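(* Let $G$ be a Lie group with Lie algebra $\mathfrak g$ and let $M$ be a $G$-manifold. The category $\mathbb X(M)^G$ of equivariant vector fields on $M$ is a topological abelian $2$-group when $\mathfrak X(M)^G$ and $C^\infty(M,\mathfrak g)^G$ are equipped with the Whitney $C^\infty$ topologies (and the space of morphisms $C^\infty(M,\mathfrak g)^G\times\mathfrak X(M)^G$ with the product topology).
   Context: A $G$-manifold is a smooth manifold with a smooth $G$-action. $\mathfrak X(M)^G$ is the space of smooth $G$-equivariant vector fields. $C^\infty(M,\mathfrak g)^G$ is the space of infinitesimal gauge transformations: smooth $\psi:M\to\mathfrak g$ with $\psi(g\cdot p)=\mathrm{Ad}(g)\psi(p)$; such $\psi$ induces $\partial(\psi)\in\mathfrak X(M)^G$, $\partial(\psi)(p)=\frac{d}{d\tau}|_0\exp(\tau\psi(p))\cdot p$. The abelian group $C^\infty(M,\mathfrak g)^G$ acts on $\mathfrak X(M)^G$ by $\psi\cdot X=X+\partial(\psi)$, and $\mathbb X(M)^G$ is the action groupoid: objects are $X\in\mathfrak X(M)^G$; morphisms are pairs $(\psi,X)$, with source $X$ and target $X+\partial(\psi)$; units are $(0,X)$; composition is $(\varphi,X+\partial(\psi))\circ(\psi,X)=(\varphi+\psi,X)$. A topological abelian $2$-group is a small category internal to topological abelian groups: the objects and the morphisms form topological abelian groups and all structure maps (source, target, unit, composition) are continuous group homomorphisms (the set of composable pairs being a topological subgroup of the product). Here the group structures are pointwise addition. The Whitney $C^\infty$ topology on $C^\infty(U,N)$ ($U,N$ manifolds) has as basis the sets $\{f\mid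 j^rf(U)\subseteq O\}$, for $r\in\mathbb Z_{\ge0}$ and $O$ open in the space $J^r(U,N)$ of $r$-jets; $\mathfrak X(M)^G$ and $C^\infty(M,\mathfrak g)^G$ carry the subspace topologies from $C^\infty(M,TM)$ and $C^\infty(M,\mathfrak g)$. *)

(* Defs.v *)
From HB Require Import structures.
From mathcomp Require Import all_boot all_order all_algebra.
From mathcomp Require Import all_classical all_reals all_analysis.
Set Implicit Arguments.
Unset Strict Implicit.
Unset Printing Implicit Defensive.
Import Order.TTheory GRing.Theory Num.Theory.
Import numFieldNormedType.Exports.
Local Open Scope classical_set_scope.
Local Open Scope ring_scope.

Section Smooth.
Context {R : realType}.
Implicit Types E F : normedModType R.

Definition iterD E F (vs : seq E) (f : E -> F) : E -> F :=
  foldr (fun v g x => 'D_v g x) f vs.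

(* Infinitely differentiable on the open set [U].  The spaces [E] used below are
   finite-dimensional, so directional derivatives capture all the derivatives. *)
Definition smooth_on E F (U : set E) (f : E -> F) : Prop :=
  forall vs x, U x -> differentiable (iterD vs f) x.

(* A family of charts, without axioms (see [is_manifold]). The carrier is a bare
   type: its topology is the one for which the charts are homeomorphisms from
   open sets, which is generated by [atlas_subbase]. *)
Record atlas E (T : Type) := Atlas {
  chart : Type;
  dom : chart -> set T;
  coord : chart -> T -> E }.

(* The expression of [h] in the chart [c], that is [h \o (coord c)^-1]; its
   values outside [coord c @` dom c] are irrelevant. *)
Definition in_chart E F T (a : atlas E T) (c : chart a) (h : T -> F) : E -> F :=
  fun x => get (h @` (dom c `&` coord c @^-1` [set x])).

Definition local_rep E F S T (a : atlas E S) (b : atlas F T)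
    (c : chart a) (c' : chart b) (f : S -> T) : E -> F :=
  in_chart c (coord c' \o f).

(* Openness of the domains of all the local representatives amounts to the
   continuity of [f]. *)
Definition smooth E F S T (a : atlas E S) (b : atlas F T) (f : S -> T) : Prop :=
  forall (c : chart a) (c' : chart b),
    let U := coord c @` (dom c `&` f @^-1` dom c') in
    open U /\ smooth_on U (local_rep c c' f).

Definition atlas_space E T (a : atlas E T) : Type := T.

Definition atlas_subbase E T (a : atlas E T) : set (set T) :=
  [set A | exists (c : chart a) (O : set E),
     open O /\ A = dom c `&` coord c @^-1` O].

End Smooth.

HB.instance Definition _ (R : realType) (E : normedModType R) (T : Type)
  (a : atlas E T) := gen_eqMixin (atlas_space a).
HB.instance Definition _ (R : realType) (E : normedModType R) (T : Type)
  (a : atlas E T) := gen_choiceMixin (atlas_space a).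
HB.instance Definition _ (R : realType) (E : normedModType R) (T : Type)
  (a : atlas E T) :=
  isSubBaseTopological.Build (atlas_space a) (atlas_subbase a) id.

Section Manifolds.
Context {R : realType}.
Implicit Types E F : normedModType R.

(* With [smooth a a id] all the sets [coord c @` (dom c `&` dom c')] are open
   and the changes of charts are smooth. *)
Record is_manifold E T (a : atlas E T) : Prop := IsManifold {
  coord_inj : forall (c : chart a) p q,
    dom c p -> dom c q -> coord c p = coord c q -> p = q;
  charts_cover : forall p, exists c : chart a, dom c p;
  charts_compatible : smooth a a id;
  manifold_hausdorff : hausdorff_space (atlas_space a);
  manifold_second_countable : @second_countable (atlas_space a) }.

Definition vector_space_atlas E : atlas E E :=
  @Atlas R E E unit (fun=> setT) (fun=> id).

Definition prod_atlas E F S T (a : atlas E S) (b : atlas F T) :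
    atlas (E * F)%type (S * T)%type :=
  @Atlas R (E * F)%type (S * T)%type (chart a * chart b)%type
    (fun c => dom c.1 `*` dom c.2)
    (fun c p => (coord c.1 p.1, coord c.2 p.2)).

(* A tangent vector at [p] is the family of its components in all the charts
   at [p], related by the differentials of the changes of charts; the component
   in a chart whose domain does not contain [p] is conventionally 0. *)
Record tangent E T (a : atlas E T) (p : T) := Tangent {
  component :> chart a -> E;
  component_change : forall c c', dom c p -> dom c' p ->
    component c' = 'd (local_rep c c' id) (coord c p) (component c);
  component_out : forall c, ~ dom c p -> component c = 0 }.

Definition tangent_bundle E T (a : atlas E T) : Type := {p : T & tangent a p}.

Definition tangent_bundle_atlas E T (a : atlas E T) :
    atlas (E * E)%type (tangent_bundle a) :=
  @Atlas R (E * E)%type (tangent_bundle a) (chart a)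
    (fun c => [set v | dom c (projT1 v)])
    (fun c v => (coord c (projT1 v), projT2 v c)).

(* The tangent space at [p] as a manifold: a finite-dimensional vector space
   with the linear coordinates given by the charts at [p]. *)
Definition tangent_space_atlas E T (a : atlas E T) (p : T) :
    atlas E (tangent a p) :=
  @Atlas R E (tangent a p) (chart a)
    (fun c => [set _ | dom c p]) (fun c v => component v c).

Definition is_differential E F S T (a : atlas E S) (b : atlas F T)
    (f : S -> T) (p : S) (q : T) (v : tangent a p) (w : tangent b q) : Prop :=
  f p = q /\
  forall (c : chart a) (c' : chart b), dom c p -> dom c' q ->
    w c' = 'd (local_rep c c' f) (coord c p) (v c).

Definition is_velocity E T (a : atlas E T) (gamma : R -> T) (p : T)
    (v : tangent a p) : Prop :=
  gamma 0 = p /\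
  forall c : chart a, dom c p ->
    (\forall t \near (0 : R), dom c (gamma t)) /\
    is_derive (0 : R^o) 1 (coord c \o gamma : R^o -> E) (v c).

End Manifolds.

Section TangentLmodule.
Context {R : realType} {E : normedModType R} {T : Type} (a : atlas E T) (p : T).
Implicit Types u v w : tangent a p.

Lemma tangent_ext u v : (forall c, u c = v c) -> u = v.
Proof.
case: u v => [u u1 u2] [v v1 v2] /= /funext uv.
by subst v; congr Tangent; exact: Prop_irrelevance.
Qed.

Definition tangent_zero : tangent a p.
Proof.
by exists (fun=> 0) => // c c' _ _; rewrite linear0.
Defined.

Definition tangent_add u v : tangent a p.
Proof.
exists (fun c => u c + v c) => [c c' pc pc'|c pc].
  by rewrite (component_change u pc pc') (component_change v pc pc') linearD.
by rewrite !component_out// addr0.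
Defined.

Definition tangent_opp u : tangent a p.
Proof.
exists (fun c => - u c) => [c c' pc pc'|c pc].
  by rewrite (component_change u pc pc') linearN.
by rewrite component_out// oppr0.
Defined.

Definition tangent_scale (k : R) u : tangent a p.
Proof.
exists (fun c => k *: u c) => [c c' pc pc'|c pc].
  by rewrite (component_change u pc pc') linearZ.
by rewrite component_out// scaler0.
Defined.

Lemma tangent_addA : associative tangent_add.
Proof. by move=> u v w; apply: tangent_ext => c /=; rewrite addrA. Qed.
Lemma tangent_addC : commutative tangent_add.
Proof. by move=> u v; apply: tangent_ext => c /=; rewrite addrC. Qed.
Lemma tangent_add0 : left_id tangent_zero tangent_add.
Proof. by move=> u; apply: tangent_ext => c /=; rewrite add0r. Qed.
Lemma tangent_addN : left_inverse tangent_zero tangent_opp tangent_add.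
Proof. by move=> u; apply: tangent_ext => c /=; rewrite addNr. Qed.

HB.instance Definition _ := gen_eqMixin (tangent a p).
HB.instance Definition _ := gen_choiceMixin (tangent a p).
HB.instance Definition _ := GRing.isZmodule.Build (tangent a p)
  tangent_addA tangent_addC tangent_add0 tangent_addN.

Lemma tangent_scaleA k l v :
  tangent_scale k (tangent_scale l v) = tangent_scale (k * l) v.
Proof. by apply: tangent_ext => c /=; rewrite scalerA. Qed.
Lemma tangent_scale1 : left_id 1 tangent_scale.
Proof. by move=> v; apply: tangent_ext => c /=; rewrite scale1r. Qed.
Lemma tangent_scaleDr : right_distributive tangent_scale +%R.
Proof. by move=> k u v; apply: tangent_ext => c /=; rewrite scalerDr. Qed.
Lemma tangent_scaleDl v : {morph tangent_scale^~ v : k l / k + l}.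
Proof. by move=> k l; apply: tangent_ext => c /=; rewrite scalerDl. Qed.

HB.instance Definition _ := GRing.Zmodule_isLmodule.Build R (tangent a p)
  tangent_scaleA tangent_scale1 tangent_scaleDr tangent_scaleDl.

End TangentLmodule.

Section SmoothClosure.
Context {R : realType}.
Implicit Types E F : normedModType R.

Lemma near_eq_differentiable E F (f g : E -> F) (x : E) :
  (\near x, f x = g x) -> differentiable f x -> differentiable g x.
Proof.
move=> fg df.
have fgx : f x = g x := nbhs_singleton fg.
have gE : g \o shift x = cst (g x) + 'd f x +o_ 0 id.
  apply/eqaddoP => e e0.
  have /eqaddoP/(_ e e0) := diff_locally df.
  have : \forall y \near 0, f (y + x) = g (y + x).
    by move: fg; rewrite (near_shift 0) subr0.
  apply: filterS2 => y /= fgy.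
  by rewrite !fctE /= fgy fgx.
have := diff_unique (diff_continuous df) gE => dE.
by apply/diff_locallyP; rewrite dE; split => //; exact: diff_continuous.
Qed.

Lemma near_eq_derive E F (f g : E -> F) (x v : E) :
  (\near x, f x = g x) -> 'D_v f x = 'D_v g x.
Proof.
move=> fg; have fgx : f x = g x := nbhs_singleton fg.
have sx : (fun h : R => h *: v + x) @ 0^' --> x.
  rewrite -[X in _ --> X]add0r -[X in X + _](scale0r v).
  apply: cvgD; last exact: cvg_cst.
  apply: cvgZr_tmp.
  exact: nbhs_dnbhs.
rewrite /derive; congr lim; rewrite predeqE => A.
have fg' : \forall h \near (0 : R)^', f (h *: v + x) = g (h *: v + x) := sx _ fg.
by split; move: fg'; apply: filterS2 => h /= <-; rewrite fgx.
Qed.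
Lemma iterD_eq E F (U : set E) (f g : E -> F) vs : open U ->
  {in U, f =1 g} -> {in U, iterD vs f =1 iterD vs g}.
Proof.
move=> oU fg; elim: vs => //= v vs IH x /set_mem Ux.
apply: near_eq_derive; near=> y; apply: IH; apply: mem_set.
by near: y; exact: open_nbhs_nbhs.
Unshelve. all: by end_near. Qed.

Lemma smooth_on_eq E F (U : set E) (f g : E -> F) : open U ->
  {in U, f =1 g} -> smooth_on U f -> smooth_on U g.
Proof.
move=> oU fg sf vs x Ux; apply: near_eq_differentiable (sf vs x Ux).
near=> y; apply: (iterD_eq vs oU fg); apply: mem_set.
by near: y; exact: open_nbhs_nbhs.
Unshelve. all: by end_near. Qed.

Lemma smooth_onD E F (U : set E) (f g : E -> F) : open U ->
  smooth_on U f -> smooth_on U g -> smooth_on U (fun x => f x + g x).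
Proof.
move=> oU sf sg.
have DE vs : {in U, (fun x => iterD vs f x + iterD vs g x) =1
                    iterD vs (fun x => f x + g x)}.
  elim: vs => //= v vs IH x /set_mem Ux.
  rewrite -[LHS]deriveD; last 2 first.
    exact/diff_derivable/(sf vs x Ux).
    exact/diff_derivable/(sg vs x Ux).
  apply: near_eq_derive; near=> y; apply: IH; apply: mem_set.
  by near: y; exact: open_nbhs_nbhs.
move=> vs x Ux.
apply: (@near_eq_differentiable _ _ (iterD vs f + iterD vs g)); last first.
  by apply: differentiableD; [exact: sf|exact: sg].
near=> y; apply: DE; apply: mem_set.
by near: y; exact: open_nbhs_nbhs.
Unshelve. all: by end_near. Qed.

Lemma smooth_on_linear E F1 F2 (U : set E) (f : E -> F1)
    (L : {linear F1 -> F2}) : open U -> continuous L ->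
  smooth_on U f -> smooth_on U (L \o f).
Proof.
move=> oU cL sf.
have dL y : differentiable L y by exact: linear_differentiable.
have DE vs : {in U, L \o iterD vs f =1 iterD vs (L \o f)}.
  elim: vs => //= v vs IH x /set_mem Ux.
  rewrite deriveE; last exact: sf.
  have -> : L ('d (iterD vs f) x v) = 'D_v (L \o iterD vs f) x.
    rewrite deriveE; last by apply: differentiable_comp => //; exact: (sf vs x Ux).
    have dfx := sf vs x Ux.
    by have /(congr1 (@^~ v)) := diff_comp dfx (dL _); rewrite diff_lin// => ->.
  apply: near_eq_derive; near=> y; apply: IH; apply: mem_set.
  by near: y; exact: open_nbhs_nbhs.
move=> vs x Ux.
apply: (@near_eq_differentiable _ _ (L \o iterD vs f)); last first.
  by apply: differentiable_comp => //; exact: sf.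
near=> y; apply: DE; apply: mem_set.
by near: y; exact: open_nbhs_nbhs.
Unshelve. all: by end_near. Qed.

Lemma in_chartE E F T (a : atlas E T) (c : chart a) (h : T -> F) p :
  is_manifold a -> dom c p -> in_chart c h (coord c p) = h p.
Proof.
move=> ma pc; apply: get_unique; first by exists p.
by move=> _ [q [qc /= cqp] <-]; rewrite (coord_inj ma qc pc cqp).
Qed.

Lemma smooth_on_lin E F1 F2 (U : set E) (f : E -> F1) (L : F1 -> F2)
    (linL : linear L) : open U -> continuous L ->
  smooth_on U f -> smooth_on U (L \o f).
Proof.
move=> oU cL sf.
pose LL : {linear F1 -> F2} := HB.pack L (GRing.isLinear.Build R F1 F2 _ L linL).
exact: (@smooth_on_linear _ _ _ _ _ LL).
Qed.

End SmoothClosure.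

Section SectionClosure.
Context {R : realType} {E : normedModType R} {T : Type} (a : atlas E T).
Hypothesis ma : is_manifold a.
Implicit Types X Y : forall p, tangent a p.

Definition smooth_section X : Prop :=
  smooth a (tangent_bundle_atlas a) (fun p => existT _ p (X p)).

Let rep X (c c' : chart a) : E -> E * E :=
  local_rep (b := tangent_bundle_atlas a) c c' (fun p => existT _ p (X p)).

Let smooth_sectionP X : smooth_section X <-> forall c c' : chart a,
  let U := coord c @` (dom c `&` dom c') in open U /\ smooth_on U (rep X c c').
Proof. by []. Qed.

Let repE X c c' p : dom c p -> rep X c c' (coord c p) = (coord c' p, X p c').
Proof. exact: in_chartE. Qed.

Let snd0 : E * E -> E * E := fun x => (0, x.2).
Let fst0 : E * E -> E * E := fun x => (x.1, - x.2).
Let diag0 : E -> E * E := fun x => (x, 0).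

Let pair_cont (U : topologicalType) (f g : U -> E) :
  continuous f -> continuous g -> continuous (fun x => (f x, g x)).
Proof. by move=> cf cg x; apply: cvg_pair; [exact: cf|exact: cg]. Qed.

Lemma smooth_section0 : smooth_section (fun=> 0).
Proof.
apply/smooth_sectionP => c c' U.
have [oU sU] : open U /\ smooth_on U (local_rep c c' id) :=
  charts_compatible ma c c'.
split => //.
apply: (@smooth_on_eq _ _ _ _ (diag0 \o local_rep c c' id)) => //.
  move=> _ /set_mem[p [pc pc'] <-].
  by rewrite repE//= /local_rep in_chartE.
apply: smooth_on_lin => //.
- by move=> k u v; congr pair; rewrite /= scaler0 addr0.
- by apply: pair_cont => x; [exact: cvg_id|exact: cvg_cst].
Qed.

Lemma smooth_sectionD X Y : smooth_section X -> smooth_section Y ->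
  smooth_section (fun p => X p + Y p).
Proof.
move=> /smooth_sectionP sX /smooth_sectionP sY; apply/smooth_sectionP => c c' U.
have [oU sXU] := sX c c'; have [_ sYU] := sY c c'; split => //.
apply: (@smooth_on_eq _ _ _ _ (fun x => rep X c c' x + (snd0 \o rep Y c c') x)) => //.
  move=> _ /set_mem[p [pc pc'] <-].
  rewrite /= !repE//=.
  by congr pair; rewrite /= addr0.
apply: smooth_onD => //; apply: smooth_on_lin => //.
- by move=> k u v; congr pair; rewrite /= scaler0 addr0.
- by apply: pair_cont => x; [exact: cvg_cst|exact: cvg_snd].
Qed.

Lemma smooth_sectionN X : smooth_section X -> smooth_section (fun p => - X p).
Proof.
move=> /smooth_sectionP sX; apply/smooth_sectionP => c c' U.
have [oU sXU] := sX c c'; split => //.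
apply: (@smooth_on_eq _ _ _ _ (fst0 \o rep X c c')) => //.
  move=> _ /set_mem[p [pc pc'] <-].
  by rewrite /= !repE.
apply: smooth_on_lin => //.
- by move=> k u v; congr pair; rewrite /= scalerN opprD.
- apply: pair_cont => x; first exact: cvg_fst.
  by apply: cvgN; exact: cvg_snd.
Qed.

End SectionClosure.

Section TangentValuedClosure.
Context {R : realType} {E F : normedModType R} {S T : Type}.
Variables (a : atlas E S) (b : atlas F T) (q : T).
Hypothesis ma : is_manifold a.
Implicit Types f g : S -> tangent b q.

Let smooth_tangent f := smooth a (tangent_space_atlas b q) f.

Let open_dom (c : chart a) (c' : chart b) :
  open (coord c @` (dom c `&` [set _ | dom c' q])).
Proof.
have [] := pselect (dom c' q) => qc'.
  have [oU _] := charts_compatible ma c c.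
  rewrite (_ : _ `&` _ = dom c `&` id @^-1` dom c)//.
  by apply/seteqP; split=> x [].
rewrite (_ : _ `&` _ = set0) ?image_set0; first exact: open0.
by apply/seteqP; split=> x [].
Qed.

Lemma smooth_tangent0 : smooth_tangent (fun=> 0).
Proof.
move=> c c' /=; split; first exact: open_dom.
apply: (@smooth_on_eq _ _ _ _ (cst 0)); first exact: open_dom.
  by move=> _ /set_mem[p [pc pc'] <-]; rewrite /local_rep in_chartE.
have iter0 (vs : seq E) : iterD vs (cst (0 : F)) = cst 0.
  by elim: vs => //= v vs ->; apply/funext => x; rewrite derive_cst.
by move=> vs x _; rewrite iter0; exact: differentiable_cst.
Qed.

Lemma smooth_tangentD f g : smooth_tangent f -> smooth_tangent g ->
  smooth_tangent (fun p => f p + g p).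
Proof.
move=> sf sg c c'; have [oU sfU] := sf c c'; have [_ sgU] := sg c c'.
split => //; apply: smooth_on_eq (smooth_onD oU sfU sgU) => //.
by move=> _ /set_mem[p [pc pc'] <-]; rewrite /local_rep !in_chartE.
Qed.

Lemma smooth_tangentN f : smooth_tangent f -> smooth_tangent (fun p => - f p).
Proof.
move=> sf c c'; have [oU sfU] := sf c c'; split => //.
apply: (@smooth_on_eq _ _ _ _
    (-%R \o local_rep (b := tangent_space_atlas b q) c c' f)) => //.
  by move=> _ /set_mem[p [pc pc'] <-]; rewrite /local_rep /= !in_chartE.
apply: smooth_on_lin => //; last exact: opp_continuous.
by move=> k u v; rewrite scalerN opprD.
Qed.

End TangentValuedClosure.

Section DifferentialClosure.
Context {R : realType} {E F : normedModType R} {S T : Type}.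
Variables (a : atlas E S) (b : atlas F T) (f : S -> T) (p : S) (q : T).
Implicit Types (v : tangent a p) (w : tangent b q).

Lemma is_differential0 : f p = q ->
  is_differential f (0 : tangent a p) (0 : tangent b q).
Proof. by move=> fpq; split=> // c c' _ _ /=; rewrite linear0. Qed.

Lemma is_differentialD v1 v2 w1 w2 : is_differential f v1 w1 ->
  is_differential f v2 w2 -> is_differential f (v1 + v2) (w1 + w2).
Proof.
move=> [fpq d1] [_ d2]; split=> // c c' pc qc' /=.
by rewrite linearD (d1 c)// (d2 c).
Qed.

Lemma is_differentialN v w :
  is_differential f v w -> is_differential f (- v) (- w).
Proof.
by move=> [fpq d]; split=> // c c' pc qc' /=; rewrite linearN (d c).
Qed.

End DifferentialClosure.

Section Whitney.
Context {R : realType} {E F : normedModType R} {S T : Type}.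
Variables (a : atlas E S) (b : atlas F T).

Record smooth_map := SmoothMap {
  smooth_fun :> S -> T;
  smooth_funP : smooth a b smooth_fun }.

Definition same_jet (r : nat) (x y : S * smooth_map) : Prop :=
  [/\ x.1 = y.1, x.2 x.1 = y.2 y.1 &
    forall (c : chart a) (c' : chart b) (vs : seq E),
      dom c x.1 -> dom c' (x.2 x.1) -> (size vs <= r)%N ->
      iterD vs (local_rep c c' x.2) (coord c x.1) =
      iterD vs (local_rep c c' y.2) (coord c y.1)].

(* An [r]-jet is a class of pairs (source, smooth map) for [same_jet r]. *)
Record jet_space (r : nat) := JetSpace {
  jet_class : set (S * smooth_map);
  jet_classP : exists x, jet_class = same_jet r x }.

Definition jet (r : nat) (f : smooth_map) (p : S) : jet_space r :=
  JetSpace (ex_intro _ (p, f) erefl).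

(* The topology of the manifold [J^r(S, T)]: a pair of charts [c], [c'] defines
   an open set of jets, with continuous coordinates the source and the
   derivatives of order at most [r] of the local representative.  Derivatives
   are recorded by their values on all lists of vectors, which in finite
   dimension amounts to recording the partial derivatives. *)
Definition jet_subbase (r : nat) : set (set (jet_space r)) :=
  [set A | exists (c : chart a) (c' : chart b) (vs : seq E)
      (O : set E) (O' : set F),
     [/\ (size vs <= r)%N, open O, open O' &
       A = [set j | exists (p : S) (f : smooth_map),
         [/\ j = jet r f p, dom c p, dom c' (f p), O (coord c p) &
             O' (iterD vs (local_rep c c' f) (coord c p))]]]].

HB.instance Definition _ := gen_eqMixin smooth_map.
HB.instance Definition _ := gen_choiceMixin smooth_map.
HB.instance Definition _ r := gen_eqMixin (jet_space r).
HB.instance Definition _ r := gen_choiceMixin (jet_space r).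
HB.instance Definition _ r :=
  isSubBaseTopological.Build (jet_space r) (@jet_subbase r) id.

(* These sets are stable under finite intersections (lift the open sets to the
   largest order of jets involved), so the topology that they generate has them
   as a basis. *)
Definition whitney_basis : set (set smooth_map) :=
  [set W | exists (r : nat) (O : set (jet_space r)),
     open O /\ W = [set f : smooth_map | forall p, O (jet r f p)]].

HB.instance Definition _ :=
  isSubBaseTopological.Build smooth_map whitney_basis id.

End Whitney.

Section LieGroups.
Variables (R : realType).

Record lieGroup (k : nat) := LieGroup {
  lie_sort :> groupType;
  lie_atlas : atlas 'rV[R]_k lie_sort;
  lie_manifold : is_manifold lie_atlas;
  lie_mul_smooth : smooth (prod_atlas lie_atlas lie_atlas) lie_atlas
    (fun x => (x.1 * x.2)%g);
  lie_inv_smooth : smooth lie_atlas lie_atlas (fun x => (x^-1)%g) }.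

Record gManifold (k : nat) (G : lieGroup k) (m : nat) := GManifold {
  mf_sort :> Type;
  mf_atlas : atlas 'rV[R]_m mf_sort;
  mf_manifold : is_manifold mf_atlas;
  act : G -> mf_sort -> mf_sort;
  act1 : forall p, act 1%g p = p;
  actM : forall g h p, act (g * h)%g p = act g (act h p);
  act_smooth : smooth (prod_atlas (lie_atlas G) mf_atlas) mf_atlas
    (fun x => act x.1 x.2) }.

End LieGroups.

Section Exponential.
Context {R : realType} {k : nat} (G : lieGroup R k).

Definition lie_algebra : Type := tangent (lie_atlas G) 1%g.
HB.instance Definition _ := GRing.Lmodule.on lie_algebra.

Definition lie_algebra_atlas : atlas 'rV[R]_k lie_algebra :=
  tangent_space_atlas (lie_atlas G) 1%g.

Definition one_parameter_subgroup (xi : lie_algebra) (gamma : R -> G) : Prop :=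
  [/\ smooth (vector_space_atlas R^o) (lie_atlas G) gamma,
      forall s t, gamma (s + t) = (gamma s * gamma t)%g &
      is_velocity gamma xi].

(* Every [xi] generates exactly one one-parameter subgroup (a theorem of Lie
   theory), so the default value 1 is never used. *)
Definition lie_exp (xi : lie_algebra) : G :=
  xget 1%g [set gamma 1 | gamma in one_parameter_subgroup xi].

(* [eta = Ad(g) xi]: the differential at 1 of the conjugation by [g]. *)
Definition is_Ad (g : G) (xi eta : lie_algebra) : Prop :=
  is_differential (fun h : G => (g * h * g^-1)%g) xi eta.

End Exponential.

Section EquivariantFields.
Context {R : realType} {k : nat} {G : lieGroup R k} {m : nat}.
Variable M : gManifold G m.
Local Notation aM := (mf_atlas M).

Record equivariant_field := EquivariantField {
  field_at :> forall p : M, tangent aM p;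
  field_smooth : smooth_section field_at;
  field_equivariant : forall (g : G) (p : M),
    is_differential (act g) (field_at p) (field_at (act g p)) }.

Record gauge := Gauge {
  gauge_at :> M -> lie_algebra G;
  gauge_smooth : smooth aM (lie_algebra_atlas G) gauge_at;
  gauge_equivariant : forall (g : G) (p : M),
    is_Ad g (gauge_at p) (gauge_at (act g p)) }.

(* [X = ∂(psi)]; this includes the existence of the derivative at [tau = 0]. *)
Definition is_induced_field (psi : gauge) (X : equivariant_field) : Prop :=
  forall p : M,
    is_velocity (fun tau : R => act (lie_exp (tau *: psi p)) p) (X p).

Lemma field_ext (X Y : equivariant_field) : (forall p, X p = Y p) -> X = Y.
Proof.
case: X Y => [X X1 X2] [Y Y1 Y2] /= XY.
have {}XY : X = Y by exact: functional_extensionality_dep.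
by subst Y; congr EquivariantField; exact: Prop_irrelevance.
Qed.

Definition field_zero : equivariant_field.
Proof.
exists (fun=> 0); first exact/smooth_section0/mf_manifold.
by move=> g p; exact: is_differential0.
Defined.

Definition field_add (X Y : equivariant_field) : equivariant_field.
Proof.
exists (fun p => X p + Y p).
  by apply: smooth_sectionD; [exact: mf_manifold|exact: field_smooth..].
by move=> g p; apply: is_differentialD; exact: field_equivariant.
Defined.

Definition field_opp (X : equivariant_field) : equivariant_field.
Proof.
exists (fun p => - X p).
  by apply: smooth_sectionN; [exact: mf_manifold|exact: field_smooth].
by move=> g p; apply: is_differentialN; exact: field_equivariant.
Defined.

Lemma field_addA : associative field_add.
Proof. by move=> X Y Z; apply: field_ext => p /=; rewrite addrA. Qed.
Lemma field_addC : commutative field_add.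
Proof. by move=> X Y; apply: field_ext => p /=; rewrite addrC. Qed.
Lemma field_add0 : left_id field_zero field_add.
Proof. by move=> X; apply: field_ext => p /=; rewrite add0r. Qed.
Lemma field_addN : left_inverse field_zero field_opp field_add.
Proof. by move=> X; apply: field_ext => p /=; rewrite addNr. Qed.

HB.instance Definition _ := gen_eqMixin equivariant_field.
HB.instance Definition _ := gen_choiceMixin equivariant_field.
HB.instance Definition _ := GRing.isZmodule.Build equivariant_field
  field_addA field_addC field_add0 field_addN.

Lemma gauge_ext (phi psi : gauge) : (forall p, phi p = psi p) -> phi = psi.
Proof.
case: phi psi => [phi h1 h2] [psi k1 k2] /= /funext phipsi.
by subst psi; congr Gauge; exact: Prop_irrelevance.
Qed.

Lemma conjg_one (g : G) : (g * 1 * g^-1 = 1)%g.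
Proof. by rewrite mulg1 mulgV. Qed.

Definition gauge_zero : gauge.
Proof.
exists (fun=> 0).
  exact/smooth_tangent0/mf_manifold.
by move=> g p; apply: is_differential0; exact: conjg_one.
Defined.

Definition gauge_add (phi psi : gauge) : gauge.
Proof.
exists (fun p => phi p + psi p).
  by apply: smooth_tangentD; [exact: mf_manifold|exact: gauge_smooth..].
by move=> g p; apply: is_differentialD; exact: gauge_equivariant.
Defined.

Definition gauge_opp (psi : gauge) : gauge.
Proof.
exists (fun p => - psi p).
  by apply: smooth_tangentN; [exact: mf_manifold|exact: gauge_smooth].
by move=> g p; apply: is_differentialN; exact: gauge_equivariant.
Defined.

Lemma gauge_addA : associative gauge_add.
Proof. by move=> X Y Z; apply: gauge_ext => p /=; rewrite addrA. Qed.
Lemma gauge_addC : commutative gauge_add.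
Proof. by move=> X Y; apply: gauge_ext => p /=; rewrite addrC. Qed.
Lemma gauge_add0 : left_id gauge_zero gauge_add.
Proof. by move=> X; apply: gauge_ext => p /=; rewrite add0r. Qed.
Lemma gauge_addN : left_inverse gauge_zero gauge_opp gauge_add.
Proof. by move=> X; apply: gauge_ext => p /=; rewrite addNr. Qed.

HB.instance Definition _ := gen_eqMixin gauge.
HB.instance Definition _ := gen_choiceMixin gauge.
HB.instance Definition _ := GRing.isZmodule.Build gauge
  gauge_addA gauge_addC gauge_add0 gauge_addN.

Definition field_map (X : equivariant_field) :
    smooth_map aM (tangent_bundle_atlas aM) :=
  SmoothMap (field_smooth X).

Definition gauge_map (psi : gauge) : smooth_map aM (lie_algebra_atlas G) :=
  SmoothMap (gauge_smooth psi).

HB.instance Definition _ :=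
  Topological.copy equivariant_field (initial_topology field_map).
HB.instance Definition _ := Topological.copy gauge (initial_topology gauge_map).

End EquivariantFields.

HB.instance Definition _ (A B : PreTopologicalZmodule.type) :=
  GRing.Zmodule.on (A * B)%type.

(* Composition is a total function, of which only the values on composable
   pairs ([source f = target g]) are relevant. *)
Record category_data := CategoryData {
  Ob : PreTopologicalZmodule.type;
  Mor : PreTopologicalZmodule.type;
  source : Mor -> Ob;
  target : Mor -> Ob;
  unit_mor : Ob -> Mor;
  comp_mor : Mor -> Mor -> Mor }.

Record topological_abelian_group (A : PreTopologicalZmodule.type) : Prop := {
  group_add_continuous : continuous (fun x : A * A => x.1 + x.2);
  group_opp_continuous : continuous (fun x : A => - x) }.

Definition composable (C : category_data) : set (Mor C * Mor C) :=
  [set fg | source fg.1 = target fg.2].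

Record small_category (C : category_data) : Prop := {
  source_unit : forall x : Ob C, source (unit_mor x) = x;
  target_unit : forall x : Ob C, target (unit_mor x) = x;
  source_comp : forall f g : Mor C, composable (f, g) ->
    source (comp_mor f g) = source g;
  target_comp : forall f g : Mor C, composable (f, g) ->
    target (comp_mor f g) = target f;
  comp_unitl : forall f : Mor C, comp_mor (unit_mor (target f)) f = f;
  comp_unitr : forall f : Mor C, comp_mor f (unit_mor (source f)) = f;
  comp_assoc : forall f g h : Mor C, composable (f, g) -> composable (g, h) ->
    comp_mor f (comp_mor g h) = comp_mor (comp_mor f g) h }.

Record topological_abelian_2group (C : category_data) : Prop := {
  is_small_category : small_category C;
  objects_group : topological_abelian_group (Ob C);
  morphisms_group : topological_abelian_group (Mor C);
  source_add : {morph @source C : f g / f + g};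
  target_add : {morph @target C : f g / f + g};
  unit_add : {morph @unit_mor C : x y / x + y};
  comp_add : forall f g f' g' : Mor C,
    composable (f, g) -> composable (f', g') ->
    comp_mor (f + f') (g + g') = comp_mor f g + comp_mor f' g';
  source_continuous : continuous (@source C);
  target_continuous : continuous (@target C);
  unit_continuous : continuous (@unit_mor C);
  comp_continuous :
    {within @composable C, continuous (fun fg => comp_mor fg.1 fg.2)} }.

(* The action groupoid in which [psi] acts on [X] by [X + d psi]. *)
Definition action_groupoid (R : realType) (k m : nat) (G : lieGroup R k)
    (M : gManifold G m) (d : gauge M -> equivariant_field M) : category_data :=
  @CategoryData (equivariant_field M) (gauge M * equivariant_field M)%type
    (fun f => f.2)
    (fun f => f.2 + d f.1)
    (fun X => (0, X))
    (fun f g => (f.1 + g.1, g.2)).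

(* Main.v *)
(** An element xi of the Lie algebra generates a unique one-parameter subgroup.
In a chart at the unit, squaring is an expanding map S with S x = 2 x + O(x^2),
and S^n (x / 2^n) converges to a map E with S (E x) = E (2 x) and
E x = x + O(x^2), which these two properties determine (Koenigs linearisation).
That uniqueness gives E x E y = E (x + y) whenever E (x / 2^n) and E (y / 2^n)
commute for all n, hence, first for rational and then by continuity for real
s and t, E (s x) E (t x) = E ((s + t) x).  So t |-> E (t xi) extends to a
one-parameter subgroup, smooth as an integral curve of a left-invariant field,
and exp (t xi) has velocity xi at t = 0.

Hence the field induced by psi is the image of psi p under the differential
at 1 of the orbit map g |-> g p, which is smooth, equivariant and linear in psi.

For the Whitney topologies, the r-jets of X + Y, - X and of the induced field
at a point depend continuously on the r-jets of X, Y and psi at that point;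
these local estimates glue along a locally finite closed cover of M. *)
From HB Require Import structures.
From mathcomp Require Import all_boot all_order all_algebra.
From mathcomp Require Import all_classical all_reals all_analysis.
From mathcomp Require Import finmap ring lra.
Require Import Defs.
Set Implicit Arguments.
Unset Strict Implicit.
Unset Printing Implicit Defensive.
Import Order.TTheory GRing.Theory Num.Theory.
Import numFieldNormedType.Exports.
Local Open Scope classical_set_scope.
Local Open Scope ring_scope.

(** * Smooth functions *)

(** [lie_exp] chooses some one-parameter subgroup and falls back on 1, so a velocity can be computed
    only once existence and uniqueness are both established. The linearisation gives them together,
    by recovering a one-parameter subgroup from its values at t / 2^n, that is from successive
    square roots. All its estimates rest on one fact: S x - 2 x has Lipschitz constant O(r) on the
    ball of radius r, the radius [d] being cut down until C d is at most 1/4. The limit E is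
    controlled through Lipschitz and quadratic bounds at 0; smoothness in t comes from the group
    law, which carries the velocity at 0 to every time.

    In charts the induced field is a combination of fixed smooth fields with the components of psi
    as coefficients. This one formula yields both its smoothness and the continuous dependence of
    its jets on those of psi.

    M may be noncompact, so the neighbourhoods of jets found at the various points cannot be
    intersected. Each is imposed only over a closed set of base points; by local finiteness,
    finitely many of these conditions matter near a given jet, and together they are still open. *)

Section SmoothFunctions.
Context {R : realType}.
Implicit Types E F : normedModType R.

(** [foldr] takes the derivative along the last vector first. Splitting the list at its end
    therefore replaces [f] by one of its derivatives, the form that inductions on smooth functions
    require. *)
Lemma iterD_rcons E F (vs : seq E) v (f : E -> F) :
  iterD (rcons vs v) f = iterD vs (fun x => 'D_v f x).
Proof. by rewrite /iterD foldr_rcons. Qed.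

Lemma open_near E (U : set E) x : open U -> U x -> \forall y \near x, U y.
Proof. by move=> oU Ux; apply: open_nbhs_nbhs. Qed.

Lemma near_eq_diff E F (f g : E -> F) x v :
  (\near x, f x = g x) -> differentiable f x -> 'd f x v = 'd g x v.
Proof.
move=> fg df; rewrite -!deriveE//; last exact: near_eq_differentiable df.
exact: near_eq_derive.
Qed.

(* A coinduction principle: [P] is a class of functions closed under
   directional derivatives. *)
Lemma smooth_on_coind E F (U : set E) (P : (E -> F) -> Prop) : open U ->
  (forall f, P f -> (forall x, U x -> differentiable f x) /\
    forall v, exists2 g, P g & forall x, U x -> 'D_v f x = g x) ->
  forall f, P f -> smooth_on U f.
Proof.
move=> oU closedP f Pf vs; elim/last_ind: vs f Pf => [|vs v IH] f Pf x Ux.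
  by have [+ _] := closedP f Pf; apply.
have [_ /(_ v)[g Pg fg]] := closedP f Pf.
rewrite iterD_rcons; apply: near_eq_differentiable (IH g Pg x Ux).
apply: filterS (open_near oU Ux) => y Uy; apply/esym/(iterD_eq vs oU).
  by move=> z /set_mem; exact: fg.
exact: mem_set.
Qed.

Lemma smooth_on_differentiable E F (U : set E) (f : E -> F) x :
  smooth_on U f -> U x -> differentiable f x.
Proof. by move=> sf; exact: (sf [::]). Qed.

Lemma smooth_on_derive E F (U : set E) (f : E -> F) v :
  smooth_on U f -> smooth_on U (fun x => 'D_v f x).
Proof. by move=> sf vs x Ux; rewrite -iterD_rcons; exact: sf. Qed.

Lemma smooth_on_subset E F (U V : set E) (f : E -> F) :
  U `<=` V -> smooth_on V f -> smooth_on U f.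
Proof. by move=> UV sf vs x /UV; exact: sf. Qed.

Lemma smooth_on_sum E F (U : set E) n (f : 'I_n -> E -> F) : open U ->
  (forall i, smooth_on U (f i)) -> smooth_on U (fun x => \sum_(i < n) f i x).
Proof.
move=> oU; elim: n f => [|n IH] f sf.
  have iter0 vs : iterD vs (fun _ : E => \sum_(i < 0) f i 0) = cst 0.
    elim: vs => [|v vs /= ->]; first by apply/funext => x; rewrite big_ord0.
    by apply/funext => x; rewrite derive_cst.
  rewrite (_ : (fun x => _) = fun=> \sum_(i < 0) f i 0).
    by move=> vs x _; rewrite iter0; exact: differentiable_cst.
  by apply/funext => x; rewrite !big_ord0.
rewrite (_ : (fun x => _) =
    fun x => f ord0 x + \sum_(i < n) f (lift ord0 i) x).
  by apply: smooth_onD => //; apply: IH => i; exact: sf.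
by apply/funext => x; rewrite big_ord_recl.
Qed.

Lemma scale_bilinear F : bilinear_for
  (GRing.Scale.Law.clone _ _ *:%R _) (GRing.Scale.Law.clone _ _ *:%R _)
  (fun (a : R^o) (v : F) => a *: v).
Proof.
split=> [v|a] k x y /=; first by rewrite scalerDl scalerA.
by rewrite scalerDr !scalerA mulrC.
Qed.

Lemma is_diff_scale E F (a : E -> R^o) (h : E -> F) x :
  differentiable a x -> differentiable h x ->
  differentiable (fun y => a y *: h y) x /\
  'd (fun y => a y *: h y) x = (fun v => a x *: 'd h x v + 'd a x v *: h x)
    :> (E -> F).
Proof.
move=> da dh.
pose B : {bilinear R^o -> F -> F} := HB.pack (fun (a : R^o) (v : F) => a *: v)
  (bilinear_isBilinear.Build R R^o F F _ _ _ (scale_bilinear F)).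
have cB : continuous (fun p : R^o * F => B p.1 p.2) by exact: scale_continuous.
have dp := differentiable_pair da dh.
have dB : differentiable (fun p : R^o * F => B p.1 p.2) (a x, h x).
  exact: differentiable_bilin.
split; first exact: (differentiable_comp dp dB).
rewrite [LHS](diff_comp dp dB) diff_bilin//.
by apply/funext => v /=; rewrite diff_pair.
Qed.

Lemma derive_scale E F (a : E -> R^o) (h : E -> F) x v :
  differentiable a x -> differentiable h x ->
  'D_v (fun y => a y *: h y) x = a x *: 'D_v h x + 'D_v a x *: h x.
Proof.
move=> da dh; have [d dE] := is_diff_scale da dh.
by rewrite !deriveE// dE.
Qed.

(** Products are not closed under differentiation, but by the Leibniz rule finite sums of products
    are: this is the class given to [smooth_on_coind] for [smooth_on_scale]. *)
Inductive sum_of_products E F (U : set E) : (E -> F) -> Prop :=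
| SumOfProducts_scale a h : smooth_on U a -> smooth_on U h ->
    sum_of_products U (fun x => (a x : R^o) *: h x)
| SumOfProducts_add f g : sum_of_products U f -> sum_of_products U g ->
    sum_of_products U (fun x => f x + g x).

Lemma smooth_on_scale E F (U : set E) (a : E -> R^o) (h : E -> F) : open U ->
  smooth_on U a -> smooth_on U h -> smooth_on U (fun x => a x *: h x).
Proof.
move=> oU sa sh; apply: (@smooth_on_coind _ _ _ (@sum_of_products E F U)) => //;
  last exact: SumOfProducts_scale.
move=> f; elim=> {f a h sa sh}[a h sa sh|f g _ [df Df] _ [dg Dg]].
  split=> [x Ux|v].
    apply: (is_diff_scale _ _).1; exact: smooth_on_differentiable Ux.
  exists (fun x => a x *: 'D_v h x + 'D_v a x *: h x).
    by apply: SumOfProducts_add; apply: SumOfProducts_scale => //;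
      exact: smooth_on_derive.
  by move=> x Ux; apply: derive_scale; exact: smooth_on_differentiable Ux.
split=> [x Ux|v].
  by apply: differentiableD; [exact: df|exact: dg].
have [f' sf' f'E] := Df v; have [g' sg' g'E] := Dg v.
exists (fun x => f' x + g' x); first exact: SumOfProducts_add.
move=> x Ux; rewrite -f'E// -g'E//.
by apply: deriveD; apply: diff_derivable; [exact: df|exact: dg].
Qed.

Lemma near_derive_comp E E' F (L : E -> E') (H : E' -> F) x v :
  differentiable L x -> differentiable H (L x) ->
  'D_v (H \o L) x = 'D_('D_v L x) H (L x).
Proof.
move=> dL dH; rewrite !deriveE//; last exact: differentiable_comp.
by rewrite diff_comp.
Qed.

(** Since [L] has constant derivatives, a derivative of [H \o L] is again a smooth function composed
    with the same [L]; coinduction then replaces a chain rule of all orders. *)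
Lemma smooth_on_affine E E' F (U : set E) (V : set E') (L : E -> E')
    (L' : E -> E') (H : E' -> F) : open U ->
  (forall x, differentiable L x) -> (forall x v, 'D_v L x = L' v) ->
  (forall x, U x -> V (L x)) -> smooth_on V H -> smooth_on U (H \o L).
Proof.
move=> oU dL DL UV sH.
apply: (@smooth_on_coind _ _ _
  [set h | exists2 H', smooth_on V H' & h = H' \o L]) => //; last by exists H.
move=> _ [H' sH' ->]; split=> [x Ux|v].
  by apply: differentiable_comp => //; apply: smooth_on_differentiable sH' (UV _ _).
exists ((fun y => 'D_(L' v) H' y) \o L).
  by exists (fun y => 'D_(L' v) H' y) => //; exact: smooth_on_derive.
move=> x Ux; rewrite near_derive_comp ?DL//.
exact: smooth_on_differentiable sH' (UV _ _).
Qed.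

Lemma smooth_on_pair E F1 F2 (U : set E) (f : E -> F1) (g : E -> F2) : open U ->
  smooth_on U f -> smooth_on U g -> smooth_on U (fun x => (f x, g x)).
Proof.
move=> oU sf sg.
apply: (@smooth_on_eq _ _ _ _ (fun x => ((fun y => (y, 0)) \o f) x +
    ((fun y => (0, y)) \o g) x)) => //.
  by move=> x _ /=; congr pair; rewrite /= ?addr0 ?add0r.
apply: smooth_onD => //; apply: smooth_on_lin => //.
- by move=> k u v; congr pair; rewrite /= scaler0 addr0.
- by move=> x; apply: cvg_pair => //=; exact: cvg_cst.
- by move=> k u v; congr pair; rewrite /= scaler0 addr0.
- by move=> x; apply: cvg_pair => //=; exact: cvg_cst.
Qed.

Lemma rV_sum_delta n (v : 'rV[R]_n) : v = \sum_j v 0 j *: 'e_j.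
Proof. exact: row_sum_delta. Qed.

Lemma smooth_on_cst E F (U : set E) (y : F) : open U -> smooth_on U (cst y).
Proof.
move=> oU; apply: (@smooth_on_coind _ _ _
  [set f : E -> F | exists y, f = cst y]) => //; last by exists y.
move=> _ [z ->]; split=> // v.
by exists (cst 0); [exists 0|move=> x _; rewrite derive_cst].
Qed.

Lemma smooth_on_id E (U : set E) : open U -> smooth_on U (@id E).
Proof.
move=> oU; apply: (@smooth_on_coind _ _ _
  [set f : E -> E | f = id \/ exists y, f = cst y]) => //; last by left.
move=> _ [->|[z ->]]; split=> // v.
  by exists (cst v); [right; exists v|move=> x _; rewrite derive_id].
by exists (cst 0); [right; exists 0|move=> x _; rewrite derive_cst].
Qed.

(** Bootstrapping: the derivative of [H \o phi] is the derivative of [H] along [W], composed with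
    [phi], so the functions of the form [H \o phi] are closed under differentiation. *)
Lemma smooth_on_integral_curve n (U : set R^o) (V : set 'rV[R]_n)
    (phi : R^o -> 'rV[R]_n) (W : 'rV[R]_n -> 'rV[R]_n) :
  open U -> open V -> smooth_on V W -> (forall t, U t -> V (phi t)) ->
  (forall t, U t -> is_derive t 1 phi (W (phi t))) -> smooth_on U phi.
Proof.
move=> oU oV sW UV Dphi.
have dphi t : U t -> differentiable phi t.
  by move=> Ut; apply/derivable1_diffP; have [] := Dphi t Ut.
apply: (@smooth_on_coind _ _ _
  [set h | exists2 H, smooth_on V H & h = H \o phi]) => //; last first.
  by exists id => //; exact: smooth_on_id.
move=> _ [H sH ->]; split=> [t Ut|v].
  by apply: differentiable_comp; [exact: dphi|exact: smooth_on_differentiable sH (UV _ _)].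
exists ((fun y => v *: \sum_j ((W y) 0 j : R^o) *: 'D_('e_j) H y) \o phi).
  eexists; last by [].
  apply: (@smooth_on_lin _ _ _ _ _ _ (fun y => v *: y)) => //.
  - by move=> k x y; rewrite scalerDr !scalerA mulrC.
  - exact: scaler_continuous.
  apply: smooth_on_sum => // j; apply: smooth_on_scale => //.
    apply: (@smooth_on_lin _ _ _ _ _ _ (fun y : 'rV[R]_n => (y 0 j : R^o))) => //.
    - by move=> k x y; rewrite !mxE.
    - exact: coord_continuous.
  exact: smooth_on_derive.
move=> t Ut; have dH := smooth_on_differentiable sH (UV _ Ut).
rewrite near_derive_comp//; last exact: dphi.
have -> : 'D_v phi t = v *: W (phi t).
  rewrite deriveE; last exact: dphi.
  rewrite -[v in LHS]mulr1 -[v * 1]/(v *: (1 : R^o)) linearZ -deriveE; last exact: dphi.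
  by have [_ ->] := Dphi t Ut.
rewrite deriveE// linearZ [W (phi t) in LHS]rV_sum_delta linear_sum /=.
by congr (_ *: _); apply: eq_bigr => j _; rewrite linearZ deriveE.
Qed.

End SmoothFunctions.

(** * Lipschitz estimates *)

Section MeanValue.
Context {R : realType}.

Lemma rV_norm_le n (v : 'rV[R]_n) (K : R) :
  0 <= K -> (forall j, `|v 0 j| <= K) -> `|v| <= K.
Proof.
move=> K0 vK; rewrite [leLHS]/Num.norm /= mx_normrE.
by apply: bigmax_le => // -[i j] _ /=; rewrite ord1.
Qed.

Lemma rV_norm_ge n (v : 'rV[R]_n) j : `|v 0 j| <= `|v|.
Proof.
rewrite [leRHS]/Num.norm /= mx_normrE.
by apply/bigmax_geP; right; exists (0, j).
Qed.

(** The norm of row vectors is the maximum of the coordinates, so the scalar mean value theorem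
    applied to each coordinate along the segment loses no constant. *)
Lemma mean_value_rV (E : normedModType R) n (f : E -> 'rV[R]_n) x y (K : R) :
  0 <= K ->
  (forall t : R, 0 <= t <= 1 -> differentiable f (t *: (y - x) + x)) ->
  (forall t : R, 0 <= t <= 1 -> `|'D_(y - x) f (t *: (y - x) + x)| <= K) ->
  `|f y - f x| <= K.
Proof.
move=> K0 df Df; apply: rV_norm_le => // j.
pose L (t : R^o) : E := t *: (y - x) + x.
pose h (t : R^o) : R^o := f (L t) 0 j.
have dL t : differentiable L t by apply: differentiableD.
have DL t : 'D_1 L t = y - x.
  rewrite /L; have -> : (fun t : R^o => t *: (y - x) + x) =
    (fun t : R^o => t *: cst (y - x) t) + cst x by [].
  have dl : derivable (fun t : R^o => t *: cst (y - x) t) t 1.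
    by apply/diff_derivable; apply: (is_diff_scale _ _).1.
  rewrite (deriveD dl (@derivable_cst _ _ _ _ _ _)).
  rewrite derive_cst derive_scale// derive_cst derive_id scaler0 add0r.
  by rewrite addr0 scale1r.
have dh (t : R^o) : 0 <= t <= 1 -> is_derive t 1 h ('D_(y - x) f (L t) 0 j).
  move=> t01; have dfL : differentiable (f \o L) t.
    by apply: differentiable_comp; [exact: dL|exact: df].
  pose c (v : 'rV[R]_n) : R^o := v 0 j.
  have linc : linear c by move=> k u v; rewrite /c !mxE.
  pose C : {linear 'rV[R]_n -> R^o} :=
    HB.pack c (GRing.isLinear.Build R _ _ _ c linc).
  have dC v : differentiable C v.
    by apply: linear_differentiable; exact: coord_continuous.
  have hE : h = C \o (f \o L) by [].
  rewrite hE; apply: DeriveDef.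
    by apply: diff_derivable; apply: differentiable_comp.
  rewrite near_derive_comp// near_derive_comp//; last exact: df.
  rewrite DL deriveE// diff_lin//; exact: coord_continuous.
have [||c c01] := @MVT_segment _ h (fun t => 'D_(y - x) f (L t) 0 j) 0 1 ler01.
- by move=> t; rewrite in_itv/= => /andP[t0 t1]; apply: dh; rewrite !ltW.
- apply: derivable_within_continuous => t; rewrite in_itv/= => t01.
  by have [] := dh _ t01.
rewrite subr0 mulr1 /h /L scale1r subrK scale0r add0r !mxE => ->.
move: c01; rewrite in_itv/= => /Df; apply: le_trans.
exact: rV_norm_ge.
Qed.

Lemma diff_linear_bound (E F : normedModType R) (f : E -> F) :
  differentiable f 0 -> f 0 = 0 ->
  exists2 C : R, 0 < C & \forall y \near (0 : E), `|f y| <= C * `|y|.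
Proof.
move=> df f0; have [k k0 dk] := linear_lipschitz (diff_continuous df).
(* [k] bounds the differential; the extra 1 absorbs the remainder of the first order expansion. *)
exists (k + 1); first by rewrite addr_gt0.
near=> y; have := diff_locallyx df y; rewrite addr0 f0 add0r => ->.
apply: (le_trans (ler_normD _ _)); rewrite mulrDl lerD//.
near: y; exact: littleoP.
Unshelve. all: by end_near. Qed.

(** The first derivatives vanish at 0, so they are O(r) on the ball of radius r; the ball is convex,
    and the mean value theorem applies along segments. Used for S x - 2 x, where it gives the
    expansion hypothesis of the linearisation. *)
Lemma small_derivative_lipschitz m n (U : set 'rV[R]_m)
    (f : 'rV[R]_m -> 'rV[R]_n) : open U -> U 0 -> smooth_on U f ->
  (forall v, 'D_v f 0 = 0) ->
  exists2 C : R, 0 < C & exists2 d : R, 0 < d &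
    forall r x y, r < d -> `|x| <= r -> `|y| <= r ->
      U x /\ `|f x - f y| <= C * r * `|x - y|.
Proof.
move=> oU U0 sf Df0.
have /choice[C] : forall j : 'I_m, exists C : R, 0 < C /\
    \forall y \near (0 : 'rV[R]_m), `|'D_('e_j) f y| <= C * `|y|.
  move=> j; have [C C0 HC] := diff_linear_bound
    (smooth_on_differentiable (smooth_on_derive 'e_j sf) U0) (Df0 _).
  by exists C; split.
move=> /all_and2[C0 HC].
(* The summand 1 keeps the constant positive in dimension 0. *)
exists (1 + \sum_j C j); first by rewrite ltr_wpDr// sumr_ge0// => j _; exact: ltW.
have : \forall y \near (0 : 'rV[R]_m),
    U y /\ forall j, `|'D_('e_j) f y| <= C j * `|y|.
  have HC' := filter_forall _ HC.
  have HU := open_near oU U0.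
  by near=> y; split; near: y; [exact: HU|exact: HC'].
move=> /nbhs_norm0P[d /= d0 Hd]; exists d => // r x y rd xr yr.
split; first by have [] := Hd x (le_lt_trans xr rd).
have r0 : 0 <= r by exact: le_trans xr.
have seg t : 0 <= t <= 1 -> `|t *: (x - y) + y| <= r.
  move=> /andP[t0 t1]; have -> : t *: (x - y) + y = (1 - t) *: y + t *: x.
    by rewrite scalerBr scalerBl scale1r addrC addrCA addrC -addrA (addrC y).
  rewrite (le_trans (ler_normD _ _))//.
  rewrite !normrZ !ger0_norm ?subr_ge0//.
  apply: (@le_trans _ _ ((1 - t) * r + t * r)); last by rewrite -mulrDl subrK mul1r.
  by rewrite lerD// ler_wpM2l// subr_ge0.
apply: mean_value_rV => [|t t01|t t01].
- by rewrite !mulr_ge0// addr_ge0// sumr_ge0// => j _; exact: ltW.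
- by have [/(smooth_on_differentiable sf)] := Hd _ (le_lt_trans (seg t t01) rd).
have [Uz Dz] := Hd _ (le_lt_trans (seg t t01) rd).
set z := t *: (x - y) + y in Uz Dz *.
rewrite deriveE; last exact: smooth_on_differentiable sf Uz.
rewrite [x - y in leLHS]rV_sum_delta linear_sum/=.
apply: (le_trans (ler_norm_sum _ _ _)).
apply: (@le_trans _ _ (\sum_j (C j * r * `|x - y|))).
  apply: ler_sum => j _; rewrite linearZ normrZ mulrC /= ler_pM//.
    rewrite -deriveE; last exact: smooth_on_differentiable sf Uz.
    by apply: (le_trans (Dz j)); rewrite ler_wpM2l ?(ltW (C0 j))// seg.
  exact: rV_norm_ge.
rewrite -!mulr_suml ler_wpM2r// ler_wpM2r//.
by rewrite lerDr.
Unshelve. all: by end_near. Qed.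

End MeanValue.

(** * Linearisation of expanding maps *)

HB.instance Definition _ (R : realType) (m n : nat) :=
  Complete.on 'M[R]_(m, n).

Section Koenigs.
Context {R : realType} {V : completeNormedModType R}.
Variables (S : V -> V) (C d : R).
Hypotheses (C0 : 0 < C) (d0 : 0 < d) (Cd : C * d <= 4^-1) (S0 : S 0 = 0).
Hypothesis S_expanding : forall r x y, r < d -> `|x| <= r -> `|y| <= r ->
  `|(S x - 2 *: x) - (S y - 2 *: y)| <= C * r * `|x - y|.

(** S^n (x / 2^n), arranged so that step n + 1 is [S] applied to step n at half the point; this is
    why the inductions below generalise over [x]. *)
Definition koenigs_iter (n : nat) (x : V) : V :=
  iter n (fun f y => S (f (2^-1 *: y))) id x.

Definition koenigs (x : V) : V := lim (koenigs_iter n x @[n --> \oo]).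

Let iterS n x : koenigs_iter n.+1 x = S (koenigs_iter n (2^-1 *: x)).
Proof. by []. Qed.

Let norm_half (x : V) : `|2^-1 *: x| = `|x| / 2.
Proof. by rewrite normrZ ger0_norm ?invr_ge0// mulrC. Qed.

Lemma expanding_lipschitz r x y : r < d -> `|x| <= r -> `|y| <= r ->
  `|S x - S y| <= (2 + C * r) * `|x - y|.
Proof.
move=> rd xr yr.
have -> : S x - S y = (S x - 2 *: x - (S y - 2 *: y)) + 2 *: (x - y).
  by rewrite scalerBr opprB addrAC !addrA !subrK.
rewrite (le_trans (ler_normD _ _))// [leRHS]mulrDl [leRHS]addrC lerD//.
  exact: S_expanding.
by rewrite normrZ ger0_norm.
Qed.

(** The form in which [Cd] is used: inside radius d / 2, C X is at most 1/8. What follows is mostly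
    linear arithmetic on these bounds. *)
Let small (X : R) : 0 <= X -> X < d / 2 ->
  0 <= C * X <= 8^-1 /\ 0 <= C * X ^+ 2 <= 8^-1 * X.
Proof.
move=> X0 Xd; have H : 0 <= C * X <= 8^-1.
  apply/andP; split; first by rewrite mulr_ge0// ltW.
  by have := ler_wpM2l (ltW C0) (ltW Xd); rewrite mulrA => H; have := Cd; lra.
split=> //; move/andP: H => [H0 H1].
by rewrite expr2 mulrA mulr_ge0// ler_wpM2r.
Qed.

(** Halving the argument divides the quadratic error by 4 and the factor 2 of [S] restores half of
    it, contributing C |x|^2. The nonlinear part of [S], at a point of norm at most 3/4 |x|, adds
    9/16 C |x|^2, and the total stays below 2 C |x|^2. *)
Let iter_bound n x : `|x| < d / 2 ->
  `|koenigs_iter n x - x| <= 2 * C * `|x| ^+ 2.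
Proof.
elim: n x => [|n IH] x xd.
  by rewrite subrr normr0 !mulr_ge0// ?exprn_ge0// ltW.
set y := 2^-1 *: x.
have yx : `|y| = `|x| / 2 by exact: norm_half.
have x0 := normr_ge0 x.
have yd : `|y| < d / 2 by rewrite yx; lra.
have := IH y yd; rewrite iterS -/y; set z := koenigs_iter n y => zy.
have zb : `|z| <= (3 / 4) * `|x|.
  rewrite -[z](subrK y) (le_trans (ler_normD _ _))// yx.
  apply: (@le_trans _ _ (2 * C * `|y| ^+ 2 + `|x| / 2)); first by rewrite lerD2r.
  by rewrite yx; have [_ /andP[]] := small x0 xd; lra.
have := @S_expanding ((3 / 4) * `|x|) z 0; rewrite S0 scaler0 subr0 subr0 subr0.
rewrite normr0 => /(_ _ _ _)H.
have {}H : `|S z - 2 *: z| <= C * (3 / 4 * `|x|) * `|z| by apply: H; lra.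
have -> : S z - x = (S z - 2 *: z) + 2 *: (z - y).
  rewrite scalerBr addrA subrK /y scalerA mulfV// ?scale1r//.
rewrite (le_trans (ler_normD _ _))// normrZ ger0_norm//.
move: zy; rewrite yx => zy.
have : C * (3 / 4 * `|x|) * `|z| <= C * (3 / 4 * `|x|) * (3 / 4 * `|x|).
  by rewrite ler_wpM2l// !mulr_ge0// ltW.
by have [_ /andP[]] := small x0 xd; lra.
Qed.

Let iter_norm n x : `|x| < d / 2 -> `|koenigs_iter n x| <= 3 / 2 * `|x|.
Proof.
move=> xd; rewrite -[koenigs_iter n x](subrK x) (le_trans (ler_normD _ _))//.
have := iter_bound n xd; have [_ /andP[]] := small (normr_ge0 x) xd; lra.
Qed.

(** On the points involved [S] has Lipschitz constant at most 9/4, while halving [x] divides a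
    quadratic bound by 4: the ratio 9/16 is below the announced 3/4. *)
Let iter_cauchy n x : `|x| < d / 2 ->
  `|koenigs_iter n.+1 x - koenigs_iter n x| <= 2 * C * `|x| ^+ 2 * (3 / 4) ^+ n.
Proof.
elim: n x => [|n IH] x xd; first by rewrite expr0 mulr1; exact: (iter_bound 1).
have x0 := normr_ge0 x.
have yd : `|2^-1 *: x| < d / 2 by rewrite norm_half; lra.
have := IH _ yd; rewrite iterS (iterS n) norm_half => IHy.
have p0 : 0 <= (3 / 4 : R) ^+ n by rewrite exprn_ge0// divr_ge0.
rewrite (exprS (3 / 4)).
have H := @expanding_lipschitz (3 / 4 * `|x|) (koenigs_iter n.+1 (2^-1 *: x))
  (koenigs_iter n (2^-1 *: x)).
apply: (le_trans (H _ _ _)); first by lra.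
- by rewrite (le_trans (iter_norm _ yd))// norm_half; lra.
- by rewrite (le_trans (iter_norm _ yd))// norm_half; lra.
have [/andP[c1 c2] _] := small x0 xd.
apply: (@le_trans _ _ ((9 / 4) * (2 * C * (`|x| / 2) ^+ 2 * (3 / 4) ^+ n))).
  by apply: ler_pM => //; lra.
move: ((3 / 4) ^+ n) p0 => p p0.
have : 0 <= C * `|x| ^+ 2 * p by rewrite !mulr_ge0// ?exprn_ge0// ltW.
set q := C * _ * _ => q0.
have -> : 9 / 4 * (2 * C * (`|x| / 2) ^+ 2 * p) = 9 / 8 * q by rewrite /q; field.
rewrite [leRHS](_ : _ = 3 / 2 * q); last by rewrite /q; field.
lra.
Qed.

(** The Lipschitz constants, renormalised by 1/2 at each step, are 1 + O(C s / 2^n), and their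
    product is bounded in [n]. The bound 1 + 2 C s reproduces itself because (C s)^2 is at most C s
    / 8. *)
Let iter_lipschitz n s x y : s < d / 2 -> `|x| <= s -> `|y| <= s ->
  `|koenigs_iter n x - koenigs_iter n y| <= (1 + 2 * C * s) * `|x - y|.
Proof.
elim: n s x y => [|n IH] s x y sd xs ys.
  by rewrite ler_peMl// lerDl !mulr_ge0// ?(le_trans _ xs)// ltW.
have s0 : 0 <= s by exact: le_trans xs.
have xd : `|2^-1 *: x| < d / 2 by rewrite norm_half; lra.
have yd : `|2^-1 *: y| < d / 2 by rewrite norm_half; lra.
rewrite !iterS.
apply: (le_trans (@expanding_lipschitz (3 / 4 * s) _ _ _ _ _)); first by lra.
- by rewrite (le_trans (iter_norm _ xd))// norm_half; lra.
- by rewrite (le_trans (iter_norm _ yd))// norm_half; lra.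
have := IH (s / 2) (2^-1 *: x) (2^-1 *: y).
rewrite -scalerBr !norm_half => /(_ _ _ _)H.
have {}H : `|koenigs_iter n (2^-1 *: x) - koenigs_iter n (2^-1 *: y)| <=
  (1 + 2 * C * (s / 2)) * (`|x - y| / 2) by apply: H; lra.
have [/andP[c1 c2] _] := small s0 sd.
have a0 : 0 <= 2 + C * (3 / 4 * s) by lra.
apply: (le_trans (ler_wpM2l a0 H)).
have c3 : (C * s) * (C * s) <= 8^-1 * (C * s) by rewrite ler_wpM2r.
rewrite [leLHS](_ : _ =
  ((2 + C * (3 / 4 * s)) * (1 + 2 * C * (s / 2)) / 2) * `|x - y|); last by field.
rewrite ler_wpM2r//; lra.
Qed.

Lemma cvg_koenigs x : `|x| < d / 2 ->
  koenigs_iter n x @[n --> \oo] --> koenigs x.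
Proof.
move=> xd; apply/cvgP; rewrite -/(cvgn (koenigs_iter ^~ x)).
have : cvgn (series (telescope (koenigs_iter ^~ x))).
  apply: normed_cvg; apply: (@series_le_cvg _ _ (geometric (2 * C * `|x| ^+ 2) (3 / 4))).
  - by move=> n /=.
  - by move=> n; rewrite geometric_ge0// ?divr_ge0// !mulr_ge0// ?exprn_ge0// ltW.
  - by move=> n; exact: iter_cauchy.
  by apply: is_cvg_geometric_series; rewrite ger0_norm; lra.
rewrite telescopeK => cv.
rewrite (_ : koenigs_iter ^~ x =
  [sequence koenigs_iter n x - koenigs_iter 0 x]_n + cst x); last first.
  by apply/funext => n /=; rewrite fctE /= subrK.
by apply: is_cvgD => //; exact: is_cvg_cst.
Qed.

Let norm_lim (u : nat -> V) l (K : R) :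
  u n @[n --> \oo] --> l -> (forall n, `|u n| <= K) -> `|l| <= K.
Proof.
move=> ul uK; apply: ler_cvg_to (cvg_norm ul) (cvg_cst K) _.
exact: nearW.
Qed.

Lemma koenigs_bound x : `|x| < d / 2 -> `|koenigs x - x| <= 2 * C * `|x| ^+ 2.
Proof.
move=> xd; apply: norm_lim (cvgB (cvg_koenigs xd) (cvg_cst x)) _ => n.
exact: iter_bound.
Qed.

Lemma koenigs_norm x : `|x| < d / 2 -> `|koenigs x| <= 3 / 2 * `|x|.
Proof.
by move=> xd; apply: norm_lim (cvg_koenigs xd) _ => n; exact: iter_norm.
Qed.

Lemma koenigs_lipschitz x y : `|x| < d / 2 -> `|y| < d / 2 ->
  `|koenigs x - koenigs y| <= 2 * `|x - y|.
Proof.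
move=> xd yd; apply: norm_lim (cvgB (cvg_koenigs xd) (cvg_koenigs yd)) _ => n.
set s := Num.max `|x| `|y|.
have sd : s < d / 2 by rewrite gt_max xd.
have s0 : 0 <= s by rewrite le_max normr_ge0.
apply: (le_trans (@iter_lipschitz n s _ _ sd _ _)).
- by rewrite le_max lexx.
- by rewrite le_max lexx orbT.
by rewrite ler_wpM2r//; have [/andP[]] := small s0 sd; lra.
Qed.

Lemma koenigs_double x : `|x| < d / 2 -> koenigs x = S (koenigs (2^-1 *: x)).
Proof.
move=> xd; have x0 := normr_ge0 x.
have yd : `|2^-1 *: x| < d / 2 by rewrite norm_half; lra.
apply: (@norm_cvg_unique _ V (koenigs_iter n.+1 x @[n --> \oo])).
  by have := cvg_koenigs xd; rewrite -(cvg_shiftS (koenigs_iter ^~ x)).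
(* The divisor 3 exceeds the Lipschitz constant 2 + 3/4 C |x| of [S], through which the recursion
   passes to the limit. *)
apply/cvgrPdist_le => e e0; have /cvgrPdist_le/(_ (e / 3)) := cvg_koenigs yd.
rewrite divr_gt0// => /(_ isT); apply: filterS => n Hn.
rewrite iterS (le_trans (@expanding_lipschitz (3 / 4 * `|x|) _ _ _ _ _))//.
- by lra.
- by rewrite (le_trans (koenigs_norm yd))// norm_half; lra.
- by rewrite (le_trans (iter_norm _ yd))// norm_half; lra.
have [/andP[c1 c2] _] := small x0 xd.
apply: (@le_trans _ _ (3 * (e / 3))); last by lra.
by apply: ler_pM => //; lra.
Qed.

Let half_pow_lt (e : R) : 0 < e -> \forall n \near \oo, (2^-1 : R) ^+ n < e.
Proof.
move=> e0; have : (2^-1 : R) ^+ n @[n --> \oo] --> (0 : R).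
  by apply: cvg_expr; rewrite ger0_norm ?invf_lt1 ?invr_ge0 ?ltr1n.
move=> /cvgr0_norm_lt/(_ _ e0); apply: filterS => n.
by rewrite ger0_norm// exprn_ge0// invr_ge0.
Qed.

(* The renormalised errors [b n] satisfy [b n <= (1 + c / 2 ^ n) b n.+1], so
   [(1 - 2 c / 2 ^ n) b n] is nondecreasing. *)
Let renormalised_error_eq0 (b : nat -> R) (c : R) N : 0 <= c ->
  2 * c * 2^-1 ^+ N < 1 -> (forall n, 0 <= b n) ->
  (forall n, (N <= n)%N -> b n <= (1 + c * 2^-1 ^+ n) * b n.+1) ->
  b n @[n --> \oo] --> 0 -> b N = 0.
Proof.
move=> c0 cN b0 bS bcvg; pose w n : R := 1 - 2 * c * 2^-1 ^+ n.
have p0 n : 0 <= (2^-1 : R) ^+ n by rewrite exprn_ge0// invr_ge0.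
have w0 n : (N <= n)%N -> 0 <= w n.
  move=> Nn; rewrite subr_ge0 (le_trans _ (ltW cN))// ler_wpM2l ?mulr_ge0//.
  by rewrite ler_wiXn2l// ?invr_ge0// invf_le1// ler1n.
have wb k : w N * b N <= w (N + k)%N * b (N + k)%N.
  elim: k => [|k IH]; first by rewrite addn0.
  apply: (le_trans IH); rewrite addnS.
  apply: (le_trans (ler_wpM2l (w0 _ (leq_addr _ _)) (bS _ (leq_addr _ _)))).
  rewrite mulrA ler_wpM2r// /w exprS.
  have := p0 (N + k)%N; set p := _ ^+ _ => p_ge0.
  have : 0 <= (c * p) * (c * p) by rewrite !mulr_ge0.
  lra.
have : w N * b N <= 0.
  apply: ler_cvg_to (cvg_cst (w N * b N)) bcvg _.
  near=> n; have /subnKC <- : (N <= n)%N by near: n; exists N.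
  apply: (le_trans (wb (n - N)%N)); rewrite ler_piMl// /w gerBl.
  by rewrite !mulr_ge0.
rewrite pmulr_rle0 ?subr_gt0// => bN.
by apply/eqP; rewrite eq_le bN b0.
Unshelve. all: by end_near. Qed.

(** The error of [koenigs] at x / 2^n is of order 4^-n, which the factor 2^n does not compensate. *)
Lemma cvg_renormalised_koenigs x : `|x| < d / 2 ->
  2 ^+ n *: koenigs (2^-1 ^+ n *: x) @[n --> \oo] --> x.
Proof.
move=> xd.
have p0 n : 0 <= (2^-1 : R) ^+ n by rewrite exprn_ge0// invr_ge0.
have P0 n : 0 <= (2 : R) ^+ n by rewrite exprn_ge0.
have Pp n : (2 : R) ^+ n * 2^-1 ^+ n = 1 by rewrite -exprMn mulfV// expr1n.
have xn n : `|2^-1 ^+ n *: x| = 2^-1 ^+ n * `|x| by rewrite normrZ ger0_norm.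
have xnd n : `|2^-1 ^+ n *: x| < d / 2.
  rewrite xn (le_lt_trans _ xd)// ler_piMl// exprn_ile1// ?invr_ge0//.
  by rewrite invf_le1// ler1n.
apply/cvgrPdist_le => e e0.
have e'0 : 0 < e / (2 * C * `|x| ^+ 2 + 1).
  by rewrite divr_gt0// ltr_wpDl// !mulr_ge0// ?exprn_ge0// ltW.
near=> n.
have -> : x - 2 ^+ n *: koenigs (2^-1 ^+ n *: x) = - (2 ^+ n *: (koenigs (2^-1 ^+ n *: x) - 2^-1 ^+ n *: x)).
  by rewrite scalerBr scalerA Pp scale1r opprB.
rewrite normrN normrZ ger0_norm//.
apply: (le_trans (ler_wpM2l (P0 n) (koenigs_bound (xnd n)))).
rewrite xn exprMn [leLHS](_ : _ = (2 ^+ n * 2^-1 ^+ n) * 2^-1 ^+ n *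
  (2 * C * `|x| ^+ 2)); last by ring.
rewrite Pp mul1r; apply: (@le_trans _ _ (2^-1 ^+ n * (2 * C * `|x| ^+ 2 + 1))).
  by rewrite ler_wpM2l// lerDl.
rewrite -ler_pdivlMr; last first.
  by rewrite ltr_wpDl// !mulr_ge0// ?exprn_ge0// ltW.
by apply/ltW; near: n; exact: half_pow_lt.
Unshelve. all: by end_near. Qed.

(** The values [v n] of [koenigs] at x / 2^n satisfy the same recursion and have the same
    renormalised limit as [u]. Since [S] expands by little more than 2 near 0, the renormalised
    distance between the two sequences can hardly shrink as n grows; but it tends to 0, so it
    vanishes from the start. *)
Lemma koenigs_unique (u : nat -> V) x : `|x| < d / 2 ->
  (forall n, `|u n| < d) -> (forall n, u n = S (u n.+1)) ->
  2 ^+ n *: u n @[n --> \oo] --> x -> u 0%N = koenigs x.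
Proof.
move=> xd ud uS ux; pose v n := koenigs (2^-1 ^+ n *: x).
have p0 n : 0 <= (2^-1 : R) ^+ n by rewrite exprn_ge0// invr_ge0.
have P0 n : 0 <= (2 : R) ^+ n by rewrite exprn_ge0.
have Pp n : (2 : R) ^+ n * 2^-1 ^+ n = 1 by rewrite -exprMn mulfV// expr1n.
have xn n : `|2^-1 ^+ n *: x| = 2^-1 ^+ n * `|x| by rewrite normrZ ger0_norm.
have xnd n : `|2^-1 ^+ n *: x| < d / 2.
  rewrite xn (le_lt_trans _ xd)// ler_piMl// exprn_ile1// ?invr_ge0//.
  by rewrite invf_le1// ler1n.
have vS n : v n = S (v n.+1).
  by rewrite /v koenigs_double// scalerA -exprS.
(* The renormalised sequence converges, hence is bounded, so [u n] has size at most A / 2^n, where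
   the Lipschitz constant of [S] is 2 + O(2^-n). *)
have [A A0 [uA vA]] : exists2 A : R, 0 <= A &
    (forall n, `|u n| <= A * 2^-1 ^+ n) /\ (forall n, `|v n| <= A * 2^-1 ^+ n).
  have [M [_ HM]] := cvg_seq_bounded (cvgP _ ux).
  pose A0 := M + 1; have HA n : `|2 ^+ n *: u n| <= A0.
    by apply: (HM A0); rewrite // ltrDl.
  exists (Num.max A0 (3 / 2 * `|x|)).
    by rewrite le_max (mulr_ge0 _ (normr_ge0 x)) ?orbT// divr_ge0.
  split=> n.
    have : `|2 ^+ n *: u n| <= A0 by apply: HA.
    rewrite normrZ ger0_norm// => Hn.
    apply: (@le_trans _ _ (A0 * 2^-1 ^+ n)).
      by have := ler_wpM2r (p0 n) Hn; rewrite mulrAC Pp mul1r.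
    by rewrite ler_wpM2r// le_max lexx.
  apply: (le_trans (koenigs_norm (xnd n))).
  by rewrite xn mulrCA mulrC ler_wpM2r// le_max lexx orbT.
pose b n := 2 ^+ n * `|u n - v n|.
have bcvg : b n @[n --> \oo] --> 0.
  have vx : 2 ^+ n *: v n @[n --> \oo] --> x by exact: cvg_renormalised_koenigs.
  have := cvg_norm (cvgB ux vx); rewrite subrr normr0.
  rewrite (_ : b = fun n => `|2 ^+ n *: u n - 2 ^+ n *: v n|); first exact.
  by apply/funext => n; rewrite /b -scalerBr normrZ ger0_norm.
pose c := C * A.
have c0 : 0 <= c by rewrite mulr_ge0// ltW.
(* Beyond [N] the bound A / 2^n is less than [d], so the Lipschitz estimate applies; the second
   condition is the one required by [renormalised_error_eq0]. *)
have [N [NA Nc]] : exists N, (forall n, (N <= n)%N -> A * 2^-1 ^+ n < d) /\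
    2 * c * 2^-1 ^+ N < 1.
  have e0 : 0 < Num.min (d / (A + 1)) (2 * c + 1)^-1.
    by rewrite lt_min divr_gt0 ?invr_gt0 ?ltr_wpDl// mulr_ge0.
  have [N _ HN] := half_pow_lt e0; exists N; split.
    move=> n /HN /=; rewrite lt_min => /andP[+ _].
    rewrite ltr_pdivlMr ?ltr_wpDl// => /le_lt_trans; apply.
    by rewrite mulrC ler_wpM2l// lerDl.
  have /= := HN N (leqnn N); rewrite lt_min => /andP[_].
  have c1 : 0 < 2 * c + 1 by rewrite ltr_wpDl// mulr_ge0.
  rewrite -[X in _ < X]mul1r ltr_pdivlMr//.
  by apply: le_lt_trans; rewrite mulrC ler_wpM2l// lerDl.
have uvN : u N = v N.
  apply/eqP; rewrite -subr_eq0 -normr_eq0.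
  have : b N = 0.
    apply: (@renormalised_error_eq0 b c N c0 Nc _ _ bcvg) => [n|n Nn].
      by rewrite mulr_ge0.
    rewrite /b (uS n) (vS n) (exprS 2) [leRHS]mulrA.
    have A1 : A * 2^-1 ^+ n.+1 < d by apply: NA; exact: leqW.
    have := expanding_lipschitz A1 (uA n.+1) (vA n.+1).
    move=> /(ler_wpM2l (P0 n)) /le_trans; apply.
    rewrite [leLHS]mulrA ler_wpM2r// (exprS 2^-1).
    have : 0 <= 2 ^+ n * (c * 2^-1 ^+ n).
      by apply: mulr_ge0 => //; apply: mulr_ge0.
    rewrite /c; move: (_ ^+ n) => p; move: (_ ^+ n) => P; lra.
  by move/eqP; rewrite mulf_eq0 expf_eq0 pnatr_eq0 andbF orFb.
(* The recursion computes each term from the next one, so the equality at [N] descends to index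
   0. *)
have {uvN} : forall k, (k <= N)%N -> u (N - k)%N = v (N - k)%N.
  elim=> [|k IH] kN; first by rewrite subn0.
  rewrite uS vS -subSn// subSS; congr S; apply: IH; exact: ltnW.
move=> /(_ N (leqnn N)); rewrite subnn => ->.
by rewrite /v expr0 scale1r.
Unshelve. all: by end_near. Qed.

End Koenigs.

(** * Differentials and velocities *)

Section DifferentiableMaps.
Context {R : realType}.
Implicit Types E F : normedModType R.

Lemma local_repE E F S T (a : atlas E S) (b : atlas F T) (c : chart a)
    (c' : chart b) (f : S -> T) p : is_manifold a -> dom c p ->
  local_rep c c' f (coord c p) = coord c' (f p).
Proof. by move=> ma pc; rewrite /local_rep in_chartE. Qed.

Lemma prod_local_repE E F E' S T S' (a : atlas E S) (b : atlas F T)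
    (e : atlas E' S') (c : chart a) (c' : chart b) (c'' : chart e)
    (f : S * T -> S') p q : is_manifold a -> is_manifold b ->
  dom c p -> dom c' q ->
  local_rep (a := prod_atlas a b) (c, c') c'' f (coord c p, coord c' q) =
  coord c'' (f (p, q)).
Proof.
move=> ma mb pc qc'; apply: get_unique; first by exists (p, q).
move=> _ [[p' q'] [[/= p'c q'c'] [pp' qq']] <-].
by rewrite (coord_inj ma p'c pc pp') (coord_inj mb q'c' qc' qq').
Qed.

(** The first clause says that [f] is expressed by these charts on a whole neighbourhood; it is what
    carries continuity. The values of [local_rep] off the chart are arbitrary, so composites have to
    be compared near the point only. *)
Definition differentiable_at E F S T (a : atlas E S) (b : atlas F T)
    (f : S -> T) (p : S) : Prop :=
  forall (c : chart a) (c' : chart b), dom c p -> dom c' (f p) ->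
    (\forall x \near coord c p,
       exists q, [/\ dom c q, dom c' (f q) & coord c q = x]) /\
    differentiable (local_rep c c' f) (coord c p).

Lemma smooth_differentiable_at E F S T (a : atlas E S) (b : atlas F T) f p :
  smooth a b f -> differentiable_at a b f p.
Proof.
move=> sf c c' pc fpc'; have [oU sU] := sf c c'.
have Up : (coord c @` (dom c `&` f @^-1` dom c')) (coord c p) by exists p.
split; last exact: smooth_on_differentiable sU Up.
by apply: filterS (open_near oU Up) => x [q [qc fqc'] <-]; exists q.
Qed.

Lemma differentiable_at_id E S (a : atlas E S) p :
  is_manifold a -> differentiable_at a a id p.
Proof. by move=> ma; apply/smooth_differentiable_at/charts_compatible. Qed.

Lemma smooth_slice_l E F E' S T S' (a : atlas E S) (b : atlas F T)
    (e : atlas E' S') (f : S * T -> S') p q :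
  is_manifold a -> is_manifold b -> smooth (prod_atlas a b) e f ->
  differentiable_at a e (fun x => f (x, q)) p.
Proof.
move=> ma mb sf c c'' pc fc''; have [c' qc'] := charts_cover mb q.
have [oU sU] := sf (c, c') c''; set U := (X in open X) in oU sU.
have Up : U (coord c p, coord c' q) by exists (p, q).
have dL : differentiable (fun x => (id x, cst (coord c' q) x)) (coord c p).
  exact: differentiable_pair.
have nU : \forall x \near coord c p,
    exists p', [/\ dom c p', dom c'' (f (p', q)) & coord c p' = x].
  have : \forall x \near coord c p, U (x, coord c' q).
    have H := open_near oU Up.
    have G := differentiable_continuous dL.
    exact: (G U H).
  apply: filterS => x.
  move=> -[[p' q'] /= [[/= p'c q'c'] fc] [<- qq']].
  by exists p'; rewrite -(coord_inj mb q'c' qc' qq').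
split=> //; apply: (@near_eq_differentiable _ _ _
  (local_rep (a := prod_atlas a b) (c, c') c'' f \o fun x => (x, coord c' q))).
  apply: filterS nU => _ [p' [p'c _ <-]].
  by rewrite local_repE//= prod_local_repE.
by apply: differentiable_comp => //; exact: smooth_on_differentiable sU Up.
Qed.

Lemma smooth_slice_r E F E' S T S' (a : atlas E S) (b : atlas F T)
    (e : atlas E' S') (f : S * T -> S') p q :
  is_manifold a -> is_manifold b -> smooth (prod_atlas a b) e f ->
  differentiable_at b e (fun y => f (p, y)) q.
Proof.
move=> ma mb sf c' c'' qc' fc''; have [c pc] := charts_cover ma p.
have [oU sU] := sf (c, c') c''; set U := (X in open X) in oU sU.
have Up : U (coord c p, coord c' q) by exists (p, q).
have dL : differentiable (fun y => (cst (coord c p) y, id y)) (coord c' q).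
  exact: differentiable_pair.
have nU : \forall y \near coord c' q,
    exists q', [/\ dom c' q', dom c'' (f (p, q')) & coord c' q' = y].
  have : \forall y \near coord c' q, U (coord c p, y).
    have H := open_near oU Up.
    have G := differentiable_continuous dL.
    exact: (G U H).
  apply: filterS => y.
  move=> -[[p' q'] /= [[/= p'c q'c'] fc] [pp' <-]].
  by exists q'; rewrite -(coord_inj ma p'c pc pp').
split=> //; apply: (@near_eq_differentiable _ _ _
  (local_rep (a := prod_atlas a b) (c, c') c'' f \o fun y => (coord c p, y))).
  apply: filterS nU => _ [q' [q'c' _ <-]].
  by rewrite local_repE//= prod_local_repE.
by apply: differentiable_comp => //; exact: smooth_on_differentiable sU Up.
Qed.

Section Composition.
Context {E1 E2 E3 : normedModType R} {S1 S2 S3 : Type}.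
Variables (a1 : atlas E1 S1) (a2 : atlas E2 S2) (a3 : atlas E3 S3).
Hypotheses (m1 : is_manifold a1) (m2 : is_manifold a2).
Variables (f : S1 -> S2) (h : S2 -> S3) (p : S1).
Hypotheses (df : differentiable_at a1 a2 f p)
  (dh : differentiable_at a2 a3 h (f p)).

Lemma local_rep_comp (c : chart a1) (c' : chart a2) (c'' : chart a3) :
  dom c p -> dom c' (f p) -> dom c'' (h (f p)) ->
  \forall x \near coord c p, exists q,
    [/\ dom c q, dom c'' (h (f q)), coord c q = x &
        local_rep c c'' (h \o f) x = local_rep c' c'' h (local_rep c c' f x)].
Proof.
move=> pc fc' hc''; have [nf drf] := df pc fc'; have [nh drh] := dh fc' hc''.
have : local_rep c c' f x @[x --> coord c p] --> coord c' (f p).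
  by rewrite -(local_repE c' f m1 pc); exact: differentiable_continuous.
move=> /(_ _ nh); apply: filterS2 nf => _ [q [qc fqc' <-]].
rewrite /= local_repE// => -[q' [q'c' hq'c'' qq']].
have {}qq' := coord_inj m2 q'c' fqc' qq'; rewrite qq' in hq'c''.
by exists q; split=> //; rewrite !local_repE.
Qed.

Lemma differentiable_at_comp : differentiable_at a1 a3 (h \o f) p.
Proof.
move=> c c'' pc hc''; have [c' fc'] := charts_cover m2 (f p).
have nr := local_rep_comp pc fc' hc''; split.
  by apply: filterS nr => x [q [? ? ? _]]; exists q.
apply: (@near_eq_differentiable _ _ _ (local_rep c' c'' h \o local_rep c c' f)).
  by apply: filterS nr => x [q [_ _ _ ->]].
have [_ drf] := df pc fc'; have [_ drh] := dh fc' hc''.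
by apply: differentiable_comp => //; rewrite local_repE.
Qed.

Lemma diff_local_rep_comp (c : chart a1) (c' : chart a2) (c'' : chart a3) v :
  dom c p -> dom c' (f p) -> dom c'' (h (f p)) ->
  'd (local_rep c c'' (h \o f)) (coord c p) v =
  'd (local_rep c' c'' h) (coord c' (f p)) ('d (local_rep c c' f) (coord c p) v).
Proof.
move=> pc fc' hc''; have nr := local_rep_comp pc fc' hc''.
have [_ drf] := df pc fc'; have [_ drh] := dh fc' hc''.
rewrite -(local_repE c' f m1 pc) in drh *.
have := diff_comp drf drh => /(congr1 (@^~ v)) /= <-.
apply: near_eq_diff; last first.
  by have [] := differentiable_at_comp pc hc''.
by apply: filterS nr => x [q [_ _ _ ->]].
Qed.

Lemma is_differential_comp (v : tangent a1 p) q (w : tangent a2 q) r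
    (z : tangent a3 r) :
  is_differential f v w -> is_differential h w z ->
  is_differential (h \o f) v z.
Proof.
move=> [fq vw] [hr wz]; split=> [|c c'' pc rc'']; first by rewrite /= fq.
have [c' qc'] := charts_cover m2 q.
subst q r.
by rewrite (diff_local_rep_comp _ pc qc' rc'') (wz c')// (vw c).
Qed.

End Composition.

Lemma is_differential_unique E F S T (a : atlas E S) (b : atlas F T)
    (f : S -> T) p (v : tangent a p) q (w w' : tangent b q) :
  is_manifold a -> is_differential f v w -> is_differential f v w' -> w = w'.
Proof.
move=> ma [_ vw] [_ vw']; apply: tangent_ext => c'.
have [qc'|qc'] := pselect (dom c' q); last by rewrite !component_out.
by have [c pc] := charts_cover ma p; rewrite (vw c)// (vw' c).
Qed.

Lemma is_differential_id E S (a : atlas E S) p (v : tangent a p) :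
  is_differential id v v.
Proof. by split=> // c c' pc pc'; exact: component_change. Qed.

Section Pushforward.
Context {E F : normedModType R} {S T : Type}.
Variables (a : atlas E S) (b : atlas F T).
Hypotheses (ma : is_manifold a) (mb : is_manifold b).
Variables (f : S -> T) (p : S) (q : T).
Hypotheses (df : differentiable_at a b f p) (fpq : f p = q).

(** All components are computed from one chart [c0] at [p]. The chain rule for [id \o f] gives their
    compatibility in the target, and the chain rule for [f \o id] their independence of [c0]. *)
Lemma pushforward_exists (v : tangent a p) :
  exists w : tangent b q, is_differential f v w.
Proof.
subst q; have [c0 pc0] := charts_cover ma p.
pose w (c' : chart b) : F := if pselect (dom c' (f p)) is left _
  then 'd (local_rep c0 c' f) (coord c0 p) (v c0) else 0.
have w_in c' : dom c' (f p) ->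
    w c' = 'd (local_rep c0 c' f) (coord c0 p) (v c0).
  by rewrite /w; case: pselect.
have w1 c c' : dom c (f p) -> dom c' (f p) ->
    w c' = 'd (local_rep c c' id) (coord c (f p)) (w c).
  move=> pc pc'; rewrite !w_in//.
  have := diff_local_rep_comp ma mb df (differentiable_at_id mb) (v c0) pc0 pc pc'.
  exact.
have w2 c : ~ dom c (f p) -> w c = 0 by rewrite /w; case: pselect.
exists (Tangent w1 w2); split=> // c c' pc fc' /=.
rewrite w_in// (component_change v pc pc0).
exact/esym/(diff_local_rep_comp ma ma (differentiable_at_id ma) df).
Qed.

Definition pushforward (v : tangent a p) : tangent b q :=
  sval (cid (pushforward_exists v)).

Lemma pushforwardP v : is_differential f v (pushforward v).
Proof. by rewrite /pushforward; case: cid. Qed.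

End Pushforward.

Section Velocities.
Context {E F : normedModType R} {S T : Type}.
Variables (a : atlas E S) (b : atlas F T).
Hypotheses (ma : is_manifold a) (mb : is_manifold b).

(** The curve is differentiated in a single chart of the source. With [f] the identity this shows
    that a velocity may be verified in one chart. *)
Lemma is_velocity_comp_chart (f : S -> T) (gamma : R -> S) (c : chart a) p
    (v : tangent a p) q (w : tangent b q) :
  differentiable_at a b f p -> is_differential f v w ->
  gamma 0 = p -> dom c p -> (\forall t \near (0 : R), dom c (gamma t)) ->
  is_derive (0 : R^o) 1 (coord c \o gamma : R^o -> E) (v c) ->
  is_velocity (f \o gamma) w.
Proof.
move=> df [fpq vw] g0 pc gc Dg; split=> [|c' qc']; first by rewrite /= g0.
subst q; have [nf drf] := df c c' pc qc'.
have dg : differentiable (coord c \o gamma : R^o -> E) 0.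
  by apply/derivable1_diffP; have [] := Dg.
have : coord c (gamma t) @[t --> (0 : R)] --> coord c p.
  by rewrite -g0; exact: differentiable_continuous dg.
move=> /(_ _ nf) nfg.
have nr : \forall t \near (0 : R), dom c (gamma t) /\ dom c' (f (gamma t)).
  apply: filterS2 gc nfg => t gtc [r [rc frc' rg]]; split=> //.
  by rewrite -(coord_inj ma rc gtc rg).
split; first by apply: filterS nr => t [].
have E0 : \forall t \near (0 : R^o), (local_rep c c' f \o (coord c \o gamma)) t =
    (coord c' \o (f \o gamma)) t.
  by apply: filterS nr => t [tc _]; rewrite /= local_repE.
have drf' : differentiable (local_rep c c' f) ((coord c \o gamma) 0).
  by rewrite /= g0.
have d1 := differentiable_comp dg drf'.
apply: DeriveDef; first exact/diff_derivable/(near_eq_differentiable E0).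
rewrite -(near_eq_derive (1 : R^o) E0) near_derive_comp//.
have [_ ->] := Dg.
by rewrite deriveE//= g0 (vw c).
Qed.

Lemma is_velocity_comp (f : S -> T) (gamma : R -> S) p
    (v : tangent a p) q (w : tangent b q) :
  differentiable_at a b f p -> is_differential f v w -> is_velocity gamma v ->
  is_velocity (f \o gamma) w.
Proof.
move=> df vw [g0 gv]; have [c pc] := charts_cover ma p.
by have [gc Dg] := gv c pc; exact: (is_velocity_comp_chart df vw g0 pc gc Dg).
Qed.

End Velocities.

Lemma is_velocity_chart E S (a : atlas E S) (gamma : R -> S) (c : chart a) p
    (v : tangent a p) :
  is_manifold a ->
  gamma 0 = p -> dom c p -> (\forall t \near (0 : R), dom c (gamma t)) ->
  is_derive (0 : R^o) 1 (coord c \o gamma : R^o -> E) (v c) ->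
  is_velocity gamma v.
Proof.
move=> ma; apply: (is_velocity_comp_chart ma (f := id)).
  exact: differentiable_at_id.
exact: is_differential_id.
Qed.

End DifferentiableMaps.

(** * One-parameter subgroups *)

(* A chart [phi], with inverse [i], centred at the unit of a group, in which
   the product is [x + y] up to higher order terms. *)
Record chart_at_unit (R : realType) (V : normedModType R) (G : groupType)
    (D : set G) (phi : G -> V) (i : V -> G) (C d : R) : Prop := ChartAtUnit {
  cu_C0 : 0 < C;
  cu_d0 : 0 < d;
  cu_Cd : C * d <= 4^-1;
  cu_phi1 : phi 1%g = 0;
  cu_dom1 : D 1%g;
  cu_iK : forall x, `|x| < d -> phi (i x) = x;
  cu_phiK : forall g, D g -> i (phi g) = g;
  cu_mul : forall x y, `|x| < d -> `|y| < d -> D (i x * i y)%g;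
  cu_square : forall r x y, r < d -> `|x| <= r -> `|y| <= r ->
    `|(phi (i x * i x)%g - 2 *: x) - (phi (i y * i y)%g - 2 *: y)| <=
    C * r * `|x - y|;
  cu_add : forall e, 0 < e -> exists2 h, 0 < h & forall x y,
    `|x| < h -> `|y| < h ->
    `|phi (i x * i y)%g - (x + y)| <= e * (`|x| + `|y|);
  cu_continuous : forall x y, `|x| < d -> `|y| < d ->
    {for (x, y), continuous (fun z : V * V => phi (i z.1 * i z.2)%g)};
  cu_inv : forall x, `|x| < d -> D (i x)^-1%g;
  cu_inv_small : forall e, 0 < e -> exists2 h, 0 < h & forall x,
    `|x| < h -> `|phi (i x)^-1%g| < e }.

Section OneParameterSubgroups.
Context {R : realType} {V : completeNormedModType R} {G : groupType}.
Variables (D : set G) (phi : G -> V) (i : V -> G) (C d : R).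
Hypothesis chart1 : chart_at_unit D phi i C d.

Let C0 := cu_C0 chart1.
Let d0 := cu_d0 chart1.
Let Cd := cu_Cd chart1.
Let phi1 := cu_phi1 chart1.
Let dom1 := cu_dom1 chart1.
Let iK := cu_iK chart1.
Let phiK := cu_phiK chart1.
Let dmul := cu_mul chart1.

Let S (x : V) : V := phi (i x * i x)%g.
Let E := koenigs S.
Let g (x : V) : G := i (E x).

Let i0 : i 0 = 1%g. Proof. by rewrite -phi1 phiK. Qed.

Let S0 : S 0 = 0. Proof. by rewrite /S i0 mulg1. Qed.

Let S_exp : forall r x y, r < d -> `|x| <= r -> `|y| <= r ->
  `|(S x - 2 *: x) - (S y - 2 *: y)| <= C * r * `|x - y|.
Proof. exact: cu_square chart1. Qed.

Let E_norm x : `|x| < d / 2 -> `|E x| <= 3 / 2 * `|x|.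
Proof. exact: koenigs_norm C0 Cd S0 S_exp x. Qed.

Let E0 : E 0 = 0.
Proof.
have /E_norm : `|0 : V| < d / 2 by rewrite normr0 divr_gt0.
by rewrite normr0 mulr0 normr_le0 => /eqP.
Qed.

Let pow_half_norm n (x : V) : `|2^-1 ^+ n *: x| = 2^-1 ^+ n * `|x|.
Proof. by rewrite normrZ ger0_norm// exprn_ge0// invr_ge0. Qed.

Let pow_half_le n (x : V) : `|2^-1 ^+ n *: x| <= `|x|.
Proof.
rewrite pow_half_norm ler_piMl// exprn_ile1// ?invr_ge0//.
by rewrite invf_le1// ler1n.
Qed.

Let pow2K n : (2 : R) ^+ n * 2^-1 ^+ n = 1.
Proof. by rewrite -exprMn mulfV// expr1n. Qed.

Let pow_half_cvg (x : V) : 2^-1 ^+ n *: x @[n --> \oo] --> (0 : V).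
Proof.
rewrite -[X in _ --> X](scale0r x); apply: cvgZr_tmp.
by apply: cvg_expr; rewrite ger0_norm ?invf_lt1 ?invr_ge0 ?ltr1n.
Qed.

(** Squaring is [S] in the chart, so [koenigs_unique] reads: a sequence of successive square roots
    near the unit is determined by its renormalised limit. *)
Lemma exp_unique (h : nat -> G) x : `|x| < d / 2 ->
  (forall n, D (h n)) -> (forall n, `|phi (h n)| < d) ->
  (forall n, h n = (h n.+1 * h n.+1)%g) ->
  2 ^+ n *: phi (h n) @[n --> \oo] --> x -> h 0%N = g x.
Proof.
move=> xd hD hd hS hx; rewrite /g -(phiK (hD 0%N)); congr i.
apply: (koenigs_unique (u := phi \o h) C0 d0 Cd S0 S_exp xd) => // n.
by rewrite /S /= !phiK// -hS.
Qed.

(** Within this radius, products and inverses of values of [g] have coordinates smaller than [d], as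
    [exp_unique] demands of its sequence. *)
Definition good_radius (rho : R) : Prop :=
  [/\ 0 < rho, rho <= d / 2,
    forall x y : V, `|x| < rho -> `|y| < rho -> `|phi (g x * g y)%g| < d &
    forall x : V, `|x| < rho -> `|phi (g x)^-1%g| < d].

Lemma good_radius_exists : exists rho, good_radius rho.
Proof.
have [h1 h10 H1] := cu_add chart1 (@ltr01 R).
have [h2 h20 H2] := cu_inv_small chart1 d0.
(* The coordinate of a product is at most twice the sum of the coordinates of its factors, hence
   below 4 h; this is the origin of d / 4. *)
pose h := Num.min (Num.min h1 h2) (d / 4).
have h0 : 0 < h by rewrite !lt_min h10 h20 divr_gt0.
have [hh1 hh2 hd] : [/\ h <= h1, h <= h2 & h <= d / 4].
  by split; rewrite /h ?ge_min ?lexx ?orbT.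
have Eh x : `|x| < h / 2 -> `|E x| < h.
  move=> xh; have xd : `|x| < d / 2 by have := d0; lra.
  by apply: (le_lt_trans (E_norm xd)); have := normr_ge0 x; lra.
exists (h / 2); split; first by rewrite divr_gt0.
- by have := d0; lra.
- move=> x y /Eh xh /Eh yh.
  have := H1 (E x) (E y) (lt_le_trans xh hh1) (lt_le_trans yh hh1).
  rewrite mul1r -/(g x) -/(g y) => H.
  rewrite -[phi _](subrK (E x + E y)) (le_lt_trans (ler_normD _ _))//.
  by have := ler_normD (E x) (E y); lra.
- by move=> x /Eh xh; apply: H2; exact: lt_le_trans hh2.
Qed.

Section GoodRadius.
Variable rho : R.
Hypothesis rhoP : good_radius rho.

Let rho0 : 0 < rho. Proof. by case: rhoP. Qed.
Let rhod (x : V) : `|x| < rho -> `|x| < d / 2.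
Proof. by move=> /lt_le_trans; apply; case: rhoP. Qed.
Let half_rho n (x : V) : `|x| < rho -> `|2^-1 ^+ n *: x| < rho.
Proof. exact: le_lt_trans. Qed.

Let Ed (x : V) : `|x| < rho -> `|E x| < d.
Proof.
move=> /rhod xd; apply: (le_lt_trans (E_norm xd)).
by have := normr_ge0 x; lra.
Qed.

Let Dg (x : V) : `|x| < rho -> D (g x).
Proof.
move=> /Ed xd; have := dmul xd (y := 0).
by rewrite i0 mulg1 normr0; apply.
Qed.

Let phig (x : V) : `|x| < rho -> phi (g x) = E x.
Proof. by move=> /Ed; exact: iK. Qed.

Let g0 : g 0 = 1%g. Proof. by rewrite /g E0 i0. Qed.

Let g_double (x : V) : `|x| < rho -> g x = (g (2^-1 *: x) * g (2^-1 *: x))%g.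
Proof.
move=> xr; have yr : `|2^-1 *: x| < rho by have := half_rho 1 xr; rewrite expr1.
rewrite {1}/g {1}/E (koenigs_double C0 Cd S0 S_exp (rhod xr)) -/E.
by rewrite /S -/(g _) phiK//; apply: dmul; exact: Ed.
Qed.

Let g_halves (x : V) n : `|x| < rho -> g (2^-1 ^+ n *: x) =
  (g (2^-1 ^+ n.+1 *: x) * g (2^-1 ^+ n.+1 *: x))%g.
Proof. by move=> xr; rewrite g_double ?half_rho// scalerA -exprS. Qed.

Let g_renorm (x : V) : `|x| < rho ->
  2 ^+ n *: phi (g (2^-1 ^+ n *: x)) @[n --> \oo] --> x.
Proof.
move=> xr; have := cvg_renormalised_koenigs C0 Cd S0 S_exp (rhod xr).
rewrite (_ : (fun n => _) = fun n => 2 ^+ n *: phi (g (2^-1 ^+ n *: x)))//.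
by apply/funext => n; rewrite phig ?half_rho.
Qed.

Let E_half_norm n (x : V) : `|x| < rho ->
  `|E (2^-1 ^+ n *: x)| <= 2^-1 ^+ n * (3 / 2 * `|x|).
Proof.
move=> xr; apply: (le_trans (E_norm (rhod (half_rho n xr)))).
by rewrite pow_half_norm mulrCA.
Qed.

Let E_half_small (x : V) h : `|x| < rho -> 0 < h ->
  \forall n \near \oo, `|E (2^-1 ^+ n *: x)| < h.
Proof.
move=> xr h0; have h'0 : 0 < h / 2 by rewrite divr_gt0.
have /cvgr0_norm_lt/(_ _ h'0) := pow_half_cvg x; apply: filterS => n hn.
apply: (le_lt_trans (E_norm (rhod (half_rho n xr)))).
by have := normr_ge0 (2^-1 ^+ n *: x); lra.
Qed.

Lemma exp_add_commuting (x y : V) : `|x| < rho -> `|y| < rho -> `|x + y| < rho ->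
  (forall n, commute (g (2^-1 ^+ n *: x)) (g (2^-1 ^+ n *: y))) ->
  (g x * g y)%g = g (x + y).
Proof.
move=> xr yr xyr cxy.
pose h n := (g (2^-1 ^+ n *: x) * g (2^-1 ^+ n *: y))%g.
have -> : (g x * g y)%g = h 0%N by rewrite /h expr0 !scale1r.
apply: exp_unique => [|n|n|n|].
- exact: rhod.
- by apply: dmul; apply: Ed; exact: half_rho.
- by case: rhoP => _ _ + _; apply; exact: half_rho.
- rewrite /h (g_halves n xr) (g_halves n yr).
  by rewrite -!mulgA; congr (_ * _)%g; rewrite !mulgA cxy.
rewrite -[X in _ --> X]addr0.
(* The first two terms tend to [x] and [y]. The last is the deviation of the product from addition,
   which by [cu_add] is negligible against 2^-n. *)
have -> : (fun n => 2 ^+ n *: phi (h n)) = (fun n =>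
    (2 ^+ n *: phi (g (2^-1 ^+ n *: x)) + 2 ^+ n *: phi (g (2^-1 ^+ n *: y))) +
    2 ^+ n *: (phi (h n) -
      (phi (g (2^-1 ^+ n *: x)) + phi (g (2^-1 ^+ n *: y))))).
  by apply/funext => n; rewrite scalerBr scalerDr addrC subrK.
apply: cvgD; first by apply: cvgD; exact: g_renorm.
apply/cvgr0Pnorm_le => e e0.
have e'0 : 0 < e / (3 / 2 * `|x| + 3 / 2 * `|y| + 1).
  by rewrite divr_gt0// ltr_wpDl// addr_ge0// mulr_ge0// divr_ge0.
have [eta eta0 H] := cu_add chart1 e'0.
near=> n.
rewrite normrZ ger0_norm ?exprn_ge0// !phig ?half_rho//.
have nx : `|E (2^-1 ^+ n *: x)| < eta by near: n; exact: E_half_small.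
have ny : `|E (2^-1 ^+ n *: y)| < eta by near: n; exact: E_half_small.
have P0 : 0 <= (2 : R) ^+ n by rewrite exprn_ge0.
apply: (le_trans (ler_wpM2l P0 (H _ _ nx ny))).
apply: (@le_trans _ _ (2 ^+ n * (e / (3 / 2 * `|x| + 3 / 2 * `|y| + 1) *
   (2^-1 ^+ n * (3 / 2 * `|x|) + 2^-1 ^+ n * (3 / 2 * `|y|))))).
  by rewrite ler_wpM2l// ler_wpM2l ?(ltW e'0)// lerD// E_half_norm.
rewrite [leLHS](_ : _ = (2 ^+ n * 2^-1 ^+ n) *
  (e / (3 / 2 * `|x| + 3 / 2 * `|y| + 1) * (3 / 2 * `|x| + 3 / 2 * `|y|)));
  last by ring.
rewrite pow2K mul1r; set z := 3 / 2 * _ + _ in e'0 *.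
have z1 : z + 1 != 0 by rewrite gt_eqF// ltr_wpDl// addr_ge0// mulr_ge0// divr_ge0.
by rewrite -[leRHS](divfK z1) ler_wpM2l ?(ltW e'0)// lerDl.
Unshelve. all: by end_near. Qed.

(** Inverses of successive square roots are again successive square roots. Their renormalised limit
    is -x because the product with the original roots, additive to first order, is the unit. *)
Lemma exp_opp (x : V) : `|x| < rho -> (g x)^-1%g = g (- x).
Proof.
move=> xr; pose h n := (g (2^-1 ^+ n *: x))^-1%g.
have -> : (g x)^-1%g = h 0%N by rewrite /h expr0 scale1r.
have hD n : D (h n) by apply: (cu_inv chart1); apply: Ed; exact: half_rho.
apply: exp_unique => [||n|n|]; rewrite ?normrN//.
- exact: rhod.
- by case: rhoP => _ _ _; apply; exact: half_rho.
- by rewrite /h (g_halves n xr) invgM.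
have -> : (fun n => 2 ^+ n *: phi (h n)) = (fun n =>
    2 ^+ n *: (phi (g (2^-1 ^+ n *: x)) + phi (h n)) -
    2 ^+ n *: phi (g (2^-1 ^+ n *: x))).
  by apply/funext => n; rewrite -scalerBr addrAC subrr add0r.
rewrite -[X in _ --> X]add0r; apply: cvgB; last exact: g_renorm.
apply/cvgr0Pnorm_le => e e0.
(* The bound 1/2 gives |b| <= 3 |a|, which makes the error relative to |a| alone; the 6 in the other
   bound is then 4 times 3/2. *)
have e'0 : 0 < Num.min (1 / 2) (e / (6 * `|x| + 1)).
  by rewrite lt_min divr_gt0//= divr_gt0// ltr_wpDl// mulr_ge0// divr_ge0.
have [eta eta0 H] := cu_add chart1 e'0.
have [eta' eta'0 H'] := cu_inv_small chart1 eta0.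
near=> n.
rewrite normrZ ger0_norm ?exprn_ge0// phig ?half_rho//.
have nx : `|E (2^-1 ^+ n *: x)| < eta by near: n; exact: E_half_small.
have nh : `|phi (h n)| < eta.
  by apply: H'; near: n; exact: E_half_small.
have := H _ _ nx nh; rewrite (phiK (hD n)) -/(g _) mulgV phi1 sub0r normrN.
set a := E _; set b := phi (h n); set k := Num.min _ _ => Hab.
have k2 : k <= 1 / 2 by rewrite ge_min lexx.
have ke : k <= e / (6 * `|x| + 1) by rewrite ge_min lexx orbT.
have ba : `|b| <= 3 * `|a|.
  have : `|b| <= `|a + b| + `|a|.
    by rewrite -[in leLHS](addKr a b) addrC (le_trans (ler_normB _ _)).
  have : k * (`|a| + `|b|) <= 1 / 2 * (`|a| + `|b|) by rewrite ler_wpM2r// addr_ge0.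
  lra.
have P0 : 0 <= (2 : R) ^+ n by rewrite exprn_ge0.
have k0 : 0 <= k by exact: ltW.
apply: (@le_trans _ _ (2 ^+ n * (k * (4 * (2^-1 ^+ n * (3 / 2 * `|x|)))))).
  rewrite ler_wpM2l// (le_trans Hab)// ler_wpM2l//.
  by have := E_half_norm n xr; rewrite -/a; lra.
rewrite mulrCA (mulrCA 4) (mulrA (2 ^+ n)) pow2K mul1r.
have X0 : 0 < 6 * `|x| + 1 by rewrite ltr_wpDl// mulr_ge0// divr_ge0.
move: ke; rewrite ler_pdivlMr//; lra.
Unshelve. all: by end_near. Qed.

Let exp_natmul n (x : V) : `|n%:R *: x| < rho -> g (n%:R *: x) = (g x ^+ n)%g.
Proof.
elim: n x => [|n IH] x nx; first by rewrite scale0r g0.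
have nle k : (k <= n.+1)%N -> `|k%:R *: x| < rho.
  move=> kn; apply: le_lt_trans nx; rewrite !normrZ ler_wpM2r//.
  by rewrite !ger0_norm ?ler_nat.
have xr : `|x| < rho by have := nle 1%N isT; rewrite scale1r.
rewrite expgSr -IH ?nle// exp_add_commuting ?nle// ?nle//.
- by rewrite -[X in _ + X]scale1r -scalerDl -natr1.
- by rewrite -[X in _ + X]scale1r -scalerDl natr1.
move=> j; rewrite scalerA mulrC -scalerA IH.
  by apply: commute_sym; apply: commuteX; exact: commute_refl.
by rewrite scalerA mulrC -scalerA half_rho// nle.
Qed.

(** For a rational [s] both elements are powers of a common root of [g x]; the general case is a
    limit of rational ones. *)
Let exp_commute_unit (x : V) (s : R) : `|x| < rho -> 0 <= s <= 1 ->
  commute (g (s *: x)) (g x).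
Proof.
move=> xr /andP[s0 s1].
(* [r n] approximates [s] from below with denominator n + 1, so it remains in the unit interval and
   its multiples of [x] never leave the good radius. *)
pose p n := Num.trunc (s * n.+1%:R); pose r n : R := (p n)%:R / n.+1%:R.
have n0 n : 0 < n.+1%:R :> R by rewrite ltr0n.
have rs n : 0 <= s - r n < n.+1%:R^-1.
  have /truncn_itv/andP[h1 h2] : 0 <= s * n.+1%:R by rewrite mulr_ge0.
  rewrite subr_ge0 ler_pdivrMr// h1/= ltrBlDl -[X in _ + X]mul1r -mulrDl.
  by rewrite ltr_pdivlMr// natr1.
have r01 n : 0 <= r n <= 1.
  rewrite divr_ge0//=; have /andP[+ _] := rs n; rewrite subr_ge0.
  by move=> /le_trans; apply.
have scale_rho t : 0 <= t <= 1 -> `|t *: x| < rho.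
  move=> /andP[t0 t1]; rewrite normrZ ger0_norm// (le_lt_trans _ xr)//.
  by rewrite ler_piMl.
have rE n : r n *: x = (p n)%:R *: (n.+1%:R^-1 *: x) by rewrite scalerA.
have xE n : x = n.+1%:R *: (n.+1%:R^-1 *: x).
  by rewrite scalerA mulfV ?gt_eqF// scale1r.
have cr n : commute (g (r n *: x)) (g x).
  rewrite {2}(xE n) rE !exp_natmul -?rE -?xE ?scale_rho//.
  exact/commuteX2/commute_refl.
have r_cvg : r n @[n --> \oo] --> s.
  apply/cvgrPdist_lt => e e0; near=> n.
  have /andP[h1 h2] := rs n; rewrite ger0_norm// (lt_trans h2)//.
  near: n; exact: near_infty_natSinv_lt (PosNum e0).
have sr : `|s *: x| < rho by apply: scale_rho; rewrite s0.
have E_cvg : E (r n *: x) @[n --> \oo] --> E (s *: x).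
  apply/cvgrPdist_le => e e0.
  have /cvgrPdist_le/(_ (e / 2 / (`|x| + 1))) := r_cvg.
  have x1 : 0 < `|x| + 1 by rewrite ltr_wpDl.
  rewrite !divr_gt0// => /(_ isT); apply: filterS => n Hn.
  rewrite (le_trans (koenigs_lipschitz C0 Cd S0 S_exp (rhod sr)
    (rhod (scale_rho _ (r01 n)))))// -scalerBl normrZ.
  move: Hn; rewrite ler_pdivlMr// => Hn.
  have : `|s - r n| * `|x| <= `|s - r n| * (`|x| + 1) by rewrite ler_wpM2l// lerDl.
  lra.
(* Continuity of the product is known in the chart, so the commutation is passed to the limit there
   and carried back by [phiK]. *)
pose mu (z : V * V) := phi (i z.1 * i z.2)%g.
have c1 : mu (E (r n *: x), E x) @[n --> \oo] --> mu (E (s *: x), E x).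
  have cp : (E (r n *: x), E x) @[n --> \oo] --> (E (s *: x), E x).
    by apply: cvg_pair => //; exact: cvg_cst.
  exact: (continuous_cvg _ (cu_continuous chart1 (Ed sr) (Ed xr)) cp).
have c2 : mu (E x, E (r n *: x)) @[n --> \oo] --> mu (E x, E (s *: x)).
  have cp : (E x, E (r n *: x)) @[n --> \oo] --> (E x, E (s *: x)).
    by apply: cvg_pair => //; exact: cvg_cst.
  exact: (continuous_cvg _ (cu_continuous chart1 (Ed xr) (Ed sr)) cp).
have muE : mu (E (s *: x), E x) = mu (E x, E (s *: x)).
  apply: (@norm_cvg_unique _ V (mu (E (r n *: x), E x) @[n --> \oo])) => //.
  have -> : (fun n => mu (E (r n *: x), E x)) = fun n => mu (E x, E (r n *: x)).
    by apply/funext => n; rewrite /mu /= [(i _ * i _)%g](cr n).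
  exact: c2.
rewrite /commute -[LHS]phiK; last by apply: dmul; exact: Ed.
rewrite -[RHS]phiK; last by apply: dmul; exact: Ed.
by congr i.
Unshelve. all: by end_near. Qed.

(** By symmetry the ratio s / t may be taken in [-1, 1]. A negative ratio is reduced to a positive
    one by [exp_opp], as commuting with an element and with its inverse are equivalent. *)
Let exp_commute (s t : R) (x : V) : `|s *: x| < rho -> `|t *: x| < rho ->
  commute (g (s *: x)) (g (t *: x)).
Proof.
wlog st : s t / `|s| <= `|t| => [H sr tr|sr tr].
  by have [/H|/ltW/H] := leP `|s| `|t|; [apply|move=> h; exact/commute_sym/h].
have [t0|t0] := eqVneq t 0.
  by rewrite t0 scale0r g0; exact: commute1.
have -> : s *: x = (s / t) *: (t *: x) by rewrite scalerA divfK.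
have rt : `|s / t| <= 1 by rewrite normf_div ler_pdivrMr ?normr_gt0// mul1r.
have [r0|r0] := leP 0 (s / t).
  by apply: exp_commute_unit => //; rewrite r0; rewrite ger0_norm in rt.
have -> : (s / t) *: (t *: x) = - (- (s / t) *: (t *: x)) by rewrite scaleNr opprK.
have r1 : 0 <= - (s / t) <= 1 by rewrite oppr_ge0 ltW//= -(ltr0_norm r0).
rewrite -exp_opp.
  apply/commute_sym/commuteV/commute_sym; exact: exp_commute_unit.
rewrite normrZ ger0_norm; last by case/andP: r1.
by apply: le_lt_trans tr; rewrite ler_piMl//; case/andP: r1.
Qed.

Lemma exp_add (s t : R) (x : V) :
  `|s *: x| < rho -> `|t *: x| < rho -> `|(s + t) *: x| < rho ->
  (g (s *: x) * g (t *: x))%g = g ((s + t) *: x).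
Proof.
move=> sr tr str; rewrite scalerDl exp_add_commuting -?scalerDl// => n.
rewrite !scalerA; apply: exp_commute; rewrite -scalerA; exact: half_rho.
Qed.

(* [g] is only controlled near 0; by [chart_expE] the choice of [n] is
   immaterial. *)
Definition chart_exp (x : V) : G :=
  let n := (Num.trunc (`|x| / rho)).+1 in (g (n%:R^-1 *: x) ^+ n)%g.

(** Two admissible numbers of parts, n and k + 1, are compared through the common subdivision into n
    (k + 1) parts. *)
Lemma chart_expE n (x : V) : (0 < n)%N -> `|n%:R^-1 *: x| < rho ->
  chart_exp x = (g (n%:R^-1 *: x) ^+ n)%g.
Proof.
rewrite /chart_exp; move: (Num.trunc _) (truncnS_gt (`|x| / rho)) => k.
rewrite ltr_pdivrMr// => kx n0 nr.
have kr : `|k.+1%:R^-1 *: x| < rho.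
  by rewrite normrZ ger0_norm ?invr_ge0// ltr_pdivrMl// ltr0n.
have n_neq0 : n%:R != 0 :> R by rewrite pnatr_eq0 -lt0n.
have E1 : k.+1%:R^-1 *: x = n%:R *: ((n * k.+1)%:R^-1 *: x).
  by rewrite scalerA natrM invfM mulrA mulfV// mul1r.
have E2 : n%:R^-1 *: x = k.+1%:R *: ((n * k.+1)%:R^-1 *: x).
  by rewrite scalerA natrM invfM mulrCA mulfV ?pnatr_eq0// mulr1.
by rewrite E1 E2 !exp_natmul -?E1 -?E2// -!expgnA mulnC.
Qed.

Lemma chart_exp_small (x : V) : `|x| < rho -> chart_exp x = g x.
Proof. by move=> xr; rewrite (@chart_expE 1) ?invr1 ?scale1r. Qed.

Let large n (x : V) : (Num.trunc (`|x| / rho) <= n)%N ->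
  `|n.+1%:R^-1 *: x| < rho.
Proof.
rewrite truncn_le_nat ltr_pdivrMr// => nx.
by rewrite normrZ ger0_norm ?invr_ge0// ltr_pdivrMl// ltr0n.
Qed.

Lemma chart_exp_add (s t : R) (x : V) :
  chart_exp ((s + t) *: x) = (chart_exp (s *: x) * chart_exp (t *: x))%g.
Proof.
pose N y := Num.trunc (`|y : V| / rho).
pose n := (N (s *: x) + N (t *: x) + N ((s + t)%R *: x))%N.
have sr : `|n.+1%:R^-1 *: (s *: x)| < rho by apply: large; rewrite /n -addnA leq_addr.
have tr : `|n.+1%:R^-1 *: (t *: x)| < rho.
  by apply: large; rewrite /n addnAC leq_addl.
have str : `|n.+1%:R^-1 *: ((s + t) *: x)| < rho by apply: large; rewrite /n leq_addl.
rewrite !(@chart_expE n.+1)// -expgMn.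
  congr (_ ^+ _)%g; rewrite !scalerA !mulrDr in sr tr str *.
  by rewrite exp_add.
by rewrite !scalerA in sr tr *; exact: exp_commute.
Qed.

(** For [N] large, the values of [gamma] at t / 2^(N + n) are successive square roots near the unit,
    so [exp_unique] identifies the one at t / 2^N; raising to the power 2^N gives the value at
    [t]. *)
Lemma one_parameter_unique (gamma : R -> G) x :
  (forall s t, gamma (s + t) = (gamma s * gamma t)%g) ->
  (\forall t \near (0 : R), D (gamma t) /\ `|phi (gamma t)| < d) ->
  (forall t, 2 ^+ n *: phi (gamma (2^-1 ^+ n * t)) @[n --> \oo] --> t *: x) ->
  forall t, gamma t = chart_exp (t *: x).
Proof.
move=> gammaD gamma_near gamma_cvg t.
have pow_cvg : 2^-1 ^+ n * t @[n --> \oo] --> (0 : R).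
  rewrite -[X in _ --> X](mul0r t); apply: cvgMr_tmp.
  by apply: cvg_expr; rewrite ger0_norm ?invf_lt1 ?invr_ge0 ?ltr1n.
have [N _ HN] : \forall n \near \oo, [/\ D (gamma (2^-1 ^+ n * t)),
    `|phi (gamma (2^-1 ^+ n * t))| < d & `|2^-1 ^+ n *: (t *: x)| < rho].
  have H1 : \forall n \near \oo, D (gamma (2^-1 ^+ n * t)) /\
      `|phi (gamma (2^-1 ^+ n * t))| < d by exact: (pow_cvg _ gamma_near).
  have /cvgr0_norm_lt/(_ _ rho0) := pow_half_cvg (t *: x).
  by move: H1; apply: filterS2 => n [].
have gamma_pow (s : R) n : gamma s = (gamma (2^-1 ^+ n * s)%R ^+ (2 ^ n)%N)%g.
  elim: n => [|n ->]; first by rewrite expr0 mul1r.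
  have -> : 2^-1 ^+ n * s = 2^-1 ^+ n.+1 * s + 2^-1 ^+ n.+1 * s :> R.
    by rewrite exprS; field.
  by rewrite gammaD -expg2 -expgnA expnS.
have nn n : [/\ D (gamma (2^-1 ^+ (N + n) * t)),
    `|phi (gamma (2^-1 ^+ (N + n) * t))| < d & `|2^-1 ^+ N *: (t *: x)| < rho].
  by have [] := HN (N + n)%N (leq_addr _ _); have [] := HN N (leqnn N).
rewrite (@chart_expE (2 ^ N)) ?expn_gt0// natrX -exprVn; last by case: (nn 0%N).
rewrite (gamma_pow t N); congr (_ ^+ _)%g.
have -> : gamma (2^-1 ^+ N * t) = gamma (2^-1 ^+ (N + 0) * t) by rewrite addn0.
apply: (@exp_unique (fun n => gamma (2^-1 ^+ (N + n) * t))) => [|n|n|n|].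
- by apply: rhod; case: (nn 0%N).
- by case: (nn n).
- by case: (nn n).
- by rewrite -gammaD addnS exprS; congr gamma; field.
rewrite scalerA; have := gamma_cvg (2^-1 ^+ N * t).
by under eq_fun do rewrite mulrA -exprD addnC.
Qed.

End GoodRadius.

End OneParameterSubgroups.

Lemma derive_pair (R : realType) (E F1 F2 : normedModType R) (f : E -> F1)
    (g : E -> F2) x v : differentiable f x -> differentiable g x ->
  'D_v (fun y => (f y, g y)) x = ('D_v f x, 'D_v g x).
Proof.
move=> df dg; rewrite !deriveE//; last exact: differentiable_pair.
by rewrite diff_pair.
Qed.

(** * The group law in a chart centred at the unit *)

Section UnitChart.
Context {R : realType} {k : nat} (G : lieGroup R k).
Local Notation aG := (lie_atlas G).
Local Notation V := 'rV[R]_k.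
Let mG : is_manifold aG := lie_manifold G.
Variable c : chart aG.
Hypothesis c1 : dom c (1%g : G).

Let e : V := coord c (1%g : G).

Definition centred_coord (g : G) : V := coord c g - e.
Definition centred_coord_inv (x : V) : G :=
  xget 1%g [set g : G | dom c g /\ coord c g = x + e].
Local Notation phi := centred_coord.
Local Notation i := centred_coord_inv.

Let m : V * V -> V := local_rep (a := prod_atlas aG aG) (c, c) c
  (fun x : G * G => (x.1 * x.2)%g).
Let U : set (V * V) := (fun p : G * G => (coord c p.1, coord c p.2)) @`
  ((dom c `*` dom c) `&` [set p | dom c (p.1 * p.2)%g]).

Let oU : open U. Proof. by have [] := @lie_mul_smooth _ _ G (c, c) c. Qed.
Let sm : smooth_on U m. Proof. by have [] := @lie_mul_smooth _ _ G (c, c) c. Qed.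
Let Ue : U (e, e). Proof. by exists (1, 1)%g; rewrite //= mulg1. Qed.

Let phiK g : dom c g -> i (phi g) = g.
Proof.
move=> gc; rewrite /i /phi subrK.
by case: xgetP => [h -> [hc]|/(_ g)[]//]; exact: coord_inj.
Qed.

(** A pair of coordinates in the open domain [U] of the product comes from elements of the chart
    whose product is in the chart too, so a single radius provides all five properties. *)
Let mul_radius : exists2 d, 0 < d & forall x y, `|x| < d -> `|y| < d ->
  [/\ U ((x, y) + (e, e)), dom c (i x), phi (i x) = x, dom c (i x * i y)%g &
      phi (i x * i y)%g = m ((x, y) + (e, e)) - e].
Proof.
have := open_near oU Ue; rewrite (near_shift (0 : V * V)) => /nbhs_norm0P[d /= d0 Hd].
exists d => // x y xd yd.
have Uxy : U ((x, y) + (e, e)).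
  have := Hd (x, y); rewrite /= prod_normE gt_max /= xd yd => /(_ isT).
  by rewrite subr0.
split=> //; case: Uxy => -[g h] [[/= gc hc] ghc] [gx hy].
all: have -> : i x = g by rewrite -(phiK gc) /phi gx addrK.
- by [].
- by rewrite /phi gx addrK.
- by have -> : i y = h by rewrite -(phiK hc) /phi hy addrK.
have -> : i y = h by rewrite -(phiK hc) /phi hy addrK.
by rewrite /phi /m -[(x, y) + _]/(x + e, y + e) -gx -hy prod_local_repE.
Qed.

Let open_norm_lt (W : normedModType R) (d : R) : open [set x : W | `|x| < d].
Proof.
apply: (@open_comp _ _ (fun x : W => `|x|) [set y : R | y < d]).
  by move=> x _; exact: norm_continuous.
exact: open_lt.
Qed.

(** [M] is the product in centred coordinates. Its differential at 0 is addition, which gives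
    [cu_add]; hence M (x, x) - 2 x has zero derivative at 0, and [small_derivative_lipschitz] gives
    [cu_square]. *)
Lemma chart_at_unit_exists : exists C d, chart_at_unit (dom c) phi i C d.
Proof.
have [d1 d10 mulP] := mul_radius.
pose B2 : set (V * V) := [set z | `|z| < d1]; pose B1 : set V := [set x | `|x| < d1].
have oB2 : open B2 by exact: open_norm_lt.
have oB1 : open B1 by exact: open_norm_lt.
pose M (z : V * V) := m (z + (e, e)) - e.
have B2P x y : `|x| < d1 -> `|y| < d1 -> B2 (x, y).
  by move=> xd yd; rewrite /B2 /= prod_normE gt_max /= xd.
have ME x y : `|x| < d1 -> `|y| < d1 -> M (x, y) = phi (i x * i y)%g.
  by move=> xd yd; have [_ _ _ _ ->] := mulP _ _ xd yd.
have sM : smooth_on B2 M.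
  apply: smooth_onD => //; last exact: smooth_on_cst.
  apply: (@smooth_on_affine _ _ _ _ B2 U (fun z => z + (e, e)) id) => //.
  - by move=> z v; rewrite deriveD// derive_cst derive_id addr0.
  - move=> [x y]; rewrite /B2 /= prod_normE gt_max /= => /andP[xd yd].
    by have [] := mulP x y xd yd.
have nd1 : `|0 : V| < d1 by rewrite normr0.
have i0 : i 0 = 1%g by rewrite -(phiK c1) /phi subrr.
have phi1 : phi 1%g = 0 by rewrite /phi subrr.
have Mx0 x : `|x| < d1 -> M (x, 0) = x.
  by move=> xd; rewrite ME// i0 mulg1; have [] := mulP x x xd xd.
have M0y y : `|y| < d1 -> M (0, y) = y.
  by move=> yd; rewrite ME// i0 mul1g; have [] := mulP y y yd yd.
have dM0 : differentiable M 0.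
  by apply: smooth_on_differentiable sM _; exact: B2P.
(* The unit laws make [M] the identity on each of the two axes, so its differential is the identity
   on both summands. *)
have DM v w : 'd M 0 (v, w) = v + w.
  have -> : (v, w) = (v, 0) + (0, w) by congr pair; rewrite /= ?addr0 ?add0r.
  rewrite linearD; congr (_ + _).
    pose L (x : V) : V * V := (id x, cst 0 x).
    have dL x : differentiable L x by exact: differentiable_pair.
    have <- : 'D_v L 0 = (v, 0).
      by rewrite derive_pair// derive_id derive_cst.
    rewrite -deriveE// -(near_derive_comp v (dL 0) dM0) -[RHS](derive_id 0 v).
    apply: near_eq_derive; have := open_near oB1 nd1; apply: filterS => x xd.
    by rewrite /= Mx0.
  pose L (x : V) : V * V := (cst 0 x, id x).
  have dL x : differentiable L x by exact: differentiable_pair.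
  have <- : 'D_w L 0 = (0, w).
    by rewrite derive_pair// derive_id derive_cst.
  rewrite -deriveE// -(near_derive_comp w (dL 0) dM0) -[RHS](derive_id 0 w).
  apply: near_eq_derive; have := open_near oB1 nd1; apply: filterS => x xd.
  by rewrite /= M0y.
have M00 : M 0 = 0 by exact: Mx0.
pose L (x : V) : V * V := (id x, id x).
have dL x : differentiable L x by exact: differentiable_pair.
have DL x v : 'D_v L x = (v, v) by rewrite derive_pair// derive_id.
pose f x := M (L x) + (- 2) *: x.
have sL : smooth_on B1 (M \o L).
  by apply: (@smooth_on_affine _ _ _ _ B1 B2 L (fun v => (v, v))) => // x xd; exact: B2P.
have s2 : smooth_on B1 (fun x : V => (- 2) *: x).
  apply: (@smooth_on_lin _ _ _ _ _ id (fun x : V => (-2) *: x)) => //.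
  - by move=> a u v; rewrite scalerDr !scalerA mulrC.
  - exact: scaler_continuous.
  - exact: smooth_on_id.
have sf : smooth_on B1 f by exact: smooth_onD.
have Df0 v : 'D_v f 0 = 0.
  rewrite deriveD; last 2 first.
  - exact/diff_derivable/(smooth_on_differentiable sL).
  - exact/diff_derivable/(smooth_on_differentiable s2).
  rewrite (near_derive_comp v (dL 0) dM0) DL deriveE// DM deriveZ//.
  by rewrite derive_id scaleNr scaler_nat mulr2n subrr.
have [C C0 [d3 d30 Hf]] := small_derivative_lipschitz oB1 nd1 sf Df0.
have c1V : dom c ((1 : G)^-1)%g by rewrite invg1.
have [near_inv d_inv] :=
  smooth_differentiable_at (p := 1%g) (@lie_inv_smooth _ _ G) c1 c1V.
have near0 (P : set V) : (\forall x \near e, P x) ->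
    exists2 h : R, 0 < h & forall x, `|x| < h -> P (x + e).
  rewrite (near_shift (0 : V)) => /nbhs_norm0P[h /= h0 Hh].
  by exists h => // x /Hh; rewrite /= subr0.
have [d2 d20 inv_dom] := near0 _ near_inv.
(* Radii at which, in turn, products stay in the chart, inverses stay in the chart, and the
   Lipschitz estimate holds; the last bound ensures that C d is at most 1/4. *)
pose d := Num.min (Num.min d1 d2) (Num.min d3 (4 * C)^-1).
have d0 : 0 < d by rewrite !lt_min d10 d20 d30 invr_gt0 mulr_gt0.
have lt_d x : x < d -> [/\ x < d1, x < d2, x < d3 & x < (4 * C)^-1].
  by rewrite !lt_min => /andP[/andP[? ?] /andP[? ?]].
have Cd : C * d <= 4^-1.
  have : d <= (4 * C)^-1 by rewrite /d !ge_min lexx !orbT.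
  move=> /(ler_wpM2l (ltW C0)) /le_trans; apply.
  by rewrite invfM mulrCA mulfV ?mulr1// gt_eqF.
have fE x : `|x| < d1 -> f x = phi (i x * i x)%g - 2 *: x.
  by move=> xd; rewrite /f ME// scaleNr.
exists C, d; split => //.
- by move=> x /lt_d[xd _ _ _]; have [] := mulP x x xd xd.
- by move=> x y /lt_d[xd _ _ _] /lt_d[yd _ _ _]; have [] := mulP x y xd yd.
- move=> r x y /lt_d[rd1 _ rd3 _] xr yr; have [_] := Hf r x y rd3 xr yr.
  by rewrite !fE//; exact: le_lt_trans rd1.
- move=> eps eps0.
  have Hlit : \forall z \near (0 : V * V), `|M z - 'd M 0 z| <= eps * `|z|.
    near=> z; have := diff_locallyx dM0 z; rewrite addr0 M00 add0r => ->.
    rewrite addrAC subrr add0r; near: z; exact: littleoP.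
  have /nbhs_norm0P[h /= h0 Hh] := Hlit.
  exists (Num.min h d1); first by rewrite lt_min h0.
  move=> x y; rewrite !lt_min => /andP[xh xd] /andP[yh yd].
  have := Hh (x, y); rewrite /= prod_normE gt_max /= xh yh => /(_ isT).
  rewrite DM ME// => /le_trans; apply; rewrite ler_wpM2l ?(ltW eps0)//.
  by rewrite ge_max lerDl lerDr !normr_ge0.
- move=> x y /lt_d[xd _ _ _] /lt_d[yd _ _ _].
  apply: differentiable_continuous.
  apply: (@near_eq_differentiable _ _ _ M); last first.
    exact/(smooth_on_differentiable sM)/B2P.
  have := open_near oB2 (B2P x y xd yd); apply: filterS => -[u v].
  by rewrite /B2 /= prod_normE gt_max /= => /andP[ud vd]; rewrite ME.
- move=> x /lt_d[xd1 xd2 _ _]; have [q [qc qVc qx]] := inv_dom x xd2.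
  by have -> : i x = q by rewrite -(phiK qc) /phi qx addrK.
move=> eps eps0.
have : \forall y \near e,
    `|e - local_rep c c (fun x : G => (x^-1)%g) y| < eps.
  have : local_rep c c (fun x : G => (x^-1)%g) y @[y --> e] --> e.
    rewrite -[X in _ --> X](_ : local_rep c c (fun x : G => (x^-1)%g) e = e).
      exact: differentiable_continuous.
    by rewrite /e local_repE// invg1.
  by move=> /cvgrPdist_lt/(_ _ eps0).
move=> /near0[h h0 Hh]; exists (Num.min h d2); first by rewrite lt_min h0.
move=> x; rewrite lt_min => /andP[xh xd2].
have [q [qc qVc qx]] := inv_dom x xd2.
have -> : i x = q by rewrite -(phiK qc) /phi qx addrK.
by have := Hh x xh; rewrite -qx local_repE// distrC.
Unshelve. all: by end_near. Qed.

End UnitChart.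

(** The estimate [koenigs_bound] is exactly of this form along a line, so it yields the velocity of
    the exponential at 0. *)
Lemma is_derive_quadratic (R : realType) (V : normedModType R) (f : R^o -> V)
    (v : V) (K : R) : f 0 = 0 ->
  (\forall t \near (0 : R), `|f t - t *: v| <= K * t ^+ 2) ->
  is_derive (0 : R^o) 1 f v.
Proof.
move=> f0 fK.
have quot : h^-1 *: (f (h *: (1 : R^o) + 0) - f 0) @[h --> (0 : R)^'] --> v.
  apply/cvgrPdist_le => eps eps0.
  have e0 : 0 < eps / (`|K| + 1) by rewrite divr_gt0// ltr_wpDl.
  have small := dnbhs0_lt e0.
  near=> h; rewrite f0 subr0 addr0 [h *: 1]mulr1.
  have h0 : h != 0 by near: h; exact: nbhs_dnbhs_neq.
  have -> : v - h^-1 *: f h = - (h^-1 *: (f h - h *: v)).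
    by rewrite scalerBr scalerA mulVf// scale1r opprB.
  have fh : `|f h - h *: v| <= K * h ^+ 2 by near: h; exact: nbhs_dnbhs.
  have he : `|h| < eps / (`|K| + 1).
    by near: h; exact: small.
  rewrite normrN normrZ normfV ler_pdivrMl ?normr_gt0//.
  apply: (le_trans fh); rewrite -real_normK ?num_real// expr2 mulrCA.
  rewrite ler_wpM2l//; move: he; rewrite ltr_pdivlMr ?ltr_wpDl// => /ltW.
  apply: le_trans; rewrite mulrC ler_wpM2l//.
  by rewrite (le_trans (ler_norm _))// lerDl.
apply: DeriveDef; first exact: (cvgP _ quot).
exact: (cvg_lim _ quot).
Unshelve. all: by end_near. Qed.

(** * The exponential map of a Lie group and its velocity at 0 *)

Section LieExponential.
Context {R : realType} {k : nat} {G : lieGroup R k}.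
Local Notation aG := (lie_atlas G).
Local Notation V := 'rV[R]_k.
Let mG : is_manifold aG := lie_manifold G.

Let left_mul_differentiable (h : G) (p : G) :
  differentiable_at aG aG (fun x => h * x)%g p.
Proof. exact: (smooth_slice_r (p := h) mG mG (@lie_mul_smooth _ _ G)). Qed.

Section Velocity.
Variable c : chart aG.
Hypothesis c1 : dom c (1%g : G).
Local Notation phi := (centred_coord c).
Local Notation i := (centred_coord_inv c).
Variables (C d : R).
Hypothesis chart1 : chart_at_unit (dom c) phi i C d.
Variable rho : R.
Hypothesis rhoP : good_radius phi i d rho.

Let expc : V -> G := chart_exp phi i rho.
Let E : V -> V := koenigs (fun x => phi (i x * i x)%g).

Let rho0 : 0 < rho. Proof. by case: rhoP. Qed.
Let rhod x : `|x : V| < rho -> `|x| < d / 2.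
Proof. by move=> /lt_le_trans; apply; case: rhoP. Qed.

Let S0 : phi (i 0 * i 0)%g = 0.
Proof.
have <- : phi 1%g = 0 by exact: cu_phi1 chart1.
by rewrite (cu_phiK chart1)// mulg1.
Qed.

Let E_bound x : `|x| < rho -> `|E x - x| <= 2 * C * `|x| ^+ 2.
Proof.
move=> /rhod; exact: koenigs_bound (cu_C0 chart1) (cu_Cd chart1) S0
  (cu_square chart1) x.
Qed.

Let Ed x : `|x| < rho -> `|E x| < d.
Proof.
move=> /rhod xd; have := cu_d0 chart1; have := normr_ge0 x.
have : `|E x| <= 3 / 2 * `|x|.
  exact: koenigs_norm (cu_C0 chart1) (cu_Cd chart1) S0 (cu_square chart1) x xd.
lra.
Qed.

Let expc_small x : `|x| < rho -> dom c (expc x) /\ phi (expc x) = E x.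
Proof.
move=> xr; have xd := Ed xr.
rewrite /expc (chart_exp_small chart1 rhoP xr) (cu_iK chart1 xd); split=> //.
have := cu_mul chart1 xd (y := 0); rewrite normr0 (cu_d0 chart1) => /(_ isT).
have <- : phi 1%g = 0 by exact: cu_phi1 chart1.
by rewrite (cu_phiK chart1)// mulg1.
Qed.

Let expc_add (s t : R) x : expc ((s + t) *: x) = (expc (s *: x) * expc (t *: x))%g.
Proof. exact: (chart_exp_add chart1 rhoP). Qed.

Let near_rho (x : V) : \forall t \near (0 : R), `|t *: x| < rho.
Proof.
have : t *: x @[t --> (0 : R)] --> (0 : V).
  by rewrite -[X in _ --> X](scale0r x); apply: cvgZr_tmp; exact: cvg_id.
by move=> /cvgr0_norm_lt/(_ _ rho0).
Qed.

Let expc0 : expc 0 = 1%g.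
Proof.
have r0 : `|0 : V| < rho by rewrite normr0.
have [c0 phi0] := expc_small r0.
rewrite -(cu_phiK chart1 c0) phi0.
have -> : E 0 = 0.
  have := E_bound r0; rewrite normr0 expr0n mulr0 subr0 normr_le0.
  by move/eqP.
by rewrite -[X in i X](cu_phi1 chart1) (cu_phiK chart1).
Qed.

Let expc_velocity (xi : lie_algebra G) :
  is_velocity (fun t : R => expc (t *: xi c)) xi.
Proof.
apply: (is_velocity_chart (c := c)) => //.
- by rewrite scale0r expc0.
- by have := near_rho (xi c); apply: filterS => t /expc_small[].
have -> : coord c \o (fun t : R => expc (t *: xi c)) =
    (fun t : R^o => phi (expc (t *: xi c)) + cst (coord c (1%g : G)) t) :> (R^o -> V).
  by apply/funext => t; rewrite /centred_coord /= subrK.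
rewrite -[X in is_derive _ _ _ X]addr0; apply: is_deriveD.
apply: (@is_derive_quadratic _ _ _ _ (2 * C * `|xi c| ^+ 2)).
  by rewrite scale0r expc0 (cu_phi1 chart1).
have := near_rho (xi c); apply: filterS => t tr.
have [_ ->] := expc_small tr; rewrite (le_trans (E_bound tr))//.
by rewrite normrZ exprMn real_normK ?num_real// mulrA mulrAC.
Qed.

Let expc_smooth (xi : lie_algebra G) :
  smooth (vector_space_atlas R^o) aG (fun t : R => expc (t *: xi c)).
Proof.
move=> [] c'; set gamma := fun t : R => _.
have gamma_add s t : gamma (s + t) = (gamma s * gamma t)%g by exact: expc_add.
have -> : local_rep (a := vector_space_atlas R^o) (tt : unit) c' gamma = coord c' \o gamma.
  apply/funext => t; apply: get_unique; first by exists t.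
  by move=> _ [s [_ /= ->] <-].
have -> /= : (id @` ([set: R] `&` gamma @^-1` dom c')) = gamma @^-1` dom c'.
  by apply/seteqP; split=> [_ [t [_ h] <-]|t h] //; exists t.
pose mul := fun x : G * G => (x.1 * x.2)%g.
pose m := local_rep (a := prod_atlas aG aG) (c', c) c' mul.
have [oU sm] := @lie_mul_smooth _ _ G (c', c) c'.
set U := (X in open X) in oU sm.
pose e := coord c (1%g : G).
(* The left-invariant field generated by [xi], read in [c']: the derivative of the product in its
   second factor at the unit. *)
pose W (y : V) : V := 'D_((0 : V, xi c) : V * V) m (y, e).
pose V' := coord c' @` (dom c' `&` id @^-1` dom c').
have oV' : open V' by have [] := charts_compatible mG c' c'.
have V'U y : V' y -> U (y, e).
  by move=> [q [qc' _] <-]; exists (q, 1%g); rewrite //= mulg1.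
have sW : smooth_on V' W.
  pose L (y : V) : V * V := (id y, cst e y).
  apply: (@smooth_on_affine _ _ _ _ V' U L (fun v => (v, 0)) (fun z => 'D_((0 : V, xi c) : V * V) m z)) => //.
  - by move=> y v; rewrite derive_pair// derive_id derive_cst.
  - exact: smooth_on_derive.
have Dgamma (t0 : R^o) : dom c' (gamma t0) ->
    (\forall t \near t0, dom c' (gamma t)) /\
    is_derive t0 1 (coord c' \o gamma : R^o -> V) (W (coord c' (gamma t0))).
  move=> t0c'; pose f := fun x : G => (gamma t0 * x)%g.
  have f1 : f 1%g = gamma t0 by rewrite /f mulg1.
  have df : differentiable_at aG aG f 1%g by exact: left_mul_differentiable.
  pose w := pushforward mG mG df f1 xi.
  have vw : is_differential f xi w by exact: pushforwardP.
  have [_ /(_ c' t0c')[near_dom Dg]] :=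
    is_velocity_comp mG df vw (expc_velocity xi).
  have wE : w c' = W (coord c' (gamma t0)).
    have [_ vwE] := vw; rewrite (vwE c c' c1 t0c').
    have f1c' : dom c' (f 1%g) by rewrite f1.
    have [_ drf] := df c c' c1 f1c'.
    pose L (y : V) : V * V := (cst (coord c' (gamma t0)) y, id y).
    have dL y : differentiable L y by exact: differentiable_pair.
    have DL : 'D_(xi c) L e = (0, xi c) by rewrite derive_pair// derive_id derive_cst.
    have dm : differentiable m (L e).
      by apply: (smooth_on_differentiable sm); apply: V'U; exists (gamma t0).
    rewrite -deriveE// /W -DL -[(_, e)]/(L e) -near_derive_comp//.
    apply: near_eq_derive.
    have [oc _] := charts_compatible mG c c.
    have ec : (coord c @` (dom c `&` id @^-1` dom c)) e by exists 1%g.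
    have := open_near oc ec; apply: filterS => _ [q [qc _] <-].
    by rewrite local_repE// /m /L /= prod_local_repE.
  (* The group law carries the time [t0] back to 0, where the velocity is known. *)
  have shiftE t : gamma t = f (gamma (t - t0)).
    by rewrite /f -gamma_add addrC subrK.
  have sh : t - t0 @[t --> t0] --> (0 : R^o).
    by rewrite -[X in _ --> X](subrr t0); apply: cvgB; [exact: cvg_id|exact: cvg_cst].
  split.
    have : \forall t \near t0, dom c' (f (gamma (t - t0))) by exact: (sh _ near_dom).
    by apply: filterS => t; rewrite -shiftE.
  have dsh (t : R^o) : differentiable (fun t : R^o => t - t0 : R^o) t.
    by apply: differentiableB.
  have Dsh : 'D_1 (fun t : R^o => t - t0 : R^o) t0 = 1.
    by rewrite deriveB// derive_id derive_cst subr0.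
  have dfg : differentiable (coord c' \o (f \o gamma) : R^o -> V) (t0 - t0).
    by rewrite subrr; apply/derivable1_diffP; have [] := Dg.
  have -> : (coord c' \o gamma : R^o -> V) =
      (coord c' \o (f \o gamma)) \o (fun t => t - t0).
    by apply/funext => t; rewrite /= -shiftE.
  apply: DeriveDef; first by apply/diff_derivable/differentiable_comp.
  rewrite near_derive_comp// Dsh subrr -wE.
  by have [_ ->] := Dg.
split.
  rewrite openE => t0 /= t0c'; exact: (Dgamma t0 t0c').1.
apply: (@smooth_on_integral_curve _ _ _ V' _ W) => //.
- by rewrite openE => t0 /= t0c'; exact: (Dgamma t0 t0c').1.
- by move=> t tc'; exists (gamma t).
- by move=> t tc'; exact: (Dgamma t tc').2.
Qed.

Let expc_one_parameter (xi : lie_algebra G) :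
  one_parameter_subgroup xi (fun t : R => expc (t *: xi c)).
Proof.
split; [exact: expc_smooth| |exact: expc_velocity].
by move=> s t; exact: expc_add.
Qed.

(** The derivative of [gamma] at 0 along the times s / 2^n is the renormalised limit that
    [one_parameter_unique] requires. *)
Let one_parameterE (xi : lie_algebra G) gamma (t : R) :
  one_parameter_subgroup xi gamma -> gamma t = expc (t *: xi c).
Proof.
move=> [_ gammaD [gamma0 gv]]; have [near_dom Dg] := gv c c1.
pose f (s : R^o) : V := phi (gamma s).
have f0 : f 0 = 0 by rewrite /f gamma0 (cu_phi1 chart1).
have fE : f = (coord c \o gamma) + cst (- coord c (1%g : G)) by [].
have df : is_derive (0 : R^o) 1 f (xi c).
  by rewrite fE -[X in is_derive _ _ _ X]addr0; apply: is_deriveD.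
have dif : differentiable f 0 by apply/derivable1_diffP; have [] := df.
have difE (s : R^o) : 'd f 0 s = s *: xi c.
  have -> : s = s *: (1 : R^o) :> R^o by rewrite -[RHS]/(s * 1) mulr1.
  rewrite linearZ -deriveE//; have [_ ->] := df.
  by rewrite -[s *: (1 : R^o)]/(s * 1) mulr1.
apply: (one_parameter_unique chart1 rhoP) => // [|s].
  have : f s @[s --> (0 : R^o)] --> (0 : V).
    by rewrite -[X in _ --> X]f0; exact: differentiable_continuous.
  by move=> /cvgr0_norm_lt/(_ _ (cu_d0 chart1)); move: near_dom; apply: filterS2.
apply/cvgrPdist_le => eps eps0.
have e0 : 0 < eps / (`|s| + 1) by rewrite divr_gt0// ltr_wpDl.
have small : \forall u \near (0 : R^o), `|f u - u *: xi c| <= eps / (`|s| + 1) * `|u|.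
  near=> u; have := diff_locallyx dif u; rewrite addr0 f0 add0r difE => ->.
  rewrite addrAC subrr add0r; near: u; exact: littleoP.
have pow_cvg : 2^-1 ^+ n * s @[n --> \oo] --> (0 : R).
  rewrite -[X in _ --> X](mul0r s); apply: cvgMr_tmp.
  by apply: cvg_expr; rewrite ger0_norm ?invf_lt1 ?invr_ge0 ?ltr1n.
have : \forall n \near \oo,
    `|f (2^-1 ^+ n * s) - (2^-1 ^+ n * s) *: xi c| <=
    eps / (`|s| + 1) * `|2^-1 ^+ n * s| by exact: (pow_cvg _ small).
apply: filterS => n Hn; rewrite -/(f _).
have pow2K : (2 : R) ^+ n * 2^-1 ^+ n = 1 by rewrite -exprMn mulfV// expr1n.
have -> : s *: xi c - 2 ^+ n *: f (2^-1 ^+ n * s) =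
    - (2 ^+ n *: (f (2^-1 ^+ n * s) - (2^-1 ^+ n * s) *: xi c)).
  move: (f _) => y; by rewrite scalerBr scalerA mulrA pow2K mul1r opprB.
rewrite normrN normrZ ger0_norm ?exprn_ge0//.
have P0 : 0 <= (2 : R) ^+ n by rewrite exprn_ge0.
apply: (le_trans (ler_wpM2l P0 Hn)).
have p0 : 0 <= (2^-1 : R) ^+ n by rewrite exprn_ge0// invr_ge0.
rewrite normrM (ger0_norm p0).
rewrite [leLHS](_ : _ = (2 ^+ n * 2^-1 ^+ n) * (eps / (`|s| + 1) * `|s|));
  last by ring.
have s1 : `|s| + 1 != 0 by rewrite gt_eqF// ltr_wpDl.
by rewrite pow2K mul1r -[leRHS](divfK s1) ler_wpM2l ?(ltW e0)// lerDl.
Unshelve. all: by end_near. Qed.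

(** Existence excludes the default value of [xget]; uniqueness identifies whichever subgroup it
    selects. *)
Lemma lie_exp_chart (xi : lie_algebra G) : lie_exp xi = expc (xi c).
Proof.
rewrite /lie_exp; case: xgetP => [_ -> [gamma gammaP <-]|/(_ (expc (1 *: xi c)))[]].
  by rewrite (one_parameterE 1 gammaP) scale1r.
by exists (fun t : R => expc (t *: xi c)).
Qed.

Lemma lie_exp_velocity_chart (xi : lie_algebra G) :
  is_velocity (fun t : R => lie_exp (t *: xi)) xi.
Proof.
have -> : (fun t : R => lie_exp (t *: xi)) = fun t : R => expc (t *: xi c).
  by apply/funext => t; rewrite lie_exp_chart.
exact: expc_velocity.
Qed.

End Velocity.

Lemma lie_exp_velocity (xi : lie_algebra G) :
  is_velocity (fun t : R => lie_exp (t *: xi)) xi.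
Proof.
have [c c1] := charts_cover mG (1%g : G).
have [C [d chart1]] := chart_at_unit_exists c1.
have [rho rhoP] := good_radius_exists chart1.
exact: (lie_exp_velocity_chart c1 chart1 rhoP).
Qed.

End LieExponential.

(** * The field induced by a gauge transformation *)

Section InducedField.
Context {R : realType} {k m : nat} {G : lieGroup R k}.
Variable M : gManifold G m.
Local Notation aG := (lie_atlas G).
Local Notation aM := (mf_atlas M).
Let mG : is_manifold aG := lie_manifold G.
Let mM : is_manifold aM := mf_manifold M.

Let orbit_differentiable (p : M) (g : G) :
  differentiable_at aG aM (fun h => act h p) g.
Proof. exact: (smooth_slice_l (q := p) mG mM (@act_smooth _ _ _ _ M)). Qed.

Let act_differentiable (g : G) (p : M) : differentiable_at aM aM (act g) p.
Proof. exact: (smooth_slice_r (p := g) mG mM (@act_smooth _ _ _ _ M)). Qed.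

Let conj_differentiable (g h : G) :
  differentiable_at aG aG (fun x => g * x * g^-1)%g h.
Proof.
apply: (differentiable_at_comp (a2 := aG) (f := fun x => (g * x)%g)
  (h := fun x => (x * g^-1)%g) mG mG).
  exact: (smooth_slice_r (p := g) mG mG (@lie_mul_smooth _ _ G)).
exact: (smooth_slice_l (q := (g^-1)%g) mG mG (@lie_mul_smooth _ _ G)).
Qed.

Definition induced_at (psi : gauge M) (p : M) : tangent aM p :=
  pushforward mG mM (@orbit_differentiable p 1%g) (act1 p) (psi p).

Lemma induced_atP (psi : gauge M) p :
  is_differential (fun h : G => act h p) (psi p) (induced_at psi p).
Proof. exact: pushforwardP. Qed.

(** Since g (h p) = (g h g^-1) (g p), the orbit map of [p] followed by [g] is conjugation followed
    by the orbit map of g p. Conjugation takes psi p to psi (g p), so both sides are the image of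
    psi p under one differential. *)
Lemma induced_equivariant psi (g : G) p :
  is_differential (act g) (induced_at psi p) (induced_at psi (act g p)).
Proof.
have [w vw] := pushforward_exists mM mM (@act_differentiable g p) erefl
  (induced_at psi p).
suff <- : w = induced_at psi (act g p) by [].
have H1 : is_differential (act g \o (fun h : G => act h p)) (psi p) w.
  apply: (is_differential_comp mG mM _ _ (@induced_atP psi p) vw).
    exact: orbit_differentiable.
  exact: act_differentiable.
apply: (is_differential_unique mG H1).
have -> : act g \o (fun h : G => act h p) =
    (fun h : G => act h (act g p)) \o (fun h => g * h * g^-1)%g.
  by apply/funext => h; rewrite /= -!actM mulgVK.
apply: (is_differential_comp mG mG _ _ (gauge_equivariant psi g p)
    (@induced_atP _ _)).
  exact: conj_differentiable.
exact: orbit_differentiable.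
Qed.

Section LocalExpression.
Variables (cG : chart aG) (c c' : chart aM).
Hypothesis cG1 : dom cG (1%g : G).
Let e := coord cG (1%g : G).
Let F := local_rep (a := prod_atlas aG aM) (cG, c) c'
  (fun x : G * M => act x.1 x.2).
Let U := coord c @` (dom c `&` dom c').

(** Component in [c'] of the field generated by the j-th basis vector of the Lie algebra (read in
    [cG]), as a function of the coordinates in [c]. *)
Definition induced_coef (j : 'I_k) (x : 'rV[R]_m) : 'rV[R]_m :=
  'D_(('e_j : 'rV[R]_k, 0 : 'rV[R]_m)) F (e, x).

Let UF (p : M) : dom c p -> dom c' p ->
  ((fun x : G * M => (coord cG x.1, coord c x.2)) @`
  ((dom cG `*` dom c) `&` [set x | dom c' (act x.1 x.2)])) (e, coord c p).
Proof. by move=> pc pc'; exists (1%g, p); rewrite //= act1. Qed.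

Lemma open_chart_overlap : open U.
Proof. by have [] := charts_compatible mM c c'. Qed.

Lemma induced_coef_smooth j : smooth_on U (induced_coef j).
Proof.
have [oF sF] := @act_smooth _ _ _ _ M (cG, c) c'.
pose L (x : 'rV[R]_m) : 'rV[R]_k * 'rV[R]_m := (cst e x, id x).
apply: (@smooth_on_affine _ _ _ _ _ _ L (fun v => (0, v))
  (fun z => 'D_(('e_j : 'rV[R]_k, 0 : 'rV[R]_m)) F z) open_chart_overlap) => //.
- by move=> x v; rewrite derive_pair// derive_id derive_cst.
- by move=> _ [p [pc pc'] <-]; exact: (UF pc pc').
exact: smooth_on_derive.
Qed.

(** The coefficients do not depend on [psi], so smoothness of the induced field, and later the
    dependence of its jets on those of [psi], reduce to sums and products. *)
Lemma induced_atE psi p : dom c p -> dom c' p ->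
  induced_at psi p c' = \sum_j psi p cG 0 j *: induced_coef j (coord c p).
Proof.
move=> pc pc'; have [_ vw] := @induced_atP psi p.
have orb1 : dom c' (act (1%g : G) p) by rewrite act1.
have [_ dro] := orbit_differentiable cG1 orb1.
rewrite (vw cG c' cG1 pc').
have [oF sF] := @act_smooth _ _ _ _ M (cG, c) c'.
pose L (y : 'rV[R]_k) : 'rV[R]_k * 'rV[R]_m := (id y, cst (coord c p) y).
have dL y : differentiable L y by exact: differentiable_pair.
have DL v : 'D_v L e = (v, 0) by rewrite derive_pair// derive_id derive_cst.
have dF : differentiable F (L e) := smooth_on_differentiable sF (UF pc pc').
have -> : 'd (local_rep cG c' (fun h : G => act h p)) e (psi p cG) =
    'd F (L e) (psi p cG, 0).
  rewrite -!deriveE// -DL -near_derive_comp//.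
  apply: near_eq_derive.
  have [oc _] := charts_compatible mG cG cG.
  have ec : (coord cG @` (dom cG `&` id @^-1` dom cG)) e by exists 1%g.
  have := open_near oc ec; apply: filterS => _ [q [qc _] <-].
  by rewrite local_repE// /F /L /= prod_local_repE.
rewrite {1}[psi p cG]rV_sum_delta.
pose f (v : 'rV[R]_k) := 'd F (L e) (v, 0).
have f0 : f 0 = 0 by exact: linear0.
have fD : {morph f : u v / u + v}.
  by move=> u v; rewrite /f -linearD; congr ('d F _ _); congr pair; rewrite /= addr0.
rewrite -/(f _) (big_morph f fD f0); apply: eq_bigr => j _.
rewrite /f /induced_coef deriveE// -linearZ.
by congr ('d F _ _); congr pair; rewrite /= scaler0.
Qed.

End LocalExpression.

Lemma induced_smooth psi : smooth_section (induced_at psi).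
Proof.
have [cG cG1] := charts_cover mG (1%g : G).
move=> c c'; change (chart (tangent_bundle_atlas aM)) with (chart aM) in c'.
split; first exact: (@open_chart_overlap c c').
pose X x := (local_rep c c' id x, \sum_j
  (local_rep (b := lie_algebra_atlas G) c cG psi x 0 j : R^o) *: induced_coef cG c c' j x).
apply: (@smooth_on_eq _ _ _ _ X); first exact: (@open_chart_overlap c c').
  move=> _ /set_mem[p [pc pc'] <-].
  by rewrite [RHS]local_repE// /X !local_repE//= (induced_atE cG1 _ pc).
have oU := @open_chart_overlap c c'.
apply: smooth_on_pair => //.
  by have [] := charts_compatible mM c c'.
apply: smooth_on_sum => // j; apply: smooth_on_scale => //; last first.
  exact: induced_coef_smooth.
apply: (@smooth_on_lin _ _ _ _ _ _ (fun y : 'rV[R]_k => (y 0 j : R^o))) => //.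
- by move=> a x y; rewrite !mxE.
- exact: coord_continuous.
have [_ sp] := gauge_smooth psi c cG.
by apply: smooth_on_subset sp => _ [p [pc _] <-]; exists p.
Qed.

Definition induced_field (psi : gauge M) : equivariant_field M :=
  EquivariantField (induced_smooth psi) (induced_equivariant psi).

Lemma induced_fieldP psi : is_induced_field psi (induced_field psi).
Proof.
move=> p; have := is_velocity_comp mG (@orbit_differentiable p 1%g)
  (@induced_atP psi p) (lie_exp_velocity (psi p)).
exact.
Qed.

Lemma induced_fieldD : {morph induced_field : phi psi / phi + psi}.
Proof.
move=> phi psi; apply: field_ext => p /=.
apply: (is_differential_unique mG (@induced_atP (phi + psi) p)).
apply: is_differentialD; exact: induced_atP.
Qed.

End InducedField.

(** * Topology of manifolds *)

Section Subbase.

Definition generated_by (X : topologicalType) (B : set (set X)) : Prop :=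
  (forall A, B A -> open A) /\
  forall (p : X) (A : set X), nbhs p A -> exists D' : {fset set X},
    [/\ {subset D' <= B}, (\bigcap_(i in [set` D']) i) p &
        \bigcap_(i in [set` D']) i `<=` A].

(** Convergence is tested on subbasic sets; this is how the topologies of manifolds, jet spaces and
    mapping spaces are all handled. *)
Lemma cvg_generated (X : topologicalType) (B : set (set X)) (T : Type)
    (F : set_system T) (f : T -> X) p : generated_by B -> Filter F ->
  (forall A, B A -> A p -> \forall t \near F, A (f t)) -> f @ F --> p.
Proof.
move=> [_ genB] FF fB A /genB[D' [D'B D'p D'A]].
apply: (@filterS _ _ _ (f @^-1` \bigcap_(i in [set` D']) i)).
  by move=> t /D'A.
rewrite preimage_bigcap; apply: filter_bigI => C CD'.
by apply: fB; [exact/set_mem/D'B|exact: D'p].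
Qed.

Lemma atlas_space_generated (R : realType) (E : normedModType R) (T : Type)
  (a : atlas E T) : @generated_by (atlas_space a) (atlas_subbase a).
Proof.
split=> [A BA|p A].
  exists [set A]; last by rewrite bigcup_set1.
  move=> _ ->; exists [fset A]%fset; last by rewrite set_fset1 bigcap_set1.
  by move=> C; rewrite inE => /eqP ->; exact: mem_set.
rewrite nbhsE => -[_ [[D' D'B <-] [C0 D'C0 C0p]] sA].
have [C CB CE] := D'B _ D'C0; exists C; split=> //; first by rewrite -CE in C0p.
by move=> q Cq; apply: sA; exists C0 => //; rewrite -CE.
Qed.

Lemma jet_space_generated (R : realType) (E F : normedModType R) (S T : Type)
    (a : atlas E S) (b : atlas F T) r :
  @generated_by (jet_space a b r) (@jet_subbase R E F S T a b r).
Proof.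
split=> [A BA|p A].
  exists [set A]; last by rewrite bigcup_set1.
  move=> _ ->; exists [fset A]%fset; last by rewrite set_fset1 bigcap_set1.
  by move=> C; rewrite inE => /eqP ->; exact: mem_set.
rewrite nbhsE => -[_ [[D' D'B <-] [C0 D'C0 C0p]] sA].
have [C CB CE] := D'B _ D'C0; exists C; split=> //; first by rewrite -CE in C0p.
by move=> q Cq; apply: sA; exists C0 => //; rewrite -CE.
Qed.

Lemma smooth_map_generated (R : realType) (E F : normedModType R) (S T : Type)
    (a : atlas E S) (b : atlas F T) :
  @generated_by (smooth_map a b) (@whitney_basis R E F S T a b).
Proof.
split=> [A BA|p A].
  exists [set A]; last by rewrite bigcup_set1.
  move=> _ ->; exists [fset A]%fset; last by rewrite set_fset1 bigcap_set1.
  by move=> C; rewrite inE => /eqP ->; exact: mem_set.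
rewrite nbhsE => -[_ [[D' D'B <-] [C0 D'C0 C0p]] sA].
have [C CB CE] := D'B _ D'C0; exists C; split=> //; first by rewrite -CE in C0p.
by move=> q Cq; apply: sA; exists C0 => //; rewrite -CE.
Qed.

End Subbase.

Section AtlasSpace.
Context {R : realType}.

Section Charts.
Context {E : normedModType R} {T : Type} (a : atlas E T).
Hypothesis ma : is_manifold a.
Local Notation X := (atlas_space a).

Lemma open_chart_preimage (c : chart a) (O : set E) : open O ->
  open (dom c `&` coord c @^-1` O : set X).
Proof. by move=> oO; apply: (atlas_space_generated a).1; exists c, O. Qed.

Lemma near_dom (c : chart a) (p : X) : dom c p ->
  \forall q \near p, dom c (q : T).
Proof.
move=> pc; have : nbhs p (dom c `&` coord c @^-1` setT : set X).
  by apply: open_nbhs_nbhs; split => //; exact/open_chart_preimage/openT.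
by apply: filterS => q [].
Qed.

Lemma coord_cvg (c : chart a) (p : X) : dom c p ->
  coord c (q : T) @[q --> p] --> coord c (p : T).
Proof.
move=> pc A; rewrite nbhsE => -[Q [oO Op] OA].
have : nbhs p (dom c `&` coord c @^-1` Q : set X).
  by apply: open_nbhs_nbhs; split => //; exact/open_chart_preimage.
by apply: filterS => q [_ /OA].
Qed.

Definition chart_inv (c : chart a) (p : T) (x : E) : X :=
  xget (p : X) [set q : X | dom c (q : T) /\ coord c (q : T) = x].

Lemma chart_invK (c : chart a) p q : dom c q -> chart_inv c p (coord c q) = q.
Proof.
move=> qc; rewrite /chart_inv; case: xgetP => [r _ [rc]|/(_ q)[]//].
exact: coord_inj.
Qed.

Lemma chart_inv_cvg (c : chart a) p0 p : dom c p ->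
  chart_inv c p0 x @[x --> coord c p] --> (p : X).
Proof.
move=> pc; apply: (cvg_generated (atlas_space_generated a)).
move=> _ [c' [Q [oO ->]]] [pc' Op].
have [near_q drep] := differentiable_at_id ma pc pc'.
have : local_rep c c' id x @[x --> coord c p] --> coord c' p.
  by rewrite -(local_repE c' id ma pc); exact: differentiable_continuous.
move=> /(_ Q (open_nbhs_nbhs (conj oO Op))); apply: filterS2 near_q.
move=> _ [q [qc qc' <-]] /=; rewrite local_repE// => Oq.
by rewrite chart_invK.
Qed.

End Charts.

(** A closed ball inside a chart is compact in finite dimension, so each point has a compact
    neighbourhood, and a Hausdorff space is regular at such points. *)
Lemma atlas_space_regular n T (a : atlas 'rV[R]_n T) :
  is_manifold a -> regular_space (atlas_space a).
Proof.
move=> ma p; have [c pc] := charts_cover ma p.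
have [oU _] := charts_compatible ma c c; set U := (X in open X) in oU.
have Up : U (coord c p) by exists p.
have /nbhs_closedballP[r rU] := open_near oU Up.
pose K := chart_inv c p @` closed_ball (coord c p) r%:num.
have cK : compact K.
  apply: continuous_compact; last first.
    apply: bounded_closed_compact; last exact: closed_ball_closed.
    rewrite closed_ballE//; exists (`|coord c p| + r%:num); split=> // y ry x /= xr.
    rewrite (le_trans _ (ltW ry))// -[x](subrK (coord c p)).
    by rewrite (le_trans (ler_normD _ _))// addrC lerD2l distrC.
  apply: continuous_in_subspaceT => x /set_mem /rU [q [qc _] <-].
  rewrite /continuous_at chart_invK//; exact: chart_inv_cvg.
apply: (compact_regular (manifold_hausdorff ma) cK).
have nB : nbhs (coord c p) (closed_ball (coord c p) r%:num).
  by apply: filterS (nbhsx_ballx _ _ _); [exact: subset_closed_ball|].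
have nK := coord_cvg pc nB.
apply: filterS2 (near_dom pc) nK => q qc Kq.
by exists (coord c q) => //; rewrite chart_invK.
Qed.

End AtlasSpace.

Section LocallyFinite.
Context {X : topologicalType}.
Hypotheses (regX : regular_space X) (scX : @second_countable X).

(** For each basic open set contained in some [V p], one such point is selected; the basic sets are
    numbered by an injection into the naturals. *)
Lemma lindelof (V : X -> set X) (p0 : X) : (forall p : X, nbhs p (V p)) ->
  exists s : nat -> X, forall p : X, exists n, nbhs p (V (s n)).
Proof.
move=> nV; have [B cB [Bopen Bbasis]] := scX.
have /countable_injP[f finj] := cB.
pose s n := xget p0 [set p | exists b, [/\ B b, f b = n & b `<=` V p]].
exists s => p.
have [b [Bb bp] bV] := Bbasis p _ (nV p).
exists (f b).
have [q qP] : exists q, [set p | exists b', [/\ B b', f b' = f b & b' `<=` V p]] q.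
  by exists p, b.
have [b' [Bb' fb' b'V]] := xgetPex p0 (ex_intro _ q qP).
have bb' : b' = b by apply: finj => //; exact: mem_set.
rewrite -/(s _) bb' in b'V; apply: filterS b'V _.
by apply: open_nbhs_nbhs; split=> //; exact: Bopen.
Qed.

(** Regularity shrinks the cover to sets whose closures are still small. [K n] is the closure of the
    n-th one without the interiors of the earlier ones: a point is in [K n] for the first n whose
    interior contains it, and each interior avoids all later [K n]. *)
Lemma locally_finite_refinement (U : X -> set X) (p0 : X) :
  (forall p : X, nbhs p (U p)) ->
  exists (K : nat -> set X) (s : nat -> X),
    [/\ forall n, closed (K n), forall n, K n `<=` U (s n),
        forall p : X, exists n, K n p &
        forall p : X, exists N, \forall q \near p, forall n, (N <= n)%N -> ~ K n q].
Proof.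
move=> nU; have /choice[V HV] : forall p : X, exists V, nbhs p V /\ closure V `<=` U p.
  by move=> p; have [V nV clV] := regX (nU p); exists V.
have [s sP] := lindelof p0 (fun p => (HV p).1).
pose K n := closure (V (s n)) `&` ~` \bigcup_(j in [set j | (j < n)%N]) (V (s j))°.
exists K, s; split=> [n|n p [+ _]|p|p].
- apply: closedI; first exact: closed_closure.
  by rewrite closedC; apply: bigcup_open => j _; exact: open_interior.
- exact: (HV (s n)).2.
- have [n0 nP] := sP p.
  have exn : exists n, `[< nbhs p (V (s n)) >] by exists n0; exact/asboolP.
  have [n /asboolP nn min] := ex_minnP exn; exists n; split.
    by apply: subset_closure; exact: nbhs_singleton.
  move=> [j /= jn Vj]; have := min j; rewrite leqNgt jn => /(_ _)H.
  by have /H : `[< nbhs p (V (s j)) >] by exact/asboolP.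
(* [K N] itself still meets the interior of [V (s N)]; the avoidance starts at the next index. *)
have [N NP] := sP p; exists N.+1.
apply: filterS (nbhs_interior NP) => q Vq n Nn [_]; apply.
by exists N.
Qed.

End LocallyFinite.

(** * Whitney topologies *)

Section Comap.
Context {T : Type} {Z : topologicalType}.

(** The preimage of the filter [nbhs z]. It turns an assertion about converging jets into the
    existence of a neighbourhood in the space of jets. *)
Definition comap (J : T -> Z) (z : Z) : set_system T :=
  [set A | nbhs z [set z' | forall t, J t = z' -> A t]].

Global Instance comap_filter J z : Filter (comap J z).
Proof.
split=> [|A B nA nB|A B AB nA].
- by apply: (@nearW _ (nbhs z)).
- apply: (@filterS2 _ (nbhs z) _ _ _ _ _ nA nB) => z' hA hB t Jt.
  by split; [exact: hA|exact: hB].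
- by apply: (@filterS _ (nbhs z) _ _ _ _ nA) => z' hA t Jt; exact/AB/hA.
Qed.

Lemma cvg_comap J z : J t @[t --> comap J z] --> z.
Proof.
move=> A nA; apply: (@filterS _ (nbhs z) _ _ _ _ nA) => z' Az' t Jt.
by rewrite /= Jt.
Qed.

End Comap.

Section WhitneyProduct.
Context {X : topologicalType} {W1 W2 Z1 Z2 : topologicalType}.
Hypotheses (regX : regular_space X) (scX : @second_countable X).
Variables (j1 : W1 -> X -> Z1) (j2 : W2 -> X -> Z2).
Variables (src1 : Z1 -> X) (src2 : Z2 -> X).
Hypotheses (src1_cont : continuous src1) (src2_cont : continuous src2).
Hypotheses (src1K : forall w p, src1 (j1 w p) = p)
  (src2K : forall w p, src2 (j2 w p) = p).
Hypotheses (j1_cont : forall w, continuous (j1 w))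
  (j2_cont : forall w, continuous (j2 w)).
Hypotheses
  (open1 : forall O, open O -> open [set w | forall p, O (j1 w p)])
  (open2 : forall O, open O -> open [set w | forall p, O (j2 w p)]).

(** Near [z] the conditions with n >= N are vacuous. Each of the finitely many others is open:
    either [A n] holds nearby, or the source stays off the closed set [K n]. *)
Let open_locally_finite (Z : topologicalType) (src : Z -> X)
    (K : nat -> set X) (A : nat -> set Z) : continuous src ->
  (forall n, closed (K n)) -> (forall n, open (A n)) ->
  (forall p : X, exists N, \forall q \near p, forall n, (N <= n)%N -> ~ K n q) ->
  open [set z | forall n, K n (src z) -> A n z].
Proof.
move=> csrc clK oA lf; rewrite openE => z /= Hz.
have [N nN] := lf (src z); have {nN}lfN : \forall z' \near z, forall n, (N <= n)%N -> ~ K n (src z').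
  exact: (csrc z _ nN).
have small : forall n : 'I_N, \forall z' \near z, K n (src z') -> A n z'.
  move=> n; have [Kn|Kn] := pselect (K n (src z)).
    have : nbhs z (A n) by apply: open_nbhs_nbhs; split=> //; exact: Hz.
    by apply: filterS => z' ? _.
  have : nbhs (src z) (~` K n).
    by apply: open_nbhs_nbhs; split=> //; exact: closed_openC.
  by move=> /csrc nK; apply: (@filterS _ (nbhs z) _ _ _ _ nK) => z' /= h /h.
near=> z' => n Kn.
have [nN|Nn] := ltnP n N.
  have sm : forall k : 'I_N, K k (src z') -> A k z'.
    by near: z'; exact: filter_forall.
  exact: (sm (Ordinal nN)).
have lg : forall k, (N <= k)%N -> ~ K k (src z') by near: z'.
by case: (lg n Nn).
Unshelve. all: by end_near. Qed.

(* A locally finite closed cover of [X] glues the local product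
   neighbourhoods [A p], [B p] into global ones; this is where paracompactness
   is needed. *)
Lemma whitney_prod (Q : set (Z1 * Z2)) w1 w2 :
  (forall p, nbhs (j1 w1 p, j2 w2 p) Q) ->
  \forall w \near (w1, w2), forall p, Q (j1 w.1 p, j2 w.2 p).
Proof.
move=> nQ; have [p0|noX] := pselect (exists p0 : X, True); last first.
  exists (setT, setT); first by split; exact: filterT.
  by move=> w _ p; case: noX; exists p.
have {p0} [p0 _] := p0.
have /choice[AB HAB] : forall p, exists AB : set Z1 * set Z2,
    [/\ open AB.1, open AB.2, AB.1 (j1 w1 p), AB.2 (j2 w2 p) &
        AB.1 `*` AB.2 `<=` Q].
  move=> p; have [[A B] /= [nA nB] ABQ] := nQ p.
  exists (A°, B°); split=> //=; try exact: open_interior.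
  by move=> [z1 z2] [/= /nbhs_singleton Az /nbhs_singleton Bz]; exact: ABQ.
have nU p : nbhs p [set q | (AB p).1 (j1 w1 q) /\ (AB p).2 (j2 w2 q)].
  have [oA oB Ap Bp _] := HAB p.
  apply: filterI.
    by apply: j1_cont; apply: open_nbhs_nbhs.
  by apply: j2_cont; apply: open_nbhs_nbhs.
have [K [s [clK KU covK lfK]]] := locally_finite_refinement regX scX p0 nU.
pose O1 := [set z | forall n, K n (src1 z) -> (AB (s n)).1 z].
pose O2 := [set z | forall n, K n (src2 z) -> (AB (s n)).2 z].
have oO1 : open O1.
  by apply: open_locally_finite => // n; case: (HAB (s n)).
have oO2 : open O2.
  by apply: open_locally_finite => // n; case: (HAB (s n)).
have n1 : nbhs w1 [set w | forall p, O1 (j1 w p)].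
  apply: open_nbhs_nbhs; split; first exact: open1.
  by move=> p n; rewrite src1K => /KU[].
have n2 : nbhs w2 [set w | forall p, O2 (j2 w p)].
  apply: open_nbhs_nbhs; split; first exact: open2.
  by move=> p n; rewrite src2K => /KU[].
exists ([set w | forall p, O1 (j1 w p)], [set w | forall p, O2 (j2 w p)]) => //.
move=> [v1 v2] [/= H1 H2] p; have [n Kp] := covK p.
have [_ _ _ _] := HAB (s n); apply; split=> /=.
  by apply: H1; rewrite src1K.
by apply: H2; rewrite src2K.
Qed.

End WhitneyProduct.

(** * Convergence in jet spaces *)

Section Jets.
Context {R : realType} {E F : normedModType R} {S T : Type}.
Variables (a : atlas E S) (b : atlas F T).
Hypotheses (ma : is_manifold a) (cover_b : forall q, exists c' : chart b, dom c' q).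
Local Notation X := (atlas_space a).

Lemma same_jetP r (f g : smooth_map a b) p q :
  jet r f p = jet r g q -> same_jet r (p, f) (q, g).
Proof.
move=> /(congr1 (@jet_class _ _ _ _ _ _ _ _)) /= /(congr1 (fun A => A (q, g))) ->.
by split.
Qed.

(** A subbasic set asks for some representative of the jet. As [vs] has length at most [r], its
    conditions depend on the jet only, hence hold for the given representative. *)
Lemma in_jet_subbase r (c : chart a) (c' : chart b) vs O O' f p :
  [set j | exists q (g : smooth_map a b),
     [/\ j = jet r g q, dom c q, dom c' (g q), O (coord c q) &
         O' (iterD vs (local_rep c c' g) (coord c q))]] (jet r f p) ->
  (size vs <= r)%N ->
  [/\ dom c p, dom c' (f p), O (coord c p) &
      O' (iterD vs (local_rep c c' f) (coord c p))].
Proof.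
move=> [q [g [/same_jetP[/= <- fg jfg] pc gc Op Op']]] vsr; split=> //.
  by rewrite fg.
by rewrite jfg// fg.
Qed.

(** Base points move together with the maps, as they do along a filter on a jet space;
    [jet_cvg_coord] is the converse. *)
Lemma jet_cvg (I : Type) (G : set_system I) (p : I -> X)
    (f : I -> smooth_map a b) p0 (f0 : smooth_map a b) r : Filter G ->
  p i @[i --> G] --> (p0 : X) ->
  (forall (c : chart a) (c' : chart b), dom c (p0 : S) -> dom c' (f0 p0) ->
    (\forall i \near G, dom c' (f i (p i))) /\
    forall vs, (size vs <= r)%N ->
      iterD vs (local_rep c c' (f i)) (coord c (p i)) @[i --> G] -->
      iterD vs (local_rep c c' f0) (coord c p0)) ->
  jet r (f i) (p i) @[i --> G] --> (jet r f0 p0 : jet_space a b r).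
Proof.
move=> FG pp0 H; apply: (cvg_generated (jet_space_generated a b r)).
move=> _ [c [c' [vs [Q [Q' [vsr oO oO' ->]]]]]].
move=> /in_jet_subbase/(_ vsr)[pc fc' Op Op'].
have [nc' nD] := H c c' pc fc'.
have npc := pp0 _ (near_dom pc).
have nO := pp0 _ (coord_cvg pc (open_nbhs_nbhs (conj oO Op))).
have nO' := nD vs vsr _ (open_nbhs_nbhs (conj oO' Op')).
near=> i; exists (p i), (f i); split=> //; near: i.
- exact: npc.
- exact: nc'.
- exact: nO.
- exact: nO'.
Unshelve. all: by end_near. Qed.

Lemma jet_continuous r (f : smooth_map a b) :
  continuous (jet r f : X -> jet_space a b r).
Proof.
move=> p; apply: (jet_cvg (G := nbhs (p : X)) (p := id) (f := fun=> f) _ cvg_id).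
move=> c c' pc fc'; have [near_c d_rep] :=
  smooth_differentiable_at (smooth_funP f) pc fc'.
have [oU sU] := smooth_funP f c c'.
split.
  have nc : \forall q \near p, exists q', [/\ dom c q', dom c' (f q') &
      coord c q' = coord c (q : S)] by exact: (coord_cvg pc near_c).
  apply: filterS2 (near_dom pc) nc.
  by move=> q qc [q' [q'c fq'c' /(coord_inj ma q'c qc) <-]].
move=> vs _.
have ex : (coord c @` (dom c `&` f @^-1` dom c')) (coord c p) by exists p.
exact: (cvg_comp _ _ (coord_cvg pc) (differentiable_continuous (sU vs _ ex))).
Qed.

Definition jet_source r (j : jet_space a b r) : X :=
  (sval (cid (jet_classP j))).1.

Lemma jet_sourceK r (f : smooth_map a b) p : jet_source (jet r f p) = p.
Proof.
rewrite /jet_source; case: cid => -[q g] /= H.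
have /same_jetP[] // : jet r f p = jet r g q.
by rewrite /jet; move: (ex_intro _ _ _) (ex_intro _ _ _); rewrite H => ? ?;
  congr JetSpace; exact: Prop_irrelevance.
Qed.

Lemma jet_spaceE r (j : jet_space a b r) : exists f p, j = jet r f p.
Proof.
case: j => C [[p f] CE]; exists f, p; rewrite /jet; subst C.
by congr JetSpace; exact: Prop_irrelevance.
Qed.

Lemma jet_source_continuous r : continuous (@jet_source r).
Proof.
move=> j; have [f [p ->]] := jet_spaceE j; rewrite /continuous_at jet_sourceK.
apply: (cvg_generated (F := nbhs (jet r f p)) (f := @jet_source r)
  (atlas_space_generated a) _) => _ [c [Q [oO ->]]] [pc Op].
have [c' fc'] := cover_b (f p).
(* Subbasic sets involve a target chart, hence the choice of [c'] at f p; the empty list and [setT]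
   leave the value in that chart free. *)
pose A : set (jet_space a b r) := [set j | exists (q : S) (g : smooth_map a b),
  [/\ j = jet r g q, dom c q, dom c' (g q), Q (coord c q) &
      setT (iterD [::] (local_rep c c' g) (coord c q))]].
have nA : nbhs (jet r f p) A.
  apply: open_nbhs_nbhs; split; last by exists p, f.
  apply: (jet_space_generated a b r).1; exists c, c', [::], Q, setT; split=> //.
  exact: openT.
apply: (@filterS _ (nbhs (jet r f p)) _ _ _ _ nA).
by move=> _ [q [g [-> qc _ Oq _]]]; rewrite /= jet_sourceK.
Qed.

Lemma whitney_open r (O : set (jet_space a b r)) : open O ->
  open [set f : smooth_map a b | forall p, O (jet r f p)].
Proof. by move=> oO; apply: (smooth_map_generated a b).1; exists r, O. Qed.

End Jets.

(** * Calculus of converging jets *)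

Section IteratedDerivatives.
Context {R : realType} {E : normedModType R} (U : set E).
Hypothesis oU : open U.

Lemma iterD_eqon (F : normedModType R) (f g : E -> F) vs x :
  (forall y, U y -> f y = g y) -> U x -> iterD vs f x = iterD vs g x.
Proof.
move=> fg Ux; apply: (iterD_eq vs oU); last exact: mem_set.
by move=> y /set_mem; exact: fg.
Qed.

Lemma iterDD (F : normedModType R) (f g : E -> F) vs x :
  smooth_on U f -> smooth_on U g -> U x ->
  iterD vs (fun y => f y + g y) x = iterD vs f x + iterD vs g x.
Proof.
elim/last_ind: vs f g => // vs v IH f g sf sg Ux; rewrite !iterD_rcons.
rewrite -IH//; [|exact: smooth_on_derive|exact: smooth_on_derive].
apply: iterD_eqon => // y Uy.
by apply: deriveD; apply: diff_derivable; exact: smooth_on_differentiable Uy.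
Qed.

Lemma iterD_lin (F1 F2 : normedModType R) (L : F1 -> F2) (f : E -> F1) vs x :
  linear L -> continuous L -> smooth_on U f -> U x ->
  iterD vs (fun y => L (f y)) x = L (iterD vs f x).
Proof.
move=> linL cL.
pose LL : {linear F1 -> F2} := HB.pack L (GRing.isLinear.Build R F1 F2 _ L linL).
have dL y : differentiable LL y by exact: linear_differentiable.
elim/last_ind: vs f => // vs v IH f sf Ux; rewrite !iterD_rcons.
rewrite -IH//; last exact: smooth_on_derive.
apply: iterD_eqon => // y Uy.
rewrite -[LHS]/('D_v (LL \o f) y) near_derive_comp//; last first.
  exact: smooth_on_differentiable Uy.
by rewrite deriveE// diff_lin.
Qed.

End IteratedDerivatives.

Section JetsConverge.
Context {R : realType} {E : normedModType R}.
Context {I : Type} {G : set_system I} {FG : Filter G}.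
Variables (U : set E) (x : I -> E) (x0 : E).
Hypotheses (oU : open U) (Ux0 : U x0) (Ux : \forall i \near G, U (x i)).
Hypothesis xx0 : x i @[i --> G] --> x0.

(** Convergence of r-jets at moving points, in coordinates. Smoothness on the common open set [U] is
    included because the rules of differentiation apply only there. *)
Definition jets_cvg (F : normedModType R) (r : nat) (h : I -> E -> F)
    (h0 : E -> F) : Prop :=
  [/\ forall i, smooth_on U (h i), smooth_on U h0 &
    forall vs, (size vs <= r)%N ->
      iterD vs (h i) (x i) @[i --> G] --> iterD vs h0 x0].

Lemma jets_cvg_cst (F : normedModType R) r (h0 : E -> F) :
  smooth_on U h0 -> jets_cvg r (fun=> h0) h0.
Proof.
move=> sh; split=> // vs _.
exact: (cvg_comp _ _ xx0 (differentiable_continuous (sh vs x0 Ux0))).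
Qed.

Lemma jets_cvg_eq (F : normedModType R) r (h h' : I -> E -> F) (h0 h0' : E -> F) :
  (forall i y, U y -> h i y = h' i y) -> (forall y, U y -> h0 y = h0' y) ->
  jets_cvg r h h0 -> jets_cvg r h' h0'.
Proof.
move=> hh' hh0' [sh sh0 ch]; split=> [i||vs vsr].
- apply: smooth_on_eq (sh i) => // y /set_mem; exact: hh'.
- apply: smooth_on_eq sh0 => // y /set_mem; exact: hh0'.
rewrite -(iterD_eqon oU vs hh0' Ux0).
apply: cvg_trans (ch vs vsr); apply: near_eq_cvg.
by apply: filterS Ux => i Ui; rewrite (iterD_eqon oU vs (hh' i) Ui).
Qed.

Lemma jets_cvgD (F : normedModType R) r (f g : I -> E -> F) (f0 g0 : E -> F) :
  jets_cvg r f f0 -> jets_cvg r g g0 ->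
  jets_cvg r (fun i y => f i y + g i y) (fun y => f0 y + g0 y).
Proof.
move=> [sf sf0 cf] [sg sg0 cg]; split=> [i||vs vsr]; try exact: smooth_onD.
rewrite (iterDD oU)//; apply: cvg_trans (cvgD (cf vs vsr) (cg vs vsr)).
apply: near_eq_cvg; apply: filterS Ux => i Ui.
by rewrite (iterDD oU).
Qed.

Lemma jets_cvg_lin (F1 F2 : normedModType R) (L : F1 -> F2) r
    (f : I -> E -> F1) (f0 : E -> F1) :
  linear L -> continuous L -> jets_cvg r f f0 ->
  jets_cvg r (fun i y => L (f i y)) (fun y => L (f0 y)).
Proof.
move=> linL cL [sf sf0 cf]; split=> [i||vs vsr].
- exact: (smooth_on_lin linL oU cL (sf i)).
- exact: (smooth_on_lin linL oU cL sf0).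
rewrite (iterD_lin oU vs linL cL sf0 Ux0).
apply: (@cvg_trans _ (L (iterD vs (f i) (x i)) @[i --> G])).
  apply: near_eq_cvg; apply: filterS Ux => i Ui.
  by rewrite (iterD_lin oU vs linL cL (sf i) Ui).
exact: (cvg_comp _ _ (cf vs vsr) (cL _)).
Qed.

Lemma jets_cvg_derive (F : normedModType R) r (f : I -> E -> F) (f0 : E -> F) v :
  jets_cvg r.+1 f f0 ->
  jets_cvg r (fun i y => 'D_v (f i) y) (fun y => 'D_v f0 y).
Proof.
move=> [sf sf0 cf]; split=> [i||vs vsr]; try exact: smooth_on_derive.
rewrite -iterD_rcons; under eq_fun do rewrite -iterD_rcons.
by apply: cf; rewrite size_rcons.
Qed.

Lemma jets_cvgW (F : normedModType R) r (f : I -> E -> F) (f0 : E -> F) :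
  jets_cvg r.+1 f f0 -> jets_cvg r f f0.
Proof. by move=> [sf sf0 cf]; split=> // vs /leqW; exact: cf. Qed.

(** Induction on the order: by the Leibniz rule a derivative of the product is a sum of two
    products, in each of which one factor has been differentiated and the other is kept at order
    [r]. *)
Lemma jets_cvg_scale (F : normedModType R) r (k : I -> E -> R^o) (k0 : E -> R^o)
    (f : I -> E -> F) (f0 : E -> F) :
  jets_cvg r k k0 -> jets_cvg r f f0 ->
  jets_cvg r (fun i y => k i y *: f i y) (fun y => k0 y *: f0 y).
Proof.
elim: r k k0 f f0 => [|r IH] k k0 f f0 ck cf.
  have [sk sk0 k_cvg] := ck; have [sf sf0 f_cvg] := cf.
  split=> [i||[]// _]; try exact: smooth_on_scale.
  by apply: cvgZ; [exact: (k_cvg [::])|exact: (f_cvg [::])].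
have [sk sk0 k_cvg] := ck; have [sf sf0 f_cvg] := cf.
split=> [i||vs]; try exact: smooth_on_scale.
case/lastP: vs => [_|vs v].
  by apply: cvgZ; [exact: (k_cvg [::])|exact: (f_cvg [::])].
rewrite size_rcons ltnS => vsr.
rewrite iterD_rcons; under eq_fun do rewrite iterD_rcons.
have c1 := IH _ _ _ _ (jets_cvgW ck) (jets_cvg_derive v cf).
have c2 := IH _ _ _ _ (jets_cvg_derive v ck) (jets_cvgW cf).
have [_ _] : jets_cvg r (fun i y => 'D_v (fun z => k i z *: f i z) y)
    (fun y => 'D_v (fun z => k0 z *: f0 z) y).
  apply: jets_cvg_eq (jets_cvgD c1 c2) => [i y Uy|y Uy].
    by rewrite derive_scale//; exact: smooth_on_differentiable Uy.
  by rewrite derive_scale//; exact: smooth_on_differentiable Uy.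
exact.
Qed.

Lemma jets_cvg_sum (F : normedModType R) r n (f : 'I_n -> I -> E -> F)
    (f0 : 'I_n -> E -> F) : (forall j, jets_cvg r (f j) (f0 j)) ->
  jets_cvg r (fun i y => \sum_j f j i y) (fun y => \sum_j f0 j y).
Proof.
elim: n f f0 => [|n IH] f f0 cf.
  apply: (@jets_cvg_eq _ _ (fun=> cst 0) _ (cst 0)) => [i y _|y _|].
  - by rewrite big_ord0.
  - by rewrite big_ord0.
  - exact/jets_cvg_cst/smooth_on_cst.
have cS := IH (fun j => f (lift ord0 j)) (fun j => f0 (lift ord0 j)).
apply: jets_cvg_eq (jets_cvgD (cf ord0) (cS _)) => [i y _|y _|j].
- by rewrite big_ord_recl.
- by rewrite big_ord_recl.
- exact: cf.
Qed.

Lemma jets_cvg_pair (F1 F2 : normedModType R) r (f : I -> E -> F1) (f0 : E -> F1)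
    (g : I -> E -> F2) (g0 : E -> F2) :
  jets_cvg r f f0 -> jets_cvg r g g0 ->
  jets_cvg r (fun i y => (f i y, g i y)) (fun y => (f0 y, g0 y)).
Proof.
move=> cf cg.
have c1 : jets_cvg r (fun i y => (f i y, 0 : F2)) (fun y => (f0 y, 0)).
  apply: (jets_cvg_lin (L := fun z : F1 => (z, 0 : F2)) _ _ cf).
  - by move=> k u v; congr pair; rewrite /= scaler0 addr0.
  - by move=> z; apply: cvg_pair => //=; exact: cvg_cst.
have c2 : jets_cvg r (fun i y => (0 : F1, g i y)) (fun y => (0, g0 y)).
  apply: (jets_cvg_lin (L := fun z : F2 => (0 : F1, z)) _ _ cg).
  - by move=> k u v; congr pair; rewrite /= scaler0 addr0.
  - by move=> z; apply: cvg_pair => //=; exact: cvg_cst.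
apply: jets_cvg_eq (jets_cvgD c1 c2) => [i y _|y _].
  by congr pair; rewrite /= ?addr0 ?add0r.
by congr pair; rewrite /= ?addr0 ?add0r.
Qed.

End JetsConverge.

(** * From continuity on jets to continuity in the Whitney topology *)

Section WhitneyContinuity.
Context {R : realType} {n : nat} {S : Type} (a : atlas 'rV[R]_n S).
Hypothesis ma : is_manifold a.
Local Notation X := (atlas_space a).

Lemma jet_cvg_coord (F : normedModType R) T (b : atlas F T) (I : Type)
    (G : set_system I) (p : I -> X) (f : I -> smooth_map a b) p0
    (f0 : smooth_map a b) r (c : chart a) (c' : chart b) : Filter G ->
  jet r (f i) (p i) @[i --> G] --> (jet r f0 p0 : jet_space a b r) ->
  dom c (p0 : S) -> dom c' (f0 p0) ->
  (\forall i \near G, dom c' (f i (p i))) /\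
  forall vs, (size vs <= r)%N ->
    iterD vs (local_rep c c' (f i)) (coord c (p i)) @[i --> G] -->
    iterD vs (local_rep c c' f0) (coord c p0).
Proof.
move=> FG jj0 pc fc'.
have near_sub vs (Q : set F) : (size vs <= r)%N -> open Q ->
    Q (iterD vs (local_rep c c' f0) (coord c p0)) ->
    \forall i \near G, [/\ dom c (p i), dom c' (f i (p i)), setT (coord c (p i)) &
      Q (iterD vs (local_rep c c' (f i)) (coord c (p i)))].
  move=> vsr oQ Qf.
  pose A : set (jet_space a b r) := [set j | exists (q : S) (g : smooth_map a b),
    [/\ j = jet r g q, dom c q, dom c' (g q), setT (coord c q) &
        Q (iterD vs (local_rep c c' g) (coord c q))]].
  have nA : nbhs (jet r f0 p0 : jet_space a b r) A.
    apply: open_nbhs_nbhs; split; last by exists p0, f0.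
    by apply: (jet_space_generated a b r).1; exists c, c', vs, setT, Q;
      split=> //; exact: openT.
  apply: (@filterS _ G _ _ _ _ (jj0 A nA)) => i.
  by move=> Ai; exact: (in_jet_subbase Ai vsr).
split.
  by apply: filterS (near_sub [::] setT isT openT Logic.I) => i [].
move=> vs vsr A; rewrite nbhsE => -[Q [oQ Qf] QA].
by apply: filterS (near_sub vs Q vsr oQ Qf) => i [_ _ _]; exact: QA.
Qed.

Context {F1 F2 F : normedModType R} {T1 T2 T : Type}.
Variables (b1 : atlas F1 T1) (b2 : atlas F2 T2) (b : atlas F T).
Hypotheses (cover1 : forall q, exists c' : chart b1, dom c' q)
  (cover2 : forall q, exists c' : chart b2, dom c' q).
Context {W1 W2 : topologicalType}.
Variables (g1 : W1 -> smooth_map a b1) (g2 : W2 -> smooth_map a b2).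
Hypotheses (cg1 : continuous g1) (cg2 : continuous g2).
Variable Phi : W1 * W2 -> smooth_map a b.

(** Reduces continuity to a local statement: the jet of the result depends continuously on the jets
    of the two arguments at the same point. [whitney_prod] then makes it uniform over the
    manifold. *)
Lemma whitney_continuous2 :
  (forall r (I : Type) (G : set_system I) (w : I -> W1 * W2) (p : I -> X)
    (w0 : W1 * W2) (p0 : X), Filter G -> p i @[i --> G] --> p0 ->
    jet r (g1 (w i).1) (p i) @[i --> G] --> (jet r (g1 w0.1) p0 : jet_space a b1 r) ->
    jet r (g2 (w i).2) (p i) @[i --> G] --> (jet r (g2 w0.2) p0 : jet_space a b2 r) ->
    jet r (Phi (w i)) (p i) @[i --> G] --> (jet r (Phi w0) p0 : jet_space a b r)) ->
  continuous Phi.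
Proof.
move=> local_cont [w1 w2].
apply: (cvg_generated (F := nbhs (w1, w2)) (smooth_map_generated a b) _).
move=> _ [r [Q [oQ ->]]] Qw.
pose j1 (w : W1) (p : X) : jet_space a b1 r := jet r (g1 w) p.
pose j2 (w : W2) (p : X) : jet_space a b2 r := jet r (g2 w) p.
pose J (t : (W1 * W2) * X) := (j1 t.1.1 t.2, j2 t.1.2 t.2).
(* Pairs of jets that force the jet of [Phi] into [Q], whatever maps and point realise them. The
   hypothesis along the [comap] filter makes [P] a neighbourhood; convergence of the base points
   comes from continuity of the source. *)
pose P := [set z | forall t, J t = z -> Q (jet r (Phi t.1) t.2)].
have nP p : nbhs (j1 w1 p, j2 w2 p) P.
  pose t0 := ((w1, w2), p).
  have Jt0 : J t @[t --> comap J (J t0)] --> J t0 by exact: cvg_comap.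
  have c1 : j1 t.1.1 t.2 @[t --> comap J (J t0)] --> j1 w1 p.
    exact: (cvg_comp _ _ Jt0 cvg_fst).
  have c2 : j2 t.1.2 t.2 @[t --> comap J (J t0)] --> j2 w2 p.
    exact: (cvg_comp _ _ Jt0 cvg_snd).
  have cp : t.2 @[t --> comap J (J t0)] --> p.
    have cs : jet_source j @[j --> j1 w1 p] --> jet_source (j1 w1 p).
      exact: jet_source_continuous.
    have := cvg_comp _ _ c1 cs; rewrite {2}/j1 jet_sourceK.
    rewrite (_ : _ \o _ = fun t : (W1 * W2) * X => t.2)//.
    by apply/funext => t; rewrite /= /j1 jet_sourceK.
  have := local_cont r _ _ fst snd (w1, w2) p (comap_filter J (J t0)) cp c1 c2.
  by move=> /(_ Q (open_nbhs_nbhs (conj oQ (Qw p)))).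
have o1 Q' : open Q' -> open [set w | forall p, Q' (j1 w p)].
  move=> oQ'; apply: (@open_comp _ _ g1 [set f | forall p, Q' (jet r f p)]).
    by move=> w _; exact: cg1.
  exact: whitney_open.
have o2 Q' : open Q' -> open [set w | forall p, Q' (j2 w p)].
  move=> oQ'; apply: (@open_comp _ _ g2 [set f | forall p, Q' (jet r f p)]).
    by move=> w _; exact: cg2.
  exact: whitney_open.
have := whitney_prod (atlas_space_regular ma) (manifold_second_countable ma)
  (@jet_source_continuous _ _ _ _ _ _ _ cover1 r)
  (@jet_source_continuous _ _ _ _ _ _ _ cover2 r)
  (fun w p => @jet_sourceK _ _ _ _ _ _ _ r (g1 w) p)
  (fun w p => @jet_sourceK _ _ _ _ _ _ _ r (g2 w) p)
  (fun w => @jet_continuous _ _ _ _ _ _ _ ma r (g1 w))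
  (fun w => @jet_continuous _ _ _ _ _ _ _ ma r (g2 w))
  o1 o2 nP.
apply: (@filterS _ (nbhs (w1, w2))) => w Pw p.
exact: (Pw p (w, p)).
Qed.

End WhitneyContinuity.

(** * Continuity of the structure maps *)

Lemma pair_continuous (Y T1 T2 : topologicalType) (f : Y -> T1) (g : Y -> T2) :
  continuous f -> continuous g -> continuous (fun y => (f y, g y)).
Proof. by move=> cf cg y; apply: cvg_pair; [exact: cf|exact: cg]. Qed.

Lemma continuous_comp2 (Y T1 T2 T3 : topologicalType) (h : T1 * T2 -> T3)
    (f : Y -> T1) (g : Y -> T2) :
  continuous h -> continuous f -> continuous g ->
  continuous (fun y => h (f y, g y)).
Proof.
move=> ch cf cg y A nA; exact: (pair_continuous cf cg (ch (f y, g y) A nA)).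
Qed.

Section ContinuityOfOperations.
Context {R : realType} {k m : nat} {G : lieGroup R k}.
Variable M : gManifold G m.
Local Notation aG := (lie_atlas G).
Local Notation aM := (mf_atlas M).
Local Notation X := (atlas_space aM).
Let mG : is_manifold aG := lie_manifold G.
Let mM : is_manifold aM := mf_manifold M.

Lemma initial_universal (Y T : topologicalType) (W : choiceType) (f : W -> T)
    (h : Y -> W) :
  continuous (f \o h) -> continuous (h : Y -> initial_topology f).
Proof.
move=> cfh y A [_ [[B oB <-] Bfs sBA]].
have nB : nbhs y ((f \o h) @^-1` B).
  by apply: cfh; apply: open_nbhs_nbhs.
by apply: (@filterS _ (nbhs y) _ _ _ _ nB) => z Bz; exact: sBA.
Qed.

(** Unary operations are treated as binary ones depending on the first argument only, restricted to
    the diagonal, so that one continuity criterion covers all cases. *)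
Let cvg_diag (Y : topologicalType) (y : Y) : (z, z) @[z --> y] --> (y, y).
Proof.
move=> A [[B C] /= [nB nC] BCA].
by apply: (@filterS2 _ (nbhs y) _ _ _ _ _ nB nC) => z Bz Cz; exact: BCA.
Qed.

Let field_map_continuous : continuous (@field_map R k G m M).
Proof. exact: (@initial_continuous _ _ (@field_map R k G m M)). Qed.

Let gauge_map_continuous : continuous (@gauge_map R k G m M).
Proof. exact: (@initial_continuous _ _ (@gauge_map R k G m M)). Qed.

Let cover_bundle (q : tangent_bundle aM) :
  exists c' : chart (tangent_bundle_atlas aM), dom c' q.
Proof. by have [c qc] := charts_cover mM (projT1 q); exists c. Qed.

Let cover_algebra (q : lie_algebra G) :
  exists c' : chart (lie_algebra_atlas G), dom c' q.
Proof. by have [c qc] := charts_cover mG (1%g : G); exists c. Qed.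

Section FieldJets.
Context {I : Type} {H : set_system I} {FH : Filter H}.
Variables (p : I -> X) (p0 : X) (r : nat).
Hypothesis pp0 : p i @[i --> H] --> p0.
Variable c : chart aM.
Hypothesis p0c : dom c (p0 : M).

Let x i := coord c (p i : M).
Section Charts.
Variable c' : chart aM.
Hypothesis p0c' : dom c' (p0 : M).

Definition overlap : set 'rV[R]_m := coord c @` (dom c `&` dom c').

Let p_overlap : \forall i \near H, dom c (p i : M) /\ dom c' (p i : M).
Proof.
have h := pp0 (near_dom p0c); have h' := pp0 (near_dom p0c').
by apply: (@filterS2 _ H _ _ _ _ _ h h') => i.
Qed.

Lemma near_overlap : \forall i \near H, overlap (x i).
Proof. by apply: filterS p_overlap => i ici; exists (p i). Qed.

Definition field_rep (Y : equivariant_field M) :=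
  local_rep (b := tangent_bundle_atlas aM) c c' (field_map Y).

Lemma field_repE Y q : dom c q -> field_rep Y (coord c q) = (coord c' q, Y q c').
Proof. by move=> qc; rewrite /field_rep local_repE. Qed.

Lemma field_jets_cvg (Y : I -> equivariant_field M) Y0 :
  jet r (field_map (Y i)) (p i) @[i --> H] --> (jet r (field_map Y0) p0 :
    jet_space aM (tangent_bundle_atlas aM) r) ->
  jets_cvg (G := H) overlap x (coord c (p0 : M)) r (fun i => field_rep (Y i))
    (field_rep Y0).
Proof.
move=> jY; split=> [i||].
- by have [] := field_smooth (Y i) c c'.
- by have [] := field_smooth Y0 c c'.
by have [] := jet_cvg_coord (c' := c' : chart (tangent_bundle_atlas aM)) FH jY p0c p0c'.
Qed.

End Charts.

Lemma cvg_field_jet (Y : I -> equivariant_field M) Y0 :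
  (forall c' : chart aM, dom c' (p0 : M) ->
   jets_cvg (G := H) (overlap c') x (coord c (p0 : M)) r
     (fun i => field_rep c' (Y i)) (field_rep c' Y0)) ->
  forall c' : chart (tangent_bundle_atlas aM), dom c' (field_map Y0 p0) ->
    (\forall i \near H, dom c' (field_map (Y i) (p i))) /\
    forall vs, (size vs <= r)%N ->
      iterD vs (local_rep c c' (field_map (Y i))) (coord c (p i : M)) @[i --> H] -->
      iterD vs (local_rep c c' (field_map Y0)) (coord c (p0 : M)).
Proof.
move=> cY c'; change (chart (tangent_bundle_atlas aM)) with (chart aM) in c'.
move=> p0c'; have [_ _ cvs] := cY c' p0c'; split=> //.
exact: (pp0 (near_dom (p0c' : dom c' (p0 : M)))).
Qed.

Section GaugeJets.
Variable cG : chart aG.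
Hypothesis cG1 : dom cG (1%g : G).

Definition gauge_rep (psi : gauge M) :=
  local_rep (b := lie_algebra_atlas G) c cG (gauge_map psi).

Lemma gauge_repE psi q : dom c q -> gauge_rep psi (coord c q) = psi q cG.
Proof. by move=> qc; rewrite /gauge_rep local_repE. Qed.

Lemma gauge_jets_cvg (U : set 'rV[R]_m) (psi : I -> gauge M) psi0 :
  U `<=` coord c @` dom c ->
  jet r (gauge_map (psi i)) (p i) @[i --> H] --> (jet r (gauge_map psi0) p0 :
    jet_space aM (lie_algebra_atlas G) r) ->
  jets_cvg (G := H) U x (coord c (p0 : M)) r (fun i => gauge_rep (psi i))
    (gauge_rep psi0).
Proof.
move=> Uc jpsi.
have sU (phi : gauge M) : smooth_on U (gauge_rep phi).
  have [_ sphi] := gauge_smooth phi c cG.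
  by apply: smooth_on_subset sphi => _ /Uc[q qc <-]; exists q.
split=> //.
by have [] := jet_cvg_coord (c' := cG : chart (lie_algebra_atlas G)) FH jpsi p0c cG1.
Qed.

End GaugeJets.

Lemma cvg_gauge_jet (psi : I -> gauge M) psi0 :
  (forall cG : chart aG, dom cG (1%g : G) ->
   jets_cvg (G := H) (coord c @` dom c) x (coord c (p0 : M)) r
     (fun i => gauge_rep cG (psi i)) (gauge_rep cG psi0)) ->
  forall cG : chart (lie_algebra_atlas G), dom cG (gauge_map psi0 p0) ->
    (\forall i \near H, dom cG (gauge_map (psi i) (p i))) /\
    forall vs, (size vs <= r)%N ->
      iterD vs (local_rep c cG (gauge_map (psi i))) (coord c (p i : M)) @[i --> H] -->
      iterD vs (local_rep c cG (gauge_map psi0)) (coord c (p0 : M)).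
Proof.
move=> cpsi cG; change (chart (lie_algebra_atlas G)) with (chart aG) in cG.
move=> cG1; have [_ _ cvs] := cpsi cG cG1; split=> //.
exact: (@filterE _ H).
Qed.

Lemma open_dom : open (coord c @` dom c).
Proof.
have [+ _] := charts_compatible mM c c.
by rewrite (_ : _ `&` _ = dom c)//; apply/seteqP; split=> [q []|q].
Qed.

Lemma near_coord_dom : \forall i \near H, (coord c @` dom c) (x i).
Proof.
by apply: (@filterS _ H _ _ _ _ (pp0 (near_dom p0c))) => i ic; exists (p i).
Qed.

End FieldJets.

Let near_field_setup (I : Type) (H : set_system I) (p : I -> X) (p0 : X)
    (c c' : chart aM) : Filter H -> p i @[i --> H] --> p0 ->
  dom c (p0 : M) -> dom c' (p0 : M) ->
  [/\ open (overlap c c'), overlap c c' (coord c (p0 : M)),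
      \forall i \near H, overlap c c' (coord c (p i : M)) &
      coord c (p i : M) @[i --> H] --> coord c (p0 : M)].
Proof.
move=> FH pp0 p0c p0c'; split.
- exact: open_chart_overlap.
- by exists p0.
- exact: (near_overlap (FH := FH) pp0 p0c p0c').
- exact: (cvg_comp _ _ pp0 (coord_cvg p0c)).
Qed.

Let near_gauge_setup (I : Type) (H : set_system I) (p : I -> X) (p0 : X)
    (c : chart aM) : Filter H -> p i @[i --> H] --> p0 -> dom c (p0 : M) ->
  [/\ open (coord c @` dom c), (coord c @` dom c) (coord c (p0 : M)),
      \forall i \near H, (coord c @` dom c) (coord c (p i : M)) &
      coord c (p i : M) @[i --> H] --> coord c (p0 : M)].
Proof.
move=> FH pp0 p0c; split.
- exact: open_dom.
- by exists p0.
- exact: (near_coord_dom (FH := FH) pp0 p0c).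
- exact: (cvg_comp _ _ pp0 (coord_cvg p0c)).
Qed.

Lemma field_add_continuous :
  continuous (fun w : equivariant_field M * equivariant_field M => w.1 + w.2).
Proof.
apply: (initial_universal (f := @field_map R k G m M)).
apply: (whitney_continuous2 mM cover_bundle cover_bundle field_map_continuous
  field_map_continuous) => r I H w p [Y0 Z0] p0 FH pp0 jY jZ.
apply: (jet_cvg FH pp0) => c c0 p0c.
apply: (cvg_field_jet pp0 (Y := fun i => (w i).1 + (w i).2)) => {c0}c' p0c'.
have [oU Ux0 Ux _] := near_field_setup FH pp0 p0c p0c'.
have cY := field_jets_cvg (FH := FH) p0c p0c' jY.
have cZ := field_jets_cvg (FH := FH) p0c p0c' jZ.
(* A representative of a field contains the base point as first component. It must not be added, so
   it is removed from the second summand; for the opposite field it is likewise kept unchanged. *)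
have lin0 : linear (fun z : 'rV[R]_m * 'rV[R]_m => (0 : 'rV[R]_m, z.2)).
  by move=> a u v; congr pair; rewrite /= scaler0 addr0.
have c0 : continuous (fun z : 'rV[R]_m * 'rV[R]_m => (0 : 'rV[R]_m, z.2)).
  apply: (pair_continuous (f := cst 0) (g := snd)) => z; first exact: cvg_cst.
  exact: cvg_snd.
have := jets_cvgD (FG := FH) oU Ux0 Ux cY (jets_cvg_lin (FG := FH) oU Ux0 Ux lin0 c0 cZ).
apply: (jets_cvg_eq (FG := FH) oU Ux0 Ux) => [i _ [q [qc qc'] <-]|_ [q [qc qc'] <-]].
  by rewrite !field_repE//; congr pair; rewrite /= addr0.
by rewrite !field_repE//; congr pair; rewrite /= addr0.
Qed.

Lemma field_opp_continuous : continuous (fun Y : equivariant_field M => - Y).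
Proof.
pose Phi (w : equivariant_field M * equivariant_field M) := - w.1.
suff cPhi : continuous Phi.
  by move=> Y A nA; exact: (cvg_diag (cPhi (Y, Y) A nA)).
apply: (initial_universal (f := @field_map R k G m M)).
apply: (whitney_continuous2 mM cover_bundle cover_bundle field_map_continuous
  field_map_continuous) => r I H w p [Y0 Z0] p0 FH pp0 jY _.
apply: (jet_cvg FH pp0) => c c0 p0c.
apply: (cvg_field_jet pp0 (Y := fun i => - (w i).1)) => {c0}c' p0c'.
have [oU Ux0 Ux _] := near_field_setup FH pp0 p0c p0c'.
have cY := field_jets_cvg (FH := FH) p0c p0c' jY.
have lin0 : linear (fun z : 'rV[R]_m * 'rV[R]_m => (z.1, - z.2)).
  by move=> a u v; congr pair; rewrite /= scalerN opprD.
have c0 : continuous (fun z : 'rV[R]_m * 'rV[R]_m => (z.1, - z.2)).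
  apply: (pair_continuous (f := fst) (g := fun z => - z.2)) => z.
    exact: cvg_fst.
  by apply: cvgN; exact: cvg_snd.
have := jets_cvg_lin (FG := FH) oU Ux0 Ux lin0 c0 cY.
apply: (jets_cvg_eq (FG := FH) oU Ux0 Ux) => [i _ [q [qc qc'] <-]|_ [q [qc qc'] <-]].
  by rewrite !field_repE.
by rewrite !field_repE.
Qed.

Lemma gauge_add_continuous :
  continuous (fun w : gauge M * gauge M => w.1 + w.2).
Proof.
apply: (initial_universal (f := @gauge_map R k G m M)).
apply: (whitney_continuous2 mM cover_algebra cover_algebra gauge_map_continuous
  gauge_map_continuous) => r I H w p [Y0 Z0] p0 FH pp0 jY jZ.
apply: (jet_cvg FH pp0) => c c0 p0c.
apply: (cvg_gauge_jet (psi := fun i => (w i).1 + (w i).2)) => {c0}cG cG1.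
have [oU Ux0 Ux _] := near_gauge_setup FH pp0 p0c.
have cY := gauge_jets_cvg (FH := FH) p0c cG1 (@subset_refl _ _) jY.
have cZ := gauge_jets_cvg (FH := FH) p0c cG1 (@subset_refl _ _) jZ.
have := jets_cvgD (FG := FH) oU Ux0 Ux cY cZ.
apply: (jets_cvg_eq (FG := FH) oU Ux0 Ux) => [i _ [q qc <-]|_ [q qc <-]].
  by rewrite !gauge_repE.
by rewrite !gauge_repE.
Qed.

Lemma gauge_opp_continuous : continuous (fun psi : gauge M => - psi).
Proof.
pose Phi (w : gauge M * gauge M) := - w.1.
suff cPhi : continuous Phi.
  by move=> Y A nA; exact: (cvg_diag (cPhi (Y, Y) A nA)).
apply: (initial_universal (f := @gauge_map R k G m M)).
apply: (whitney_continuous2 mM cover_algebra cover_algebra gauge_map_continuous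
  gauge_map_continuous) => r I H w p [Y0 Z0] p0 FH pp0 jY _.
apply: (jet_cvg FH pp0) => c c0 p0c.
apply: (cvg_gauge_jet (psi := fun i => - (w i).1)) => {c0}cG cG1.
have [oU Ux0 Ux _] := near_gauge_setup FH pp0 p0c.
have cY := gauge_jets_cvg (FH := FH) p0c cG1 (@subset_refl _ _) jY.
have lin0 : linear (fun z : 'rV[R]_k => - z).
  by move=> a u v; rewrite scalerN opprD.
have := jets_cvg_lin (FG := FH) oU Ux0 Ux lin0 (@opp_continuous _) cY.
apply: (jets_cvg_eq (FG := FH) oU Ux0 Ux) => [i _ [q qc <-]|_ [q qc <-]].
  by rewrite !gauge_repE.
by rewrite !gauge_repE.
Qed.

(** By [induced_atE] a representative is the change of charts paired with a sum of products of
    components of [psi] with fixed smooth coefficients, and each of these operations preserves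
    convergence of jets without loss of order. *)
Lemma induced_field_continuous : continuous (@induced_field R k m G M).
Proof.
pose Phi (w : gauge M * gauge M) := induced_field w.1.
suff cPhi : continuous Phi.
  by move=> psi A nA; exact: (cvg_diag (cPhi (psi, psi) A nA)).
apply: (initial_universal (f := @field_map R k G m M)).
apply: (whitney_continuous2 mM cover_algebra cover_algebra gauge_map_continuous
  gauge_map_continuous) => r I H w p [psi0 Z0] p0 FH pp0 jpsi _.
apply: (jet_cvg FH pp0) => c c0 p0c.
apply: (cvg_field_jet pp0 (Y := fun i => induced_field (w i).1)) => {c0}c' p0c'.
have [oU Ux0 Ux xx0] := near_field_setup FH pp0 p0c p0c'.
have [cG cG1] := charts_cover mG (1%g : G).
have Uc : overlap c c' `<=` coord c @` dom c by move=> _ [q [qc _] <-]; exists q.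
have cpsi := gauge_jets_cvg (FH := FH) p0c cG1 Uc jpsi.
have cid : jets_cvg (G := H) (overlap c c') (fun i => coord c (p i : M))
    (coord c (p0 : M)) r (fun=> local_rep c c' id) (local_rep c c' id).
  apply: jets_cvg_cst => //.
  by have [] := charts_compatible mM c c'.
have ccoef j : jets_cvg (G := H) (overlap c c') (fun i => coord c (p i : M))
    (coord c (p0 : M)) r (fun=> @induced_coef R k m G M cG c c' j)
    (@induced_coef R k m G M cG c c' j).
  by apply: jets_cvg_cst => //; exact: induced_coef_smooth.
have ccomp j : jets_cvg (G := H) (overlap c c') (fun i => coord c (p i : M))
    (coord c (p0 : M)) r (fun i y => (gauge_rep c cG (w i).1 y 0 j : R^o))
    (fun y => (gauge_rep c cG psi0 y 0 j : R^o)).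
  apply: (jets_cvg_lin (FG := FH) oU Ux0 Ux (L := fun z : 'rV[R]_k => (z 0 j : R^o)) _ _ cpsi).
  - by move=> a u v; rewrite !mxE.
  - exact: coord_continuous.
have csum := jets_cvg_sum (FG := FH) oU Ux0 Ux xx0
  (fun j => jets_cvg_scale (FG := FH) oU Ux0 Ux (ccomp j) (ccoef j)).
have := jets_cvg_pair (FG := FH) oU Ux0 Ux cid csum.
apply: (jets_cvg_eq (FG := FH) oU Ux0 Ux) => [i _ [q [qc qc'] <-]|_ [q [qc qc'] <-]].
  rewrite field_repE// local_repE//=; congr pair.
  rewrite (induced_atE cG1 _ qc qc'); apply: eq_bigr => j _.
  by rewrite gauge_repE.
rewrite field_repE// local_repE//=; congr pair.
rewrite (induced_atE cG1 _ qc qc'); apply: eq_bigr => j _.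
by rewrite gauge_repE.
Qed.

Local Notation mor := (gauge M * equivariant_field M)%type.

Let comp_continuous (A B T : topologicalType) (f : B -> T) (h : A -> B) :
  continuous f -> continuous h -> continuous (fun x => f (h x)).
Proof. by move=> cf ch x; exact: (cvg_comp _ _ (ch x) (cf (h x))). Qed.

Let fst_continuous (A B : topologicalType) : continuous (@fst A B).
Proof. by move=> z; exact: cvg_fst. Qed.

Let snd_continuous (A B : topologicalType) : continuous (@snd A B).
Proof. by move=> z; exact: cvg_snd. Qed.

Let proj11 : continuous (fun x : mor * mor => x.1.1).
Proof. exact: (comp_continuous (@fst_continuous _ _) (@fst_continuous _ _)). Qed.
Let proj12 : continuous (fun x : mor * mor => x.1.2).
Proof. exact: (comp_continuous (@snd_continuous _ _) (@fst_continuous _ _)). Qed.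
Let proj21 : continuous (fun x : mor * mor => x.2.1).
Proof. exact: (comp_continuous (@fst_continuous _ _) (@snd_continuous _ _)). Qed.
Let proj22 : continuous (fun x : mor * mor => x.2.2).
Proof. exact: (comp_continuous (@snd_continuous _ _) (@snd_continuous _ _)). Qed.

Lemma morphism_add_continuous :
  continuous (fun x : mor * mor => (x.1.1 + x.2.1, x.1.2 + x.2.2)).
Proof.
exact: (pair_continuous (continuous_comp2 gauge_add_continuous proj11 proj21)
  (continuous_comp2 field_add_continuous proj12 proj22)).
Qed.

Lemma morphism_opp_continuous : continuous (fun x : mor => (- x.1, - x.2)).
Proof.
exact: (pair_continuous
  (comp_continuous gauge_opp_continuous (@fst_continuous _ _))
  (comp_continuous field_opp_continuous (@snd_continuous _ _))).
Qed.

Lemma target_continuous : continuous (fun x : mor => x.2 + induced_field x.1).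
Proof.
exact: (continuous_comp2 field_add_continuous (@snd_continuous _ _)
  (comp_continuous induced_field_continuous (@fst_continuous _ _))).
Qed.

Lemma unit_continuous : continuous (fun Y : equivariant_field M => (0 : gauge M, Y)).
Proof.
apply: (pair_continuous (f := cst 0) (g := id)); last by move=> Y; exact: cvg_id.
by move=> Y A nA; apply: (@nearW _ (nbhs Y)) => Z; exact: nbhs_singleton nA.
Qed.

Lemma composition_continuous :
  continuous (fun x : mor * mor => (x.1.1 + x.2.1, x.2.2)).
Proof.
exact: (pair_continuous (continuous_comp2 gauge_add_continuous proj11 proj21)
  proj22).
Qed.

End ContinuityOfOperations.

Theorem theorem5p24 (R : realType) (k m : nat) (G : lieGroup R k)
    (M : gManifold G m) :
  exists d : gauge M -> equivariant_field M,
    (forall psi : gauge M, is_induced_field psi (d psi)) /\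
    topological_abelian_2group (action_groupoid d).
Proof.
exists (@induced_field R k m G M); split; first exact: induced_fieldP.
have d0 : induced_field (0 : gauge M) = 0.
  apply: (addrI (induced_field 0)).
  by rewrite -induced_fieldD !addr0.
split.
- split.
  + by [].
  + by move=> x /=; rewrite d0 addr0.
  + by [].
  + move=> f g; rewrite /composable /= => fg.
    by rewrite fg induced_fieldD [induced_field f.1 + _]addrC addrA.
  + by case=> psi Y /=; rewrite add0r.
  + by case=> psi Y /=; rewrite addr0.
  + by move=> f g h _ _ /=; rewrite addrA.
- split; [exact: field_add_continuous|exact: field_opp_continuous].
- split; [exact: morphism_add_continuous|exact: morphism_opp_continuous].
- by [].
- by move=> f g /=; rewrite induced_fieldD addrACA.
- by move=> x y /=; congr pair; rewrite /= addr0.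
- by move=> f g f' g' _ _ /=; congr pair; rewrite /= addrACA.
- by move=> f; exact: cvg_snd.
- exact: target_continuous.
- exact: unit_continuous.
by apply: continuous_subspaceT; exact: composition_continuous.
Qed.
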